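(* Let $F_\bullet:\mathbb{C}\times\mathbb{C}^n\to\mathbb{C}^n$, $(t,x)\mapsto F_t(x)$, be a polynomial map given by an arithmetic circuit. Let $(x,r,A)$ be a $\frac78$-Moore box for $F_0$ with associated zero $\zeta$. Let $I\subseteq\mathbb{R}$ and $Z:I\to\mathbb{C}^n$ be the maximal interval and the continuation of the zero $\zeta$, as defined in the context. Then the algorithm $\mathtt{track}$ described in the context, on input $F_\bullet,x,r,A$, terminates if and only if $1\in I$. In this case, it outputs a $\frac78$-Moore box for $F_1$ with associated zero $Z_1$.
   Context: **Norm, Moore boxes.** $\|\cdot\|$ is the norm on $\mathbb{C}^n$ given by $\|(z_1,\dots,z_n)\|=\max_i\max(|\mathrm{Re}\,z_i|,|\mathrm{Im}\,z_i|)$ and $B$ is its closed unit ball. For a polynomial map $f:\mathbb{C}^n\to\mathbb{C}^n$ and $\rho\in(0,1)$, a $\rho$-Moore box for $f$ is a triple $(x,r,A)\in\mathbb{C}^n\times\mathbb{R}_{>0}\times\mathbb{C}^{n\times n}$ such that $\|-r^{-1}Af(x)+(I_n-A\,\mathrm{d}f(x+ru))v\|\le\rho$ for all $u,v\in B$. There is then a unique zero of $f$ in $x+rB$, called the associated zero of the box, and $\mathrm{d}f$ is invertible there. **Continuation.** $\mathrm{d}F_t$ is the differential of $F_t:\mathbb{C}^n\to\mathbb{C}^n$ and $\dot F_t$ the partial derivative of $F_t$ with respect to $t$. For a regular zero $\zeta$ of $F_0$ (i.e. $F_0(\zeta)=0$ and $\mathrm{d}F_0(\zeta)$ invertible), $I\subseteq\mathbb{R}$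 is the unique open interval containing $0$, and $Z:I\to\mathbb{C}^n$, $t\mapsto Z_t$, the unique continuous function, such that: (i) $Z_0=\zeta$; (ii) $F_t(Z_t)=0$ for all $t\in I$; (iii) if $b\in\overline I\setminus I$, then either $\lim_{t\to b}\|Z_t\|=\infty$ or $\lim_{t\to b}\det(\mathrm{d}F_t(Z_t))=0$. Concretely, $(I,Z)$ is the maximal solution of the differential equation $\frac{\mathrm{d}}{\mathrm{d}t}Z_t=-\mathrm{d}F_t(Z_t)^{-1}\cdot\dot F_t(Z_t)$, $Z_0=\zeta$, on the domain where $\mathrm{d}F_t$ is invertible. **Circuits.** An arithmetic circuit with input space $\mathbb{C}^N$ is a finite directed acyclic multigraph whose nodes are input nodes (labelled in $\{1,\dots,N\}$), constant nodes, and addition and multiplication nodes with exactly two incoming edges; each node computes a polynomial function in the obvious way, and a tuple of $m$ nodes represents a polynomial map to $\mathbb{C}^m$. Circuits for derivatives are obtained by automatic differentiation. Constants of circuits are representable (see below). **Interval arithmetic with adaptive precision.** $\mathbb{F}\subset\mathbb{R}$ is the set of representable numbers (for instance the dyadic numbers $a2^b$, $a,b\in\mathbb{Z}$), closed under addition, subtraction and multiplication and containing $1/2$. $\square\mathbb{R}$ is the set of nonempty compact intervals with endpoints in $\mathbb{F}$; $\square\mathbb{C}$ is the set of pairs of elements of $\square\mathbb{R}$ (real and imaginary parts); $\square\mathbb{C}^n$ is the set of vectors of such boxes, viewed as subsets of $\mathbb{C}^n$. There are operations $\boxplus,\boxtimes$ on $\square\mathbb{R}$, depending on a parameter $u_{\mathrm{prec}}\in(0,1)$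 (the unit roundoff, which the algorithm may change), with $x+y\in I\boxplus J$ and $xy\in I\boxtimes J$ for $x\in I$, $y\in J$, and such that for any $M\ge1$ and any $[a,b],[c,d]\in\square\mathbb{R}$ included in $[-M,M]$, $[a,b]\boxplus[c,d]\subseteq[a+c-Mu_{\mathrm{prec}},\,b+d+Mu_{\mathrm{prec}}]$ and $[a,b]\boxtimes[c,d]\subseteq[\min(ac,ad,bc,bd)-M^2u_{\mathrm{prec}},\,\max(ac,ad,bc,bd)+M^2u_{\mathrm{prec}}]$. These operations are extended to complex boxes, vectors and matrices by the usual formulas (negation of an interval is exact). For a map $f$ given by a circuit, $\square f$ and $\square\mathrm{d}f$ are the natural interval extensions, obtained by evaluating the circuits of $f$ and $\mathrm{d}f$ with $\boxplus,\boxtimes$ and replacing constants $c$ by $[c,c]$. For $T\in\square\mathbb{R}$, $\square F_T$ and $\square\mathrm{d}F_T$ denote the interval functions on $\square\mathbb{C}^n$ obtained by evaluating in the same way the circuits of $F_\bullet$ and $\mathrm{d}F_\bullet$ with the parameter input replaced by the interval $T$. For a box $X$: $\mathrm{width}(X)=\sup_{x,y\in X}\|x-y\|$, $\|X\|_\square=\sup_{x\in X}\|x\|$, and $\mathrm{mid}(X)$ is a representable element of $X$ (close to its center). The inputs $x,r,A$ are representable. **Test $\mathtt{M}$.** Given interval functions $\square f,\square\mathrm{d}f$, $\mathtt{M}(\square f,\square\mathrm{d}f,x,r,A,\rho)$ computes in interval arithmetic the box $K=-r^{-1}A\cdot\square f(x)+(I_n-A\cdot\square\mathrm{d}f(x+rB))\cdot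 B$ (where $A\cdot\square f(x)$ is computed first and then scaled by $r^{-1}$, this scaling multiplying the box by $r^{-1}$) and returns True if and only if $\|K\|_\square\le\rho$. **Algorithm $\mathtt{refine}(f,x,r,A,\tau)$** (input: a $\frac78$-Moore box for $f$, and $\tau\in(0,1)$). 1. $y\gets x$; $s\gets r$; $U\gets A$. 2. While $\mathtt{M}(\square f,\square\mathrm{d}f,y,s,U,\tau)$ is not True, do: (a) $\delta\gets A\cdot\square f(y)$ (interval arithmetic). (b) If $\|\delta\|_\square\le\frac1{64}\tau s$: set $s\gets\frac12s$, and then, if $s<\frac1{16}\tau r$, increase the precision enough so that $u_{\mathrm{prec}}=o(s)$. Else if $\mathrm{width}(y-\delta)>\frac1{40}\|\delta\|_\square$: increase the working precision. Else: $y\gets\mathrm{mid}(y-\delta)$. (c) (in all cases) $U\gets\mathrm{mid}(\square\mathrm{d}f(y))^{-1}$, computed in unchecked arithmetic. 3. While $2s\le1$ and $\mathtt{M}(\square f,\square\mathrm{d}f,y,2s,U,\tau)$ is True: $s\gets2s$. 4. Return $(y,s,U)$. **Algorithm $\mathtt{track}(F_\bullet,x,r,A)$.** 1. $t\gets0$; $h\gets1$. 2. While $t<1$, do: (a) $(x,r,A)\gets\mathtt{refine}(F_t,x,r,A,\frac18)$. (b) $h\gets2h$; $T\gets[t,t+h]$. (c) While $\mathtt{M}(\square F_T,\square\mathrm{d}F_T,x,r,A,\frac78)$ is not True: $h\gets\frac12h$; $T\gets[t,t+h]$; if $u_{\mathrm{prec}}>h$, increase the working precision. (d) $t\gets\sup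 T$. 3. Return $(x,r,A)$. Conventions: the precision is never lowered during a run; increasing the working precision infinitely often makes $u_{\mathrm{prec}}\to0$; ''increase the precision enough so that $u_{\mathrm{prec}}=o(s)$'' means that $u_{\mathrm{prec}}$ is lowered, if necessary, so that $u_{\mathrm{prec}}\le\omega(s)$ for a fixed function $\omega:(0,\infty)\to(0,1)$ with $\omega(s)/s\to0$ as $s\to0$. The matrix $U$ computed in step 2(c) of $\mathtt{refine}$ (with $f=F_t$) is representable and only has to satisfy $U-\mathrm{d}F_t(y)^{-1}\to0$ as $u_{\mathrm{prec}}\to0$, uniformly for $(t,y)$ in any compact set on which $\mathrm{d}F_t(y)$ is invertible. *)

(* Defs.v *)
(* The field C is R[i] for an arbitrary R : realType. *)
From HB Require Import structures.
From mathcomp Require Import all_boot all_order all_algebra.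
From mathcomp Require Import all_classical all_reals all_analysis.
From mathcomp.real_closed Require Import complex.
(* The notations of mpoly clash with those of MathComp-Analysis. *)
From mathcomp.multinomials Require Import -(notations) mpoly.
Set Implicit Arguments.
Unset Strict Implicit.
Unset Printing Implicit Defensive.
Import Order.TTheory GRing.Theory Num.Theory.
Import numFieldNormedType.Exports.
Local Open Scope classical_set_scope.
Local Open Scope ring_scope.

Section Norm.
Variable R : realType.

Definition cabs (z : R[i]) : R := Num.max `|complex.Re z| `|complex.Im z|.

Definition cnorm n (z : 'cV[R[i]]_n) : R := \big[Num.max/0]_(i < n) cabs (z i 0).

Definition cscale m n (a : R) (A : 'M[R[i]]_(m, n)) : 'M[R[i]]_(m, n) :=
  (a%:C)%C *: A.

(* C^n carries the topology of R^n x R^n. *)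
Definition coords n (p : R * 'cV[R[i]]_n) : R * ('rV[R]_n * 'rV[R]_n) :=
  (p.1, (map_mx (@complex.Re R) p.2^T, map_mx (@complex.Im R) p.2^T)).

Definition ccompact n (K : set (R * 'cV[R[i]]_n)) : Prop :=
  compact [set coords p | p in K].

End Norm.

Section Moore.
Variables (R : realType) (n : nat).
Variables (f : 'cV[R[i]]_n -> 'cV[R[i]]_n) (df : 'cV[R[i]]_n -> 'M[R[i]]_n).

Definition moore_box (rho : R) (x : 'cV[R[i]]_n) (r : R) (A : 'M[R[i]]_n) : Prop :=
  0 < r /\
  forall u v : 'cV[R[i]]_n, cnorm u <= 1 -> cnorm v <= 1 ->
    cnorm (- cscale r^-1 (A *m f x) + (1%:M - A *m df (x + cscale r u)) *m v)
      <= rho.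

Definition associated_zero (x : 'cV[R[i]]_n) (r : R) (z : 'cV[R[i]]_n) : Prop :=
  unique (fun z' => f z' = 0 /\ cnorm (z' - x) <= r) z.

End Moore.

(* A polynomial map C x C^n -> C^n is a family of n polynomials in n.+1
   variables; variable ord0 is t and variable lift ord0 j is the j-th
   coordinate of x. *)
Section Family.
Variables (R : realType) (n : nat) (F : 'I_n -> mpoly n.+1 R[i]).

Definition family_point (t : R) (x : 'cV[R[i]]_n) (i : 'I_n.+1) : R[i] :=
  if unlift ord0 i is Some j then x j 0 else (t%:C)%C.

Definition Fmap (t : R) (x : 'cV[R[i]]_n) : 'cV[R[i]]_n :=
  \col_i meval (family_point t x) (F i).

Definition dFmap (t : R) (x : 'cV[R[i]]_n) : 'M[R[i]]_n :=
  \matrix_(i, j) meval (family_point t x) (mderiv (lift ord0 j) (F i)).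

(* Conditions (i)-(iii) alone do not determine (I, Z), since a continuous
   branch may cross a singular zero; it is the maximal solution of the
   differential equation on the domain where dF_t is invertible, hence the
   requirement dF_t(Z_t) \in unitmx. *)
Definition continuation (zeta : 'cV[R[i]]_n) (I : set R)
    (Z : R -> 'cV[R[i]]_n) : Prop :=
  [/\ [/\ open I, is_interval I & I 0],
      forall t : R, I t -> cnorm (Z s - Z t) @[s --> within I (nbhs t)] --> (0 : R),
      Z 0 = zeta,
      forall t, I t -> Fmap t (Z t) = 0 /\ dFmap t (Z t) \in unitmx &
      forall b : R, closure I b -> ~ I b ->
        (cnorm (Z t) @[t --> within I (nbhs b)] --> +oo) \/
        (cabs (\det (dFmap t (Z t))) @[t --> within I (nbhs b)] --> (0 : R))].

End Family.

(* A circuit lists the nodes of the directed acyclic multigraph in a topological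
   order: the k-th node may only refer to nodes of index less than k. *)
Section Circuit.
Variables (R : realType) (N : nat).

Inductive gate :=
| Input of 'I_N
| Const of R[i]
| Add of nat & nat
| Mul of nat & nat.

Definition gate_before (g : gate) (k : nat) : bool :=
  match g with
  | Input _ | Const _ => true
  | Add i j | Mul i j => (i < k)%N && (j < k)%N
  end.

Record circuit := Circuit {
  nodes :> seq gate;
  nodes_acyclic :
    all (fun k => gate_before (nth (Const 0) nodes k) k) (iota 0 (size nodes))
}.

Definition node (c : circuit) := 'I_(size c).

Section Eval.
Variables (T : Type) (cst : R[i] -> T) (add mul : T -> T -> T) (inp : 'I_N -> T).

Definition eval_gate (vals : seq T) (g : gate) : T :=
  match g with
  | Input i => inp i
  | Const a => cst a
  | Add i j => add (nth (cst 0) vals i) (nth (cst 0) vals j)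
  | Mul i j => mul (nth (cst 0) vals i) (nth (cst 0) vals j)
  end.

Definition eval_circuit (c : circuit) (m : node c) : T :=
  nth (cst 0) (foldl (fun vals g => rcons vals (eval_gate vals g)) [::] c) m.

End Eval.

Definition node_poly (c : circuit) (m : node c) : mpoly N R[i] :=
  eval_circuit (mpolyC N (R := R[i])) +%R *%R (fun i => mpolyX R[i] (mnm1 i)) m.

End Circuit.
Arguments Input {R N}.
Arguments Const {R N}.
Arguments Add {R N}.
Arguments Mul {R N}.

Section Interval.
Variable R : realType.

Record itv := Itv { lo : R; hi : R; lo_le_hi : lo <= hi }.

Definition in_itv (I : itv) : set R := [set x | lo I <= x <= hi I].

Lemma hull_proof (a b : R) : Num.min a b <= Num.max a b.
Proof. by rewrite ge_min !le_max lexx. Qed.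

Definition hull (a b : R) : itv := Itv (hull_proof a b).

Definition pt (a : R) : itv := Itv (lexx a).

Lemma iopp_proof (I : itv) : - hi I <= - lo I.
Proof. by rewrite lerN2 lo_le_hi. Qed.

Definition iopp (I : itv) : itv := Itv (iopp_proof I).

Definition iscale (a : R) (I : itv) : itv := hull (a * lo I) (a * hi I).

(* Complex boxes: real and imaginary parts. *)
Definition cbox : Type := itv * itv.

Definition in_cbox (X : cbox) : set R[i] :=
  [set z | in_itv X.1 (complex.Re z) /\ in_itv X.2 (complex.Im z)].

Definition cpt (a : R[i]) : cbox := (pt (complex.Re a), pt (complex.Im a)).

Definition copp (X : cbox) : cbox := (iopp X.1, iopp X.2).

Definition cboxscale (a : R) (X : cbox) : cbox := (iscale a X.1, iscale a X.2).

Definition cball (a : R[i]) (r : R) : cbox :=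
  (hull (complex.Re a - r) (complex.Re a + r),
   hull (complex.Im a - r) (complex.Im a + r)).

Section Vectors.
Variable n : nat.

Definition in_vbox (X : 'cV[cbox]_n) : set 'cV[R[i]]_n :=
  [set z | forall i, in_cbox (X i 0) (z i 0)].

(* x + r B *)
Definition vball (x : 'cV[R[i]]_n) (r : R) : 'cV[cbox]_n := \col_i cball (x i 0) r.

Definition width (X : 'cV[cbox]_n) : R :=
  sup [set d | exists x y, [/\ in_vbox X x, in_vbox X y & d = cnorm (x - y)]].

Definition boxnorm (X : 'cV[cbox]_n) : R := sup [set cnorm x | x in in_vbox X].

End Vectors.
End Interval.

Section Representable.
Variables (R : realType) (repr : set R).

Definition representable_numbers : Prop :=
  [/\ repr 2^-1,
      forall a b, repr a -> repr b -> repr (a + b),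
      forall a b, repr a -> repr b -> repr (a - b) &
      forall a b, repr a -> repr b -> repr (a * b)].

Definition repr_c (z : R[i]) : Prop := repr (complex.Re z) /\ repr (complex.Im z).

Definition repr_mx m n (A : 'M[R[i]]_(m, n)) : Prop := forall i j, repr_c (A i j).

Definition repr_itv (I : itv R) : Prop := repr (lo I) /\ repr (hi I).

Definition repr_vbox n (X : 'cV[cbox R]_n) : Prop :=
  forall i, repr_itv (X i 0).1 /\ repr_itv (X i 0).2.

Definition repr_circuit N (c : circuit R N) : Prop :=
  forall k, (k < size c)%N ->
    if nth (Const 0) c k is Const a then repr_c a else True.

End Representable.

Section Arithmetic.
Variable R : realType.

(* The first argument of both operations is the unit roundoff. *)
Record arithmetic := Arithmetic {
  iadd : R -> itv R -> itv R -> itv R;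
  imul : R -> itv R -> itv R -> itv R
}.

Definition bounded_itv (M : R) (I : itv R) : Prop := - M <= lo I /\ hi I <= M.

(* In the test M, a box scaled by r^-1 is an argument of the addition, and it
   has representable endpoints only if r^-1 is representable. This is why the
   enclosure and accuracy of the addition do not assume representable endpoints.
   It is no restriction: an addition given on representable intervals only
   extends to all compact intervals by the exact sum. *)
Definition valid_arithmetic (repr : set R) (ar : arithmetic) : Prop :=
  forall u : R, 0 < u < 1 ->
  [/\ forall I J, repr_itv repr I -> repr_itv repr J ->
        repr_itv repr (iadd ar u I J) /\ repr_itv repr (imul ar u I J),
      forall I J x y, in_itv I x -> in_itv J y -> in_itv (iadd ar u I J) (x + y),
      forall M I J, 1 <= M -> bounded_itv M I -> bounded_itv M J ->
        lo I + lo J - M * u <= lo (iadd ar u I J) /\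
        hi (iadd ar u I J) <= hi I + hi J + M * u,
      forall I J x y, repr_itv repr I -> repr_itv repr J ->
        in_itv I x -> in_itv J y -> in_itv (imul ar u I J) (x * y) &
      forall M I J, 1 <= M -> repr_itv repr I -> repr_itv repr J ->
        bounded_itv M I -> bounded_itv M J ->
        let a := lo I in let b := hi I in let c := lo J in let d := hi J in
        Num.min (Num.min (a * c) (a * d)) (Num.min (b * c) (b * d)) - M ^+ 2 * u
          <= lo (imul ar u I J) /\
        hi (imul ar u I J)
          <= Num.max (Num.max (a * c) (a * d)) (Num.max (b * c) (b * d))
             + M ^+ 2 * u].

Variables (ar : arithmetic) (u : R).

Definition cadd (X Y : cbox R) : cbox R := (iadd ar u X.1 Y.1, iadd ar u X.2 Y.2).

Definition csub (X Y : cbox R) : cbox R := cadd X (copp Y).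

Definition cmul (X Y : cbox R) : cbox R :=
  (iadd ar u (imul ar u X.1 Y.1) (iopp (imul ar u X.2 Y.2)),
   iadd ar u (imul ar u X.1 Y.2) (imul ar u X.2 Y.1)).

Definition csum (s : seq (cbox R)) : cbox R :=
  if s is X :: s' then foldl cadd X s' else cpt 0.

Definition mxbox_add m n (X Y : 'M[cbox R]_(m, n)) : 'M[cbox R]_(m, n) :=
  \matrix_(i, j) cadd (X i j) (Y i j).

Definition mxbox_sub m n (X Y : 'M[cbox R]_(m, n)) : 'M[cbox R]_(m, n) :=
  \matrix_(i, j) csub (X i j) (Y i j).

Definition mxbox_mul m n p (X : 'M[cbox R]_(m, n)) (Y : 'M[cbox R]_(n, p)) :
    'M[cbox R]_(m, p) :=
  \matrix_(i, j) csum [seq cmul (X i k) (Y k j) | k <- enum 'I_n].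

Definition mxpt m n (A : 'M[R[i]]_(m, n)) : 'M[cbox R]_(m, n) :=
  map_mx (@cpt R) A.

(* Natural interval extension of a circuit with inputs t, x_1, ..., x_n. *)
Definition eval_box n (c : circuit R n.+1) (T : itv R) (X : 'cV[cbox R]_n)
    (m : node c) : cbox R :=
  eval_circuit (@cpt R) cadd cmul
    (fun i => if unlift ord0 i is Some j then X j 0 else (T, pt 0)) m.

(* K = - r^-1 A [f](x) + (1 - A [df](x + r B)) B *)
Definition moore_image n (sf : 'cV[cbox R]_n -> 'cV[cbox R]_n)
    (sdf : 'cV[cbox R]_n -> 'M[cbox R]_n) (x : 'cV[R[i]]_n) (r : R)
    (A : 'M[R[i]]_n) : 'cV[cbox R]_n :=
  mxbox_add
    (map_mx (fun X => copp (cboxscale r^-1 X)) (mxbox_mul (mxpt A) (sf (mxpt x))))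
    (mxbox_mul
      (mxbox_sub (mxpt 1%:M) (mxbox_mul (mxpt A) (sdf (vball x r))))
      (vball 0 1)).

Definition testM n (sf : 'cV[cbox R]_n -> 'cV[cbox R]_n)
    (sdf : 'cV[cbox R]_n -> 'M[cbox R]_n) (x : 'cV[R[i]]_n) (r : R)
    (A : 'M[R[i]]_n) (rho : R) : bool :=
  boxnorm (moore_image sf sdf x r A) <= rho.

End Arithmetic.

(* [while P body S S'] : the loop "while P do body", started in state S,
   terminates in state S'. All the loop bodies below are deterministic, so that a
   program terminates if and only if it is related to some output. *)
Inductive while (S : Type) (P : S -> bool) (body : S -> S -> Prop) : S -> S -> Prop :=
| while_done s : ~~ P s -> while P body s s
| while_step s s1 s2 : P s -> body s s1 -> while P body s1 s2 -> while P body s s2.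

Section Algorithms.
Variables (R : realType) (n : nat).

(* The data left open by the description of the algorithms.
   - impl_prec lists the successive values of the unit roundoff in the run;
     the current precision is an index in this sequence, and an increase of
     the precision moves to the next index.
   - impl_omega is the function making "u_prec = o(s)" precise.
   - impl_mid is mid.
   - impl_inv u t y is mid(dF_t(y))^-1, computed in unchecked arithmetic with unit
     roundoff u. *)
Record implementation := Implementation {
  impl_arith : arithmetic R;
  impl_prec : nat -> R;
  impl_omega : R -> R;
  impl_mid : 'cV[cbox R]_n -> 'cV[R[i]]_n;
  impl_inv : R -> R -> 'cV[R[i]]_n -> 'M[R[i]]_n
}.

Definition valid_prec (prec : nat -> R) : Prop :=
  [/\ forall k, 0 < prec k < 1,
      forall k, prec k.+1 <= prec k &
      prec k @[k --> \oo] --> (0 : R)].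

Definition valid_omega (omega : R -> R) : Prop :=
  (forall s : R, 0 < s -> 0 < omega s < 1) /\
  omega s / s @[s --> 0^'+] --> (0 : R).

Definition valid_mid (repr : set R) (mid : 'cV[cbox R]_n -> 'cV[R[i]]_n) : Prop :=
  forall X, repr_vbox repr X -> repr_mx repr (mid X) /\ in_vbox X (mid X).

Definition valid_inv (repr : set R) (dF : R -> 'cV[R[i]]_n -> 'M[R[i]]_n)
    (inv : R -> R -> 'cV[R[i]]_n -> 'M[R[i]]_n) : Prop :=
  (forall u t y, 0 < u < 1 -> repr t -> repr_mx repr y ->
     repr_mx repr (inv u t y)) /\
  (forall K : set (R * 'cV[R[i]]_n), ccompact K ->
     (forall p, K p -> dF p.1 p.2 \in unitmx) ->
     forall eps : R, 0 < eps -> exists2 delta : R, 0 < delta &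
       forall u t y, 0 < u < 1 -> u < delta -> K (t, y) ->
         repr t -> repr_mx repr y ->
         forall i j, cabs ((inv u t y - invmx (dF t y)) i j) <= eps).

Definition valid_implementation (repr : set R)
    (dF : R -> 'cV[R[i]]_n -> 'M[R[i]]_n) (im : implementation) : Prop :=
  [/\ valid_arithmetic repr (impl_arith im),
      valid_prec (impl_prec im),
      valid_omega (impl_omega im),
      valid_mid repr (impl_mid im) &
      valid_inv repr dF (impl_inv im)].

Variable im : implementation.
Local Notation ar := (impl_arith im).
Local Notation prec := (impl_prec im).
Local Notation omega := (impl_omega im).

(* k' is the index of the precision once it has been lowered from that of
   index k, if necessary, to a value at most b. *)
Definition lower_prec (b : R) (k k' : nat) : Prop :=
  [/\ (k <= k')%N, prec k' <= b & forall j, (k <= j < k')%N -> b < prec j].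

(* dc is a circuit for the entries of dF_t(x), obtained from c by whatever
   method of automatic differentiation. *)
Variables (c dc : circuit R n.+1).
Variables (out : 'I_n -> node c) (dout : 'I_n -> 'I_n -> node dc).

Definition boxF (u : R) (T : itv R) (X : 'cV[cbox R]_n) : 'cV[cbox R]_n :=
  \col_i eval_box ar u T X (out i).

Definition boxdF (u : R) (T : itv R) (X : 'cV[cbox R]_n) : 'M[cbox R]_n :=
  \matrix_(i, j) eval_box ar u T X (dout i j).

Definition testMF (k : nat) (T : itv R) (x : 'cV[R[i]]_n) (r : R)
    (A : 'M[R[i]]_n) (rho : R) : bool :=
  testM ar (prec k) (boxF (prec k) T) (boxdF (prec k) T) x r A rho.

(* A precision and a box. *)
Definition bstate : Type := nat * 'cV[R[i]]_n * R * 'M[R[i]]_n.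

Section Refine.
Variables (t : R) (r : R) (A : 'M[R[i]]_n) (tau : R).

Definition refine_body (S S' : bstate) : Prop :=
  let: (k, y, s, _) := S in
  let: (k', y', s', U') := S' in
  let u := prec k in
  let delta := mxbox_mul ar u (mxpt A) (boxF u (pt t) (mxpt y)) in
  let newton := mxbox_sub ar u (mxpt y) delta in
  (if boxnorm delta <= 64^-1 * tau * s then
     [/\ y' = y, s' = s / 2 &
         if s' < 16^-1 * tau * r then lower_prec (omega s') k k' else k' = k]
   else if width newton > 40^-1 * boxnorm delta then
     [/\ y' = y, s' = s & k' = k.+1]
   else [/\ y' = impl_mid im newton, s' = s & k' = k]) /\
  U' = impl_inv im (prec k') t y'.

Definition enlarge_body (S S' : bstate) : Prop :=
  let: (k, y, s, U) := S in S' = (k, y, 2 * s, U).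

(* S' is the output (with the final precision) of refine(F_t, x, r, A, tau). *)
Definition refine (k : nat) (x : 'cV[R[i]]_n) (S' : bstate) : Prop :=
  exists S1 : bstate,
    while (fun S => let: (k, y, s, U) := S in ~~ testMF k (pt t) y s U tau)
      refine_body (k, x, r, A) S1 /\
    while (fun S => let: (k, y, s, U) := S in
             (2 * s <= 1) && testMF k (pt t) y (2 * s) U tau)
      enlarge_body S1 S'.

End Refine.

(* Inner loop of track; the state consists of a precision and of h. *)
Definition shrink_body (S S' : nat * R) : Prop :=
  let: (k, h) := S in
  S' = (if prec k > h / 2 then k.+1 else k, h / 2).

(* State of the main loop of track: a precision, a box, t and h. *)
Definition tstate : Type := bstate * R * R.

Definition track_body (S S' : tstate) : Prop :=
  let: (k, x, r, A, t, h) := S in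
  exists k1 x1 r1 A1 k2 h2,
    [/\ refine t r A 8^-1 k x (k1, x1, r1, A1),
        while (fun S => let: (k, h) := S in
                 ~~ testMF k (hull t (t + h)) x1 r1 A1 (7 / 8))
          shrink_body (k1, 2 * h) (k2, h2) &
        S' = (k2, x1, r1, A1, hi (hull t (t + h2)), h2)].

(* track, on input F, x, r, A, terminates and outputs (x', r', A'). *)
Definition track (x : 'cV[R[i]]_n) (r : R) (A : 'M[R[i]]_n)
    (x' : 'cV[R[i]]_n) (r' : R) (A' : 'M[R[i]]_n) : Prop :=
  exists k' t' h',
    while (fun S : tstate => let: (_, t, _) := S in t < 1) track_body
      (0%N, x, r, A, 0, 1) (k', x', r', A', t', h').

End Algorithms.

(* Main.v *)
(* Evaluating a circuit in interval arithmetic encloses the exact interval evaluation, and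
   differs from it by O(u_prec) when the unit roundoff is small and the input is bounded.
   Hence the test M is sound, and it succeeds when the exact box is small enough and the
   precision high enough.

   On a Moore box the mean value inequality makes y |-> y - A f(y) a contraction, so a
   Moore box contains at most one zero, near the centre. The zero Z_t can thus not leave a
   box that is a Moore box for all t in [t0, t1]; there det dF_t(Z_t) is bounded away from
   0, so [t0, t1] is included in I. This gives correctness, and 1 in I when track
   terminates.

   Conversely let 1 be in I. The Newton steps of refine contract the distance to the zero,
   each halving requires a smaller distance, and after finitely many halvings the matrix U
   is close enough to the inverse of the differential for the test to succeed, so refine
   terminates. By compactness of [0, 1] there is a radius s0 and a precision from which on
   the boxes of radius below s0 around Z_t can always be enlarged; refine then returns
   radii bounded below, and the step h of track stays bounded below. Before this precision
   is reached, h can only become small together with an increase of the precision. *)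

From Pilot Require Import Defs.
From HB Require Import structures.
From mathcomp Require Import all_boot all_order all_algebra.
From mathcomp Require Import all_classical all_reals all_analysis.
From mathcomp.real_closed Require Import complex polyrcf.
From mathcomp.multinomials Require Import -(notations) mpoly.
From mathcomp Require Import perm ring lra.
Import Order.TTheory GRing.Theory Num.Theory.
Import numFieldNormedType.Exports.
Import Pilot.Defs.
Set Implicit Arguments.
Unset Strict Implicit.
Unset Printing Implicit Defensive.
Local Open Scope classical_set_scope.
Local Open Scope ring_scope.

(** * Norms and exact interval arithmetic *)

(** About the matrix [A] of a box only the contraction factor 7/8 is known, and the Newton steps of
    [refine] use this [A] throughout. Their progress rests on that factor alone, the rounding errors
    using up less than the remaining 1/8; the recomputed matrix [U] only matters for the tests. The
    precision is raised by local criteria only, so a whole run may stay below any given precision.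
    No bound valid at high precision can be assumed to apply eventually, and runs are treated
    according to whether the precision index reaches a threshold, which the algorithm does not know.
    Uniform constants are obtained without looking into the circuits. Two relations between
    intervals, enclosure and closeness up to [C * (e + u)], are preserved by each operation, hence
    by evaluation. Here [u] is the roundoff and [e] a perturbation of the inputs: the radius of a
    box, the step of the parameter, or the distance of two points. One statement thus gives the
    accuracy of the arithmetic and the Lipschitz bounds. *)

Section ComplexNorm.
Variable R : realType.
Implicit Types (a b z : R[i]) (e : R).

Lemma ReD a b : complex.Re (a + b) = complex.Re a + complex.Re b.
Proof. by case: a b => ? ? []. Qed.

Lemma ImD a b : complex.Im (a + b) = complex.Im a + complex.Im b.
Proof. by case: a b => ? ? []. Qed.

Lemma ReN a : complex.Re (- a) = - complex.Re a.
Proof. by case: a. Qed.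

Lemma ImN a : complex.Im (- a) = - complex.Im a.
Proof. by case: a. Qed.

Lemma ReM a b : complex.Re (a * b) =
  complex.Re a * complex.Re b - complex.Im a * complex.Im b.
Proof. by case: a b => ? ? []. Qed.

Lemma ImM a b : complex.Im (a * b) =
  complex.Re a * complex.Im b + complex.Im a * complex.Re b.
Proof. by case: a b => ? ? []. Qed.

Lemma Re_realM (a : R) z : complex.Re ((a%:C)%C * z) = a * complex.Re z.
Proof. by rewrite ReM /= mul0r subr0. Qed.

Lemma Im_realM (a : R) z : complex.Im ((a%:C)%C * z) = a * complex.Im z.
Proof. by rewrite ImM /= mul0r addr0. Qed.

Lemma complexP a b :
  complex.Re a = complex.Re b -> complex.Im a = complex.Im b -> a = b.
Proof. by case: a b => ? ? [? ?] /= -> ->. Qed.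

Lemma cabs_le z e :
  (cabs z <= e) = (`|complex.Re z| <= e) && (`|complex.Im z| <= e).
Proof. by rewrite /cabs ge_max. Qed.

Lemma Re_le_cabs z : `|complex.Re z| <= cabs z.
Proof. by rewrite /cabs le_max lexx. Qed.

Lemma Im_le_cabs z : `|complex.Im z| <= cabs z.
Proof. by rewrite /cabs le_max lexx orbT. Qed.

Lemma cabs_ge0 z : 0 <= cabs z.
Proof. exact: le_trans (Re_le_cabs z). Qed.

Lemma cabs0 : cabs (0 : R[i]) = 0.
Proof. by rewrite /cabs /= normr0 maxxx. Qed.

Lemma cabs0_eq0 z : cabs z <= 0 -> z = 0.
Proof.
by rewrite cabs_le !normr_le0 => /andP[/eqP zr /eqP zi]; apply: complexP.
Qed.

Lemma cabsN z : cabs (- z) = cabs z.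
Proof. by rewrite /cabs ReN ImN !normrN. Qed.

Lemma cabsD a b : cabs (a + b) <= cabs a + cabs b.
Proof.
rewrite cabs_le ReD ImD; apply/andP; split; apply: le_trans (ler_normD _ _) _;
by apply: lerD; rewrite ?Re_le_cabs ?Im_le_cabs.
Qed.

(** The max norm is not submultiplicative: each part of a product is a sum of two real products. The
    factor 2 reappears in all matrix bounds below. *)
Lemma cabsM a b : cabs (a * b) <= 2 * (cabs a * cabs b).
Proof.
have mix (p q : R) : `|p| <= cabs a -> `|q| <= cabs b -> `|p * q| <= cabs a * cabs b.
  by move=> pa qb; rewrite normrM ler_pM.
have := (Re_le_cabs a, Im_le_cabs a, Re_le_cabs b, Im_le_cabs b).
move=> [[[ra ia] rb] ib]; rewrite cabs_le ReM ImM mulr_natl mulr2n.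
apply/andP; split; first by apply: le_trans (ler_normB _ _) _; apply: lerD; exact: mix.
by apply: le_trans (ler_normD _ _) _; apply: lerD; exact: mix.
Qed.

Lemma cabs_realM (a : R) z : cabs ((a%:C)%C * z) = `|a| * cabs z.
Proof. by rewrite /cabs Re_realM Im_realM !normrM -maxr_pMr. Qed.

Lemma cabs_real (a : R) : cabs (a%:C)%C = `|a|.
Proof. by rewrite /cabs /= normr0; apply: max_l. Qed.

Lemma cabs_sum (T : Type) (s : seq T) (f : T -> R[i]) :
  cabs (\sum_(k <- s) f k) <= \sum_(k <- s) cabs (f k).
Proof.
elim: s => [|k s IH]; first by rewrite !big_nil cabs0.
by rewrite !big_cons; apply: le_trans (cabsD _ _) _; rewrite lerD2l.
Qed.

End ComplexNorm.

Section VectorNorm.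
Variables (R : realType) (n : nat).
Implicit Types (z w : 'cV[R[i]]_n) (e : R).

Lemma cabs_le_cnorm z i : cabs (z i 0) <= cnorm z.
Proof. exact: (le_bigmax _ (fun i => cabs (z i 0))). Qed.

Lemma cnorm_ge0 z : 0 <= cnorm z.
Proof.
rewrite /cnorm; elim/big_rec: _ => // i x _ x0.
by rewrite le_max cabs_ge0.
Qed.

Lemma cnorm_leP z e : 0 <= e -> reflect (forall i, cabs (z i 0) <= e) (cnorm z <= e).
Proof.
move=> e0; apply: (iffP idP) => [ze i|ze]; first exact: le_trans (cabs_le_cnorm z i) ze.
by apply: bigmax_le.
Qed.

Lemma cnorm0 : cnorm (0 : 'cV[R[i]]_n) = 0.
Proof.
apply/eqP; rewrite eq_le cnorm_ge0 andbT; apply/cnorm_leP => // i.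
by rewrite mxE cabs0.
Qed.

Lemma cnorm0_eq0 z : cnorm z <= 0 -> z = 0.
Proof.
move=> /(cnorm_leP _ (lexx 0)) z0; apply/colP => i; rewrite mxE.
exact/cabs0_eq0/z0.
Qed.

Lemma cnormN z : cnorm (- z) = cnorm z.
Proof. by rewrite /cnorm; apply: eq_bigr => i _; rewrite mxE cabsN. Qed.

Lemma cnormD z w : cnorm (z + w) <= cnorm z + cnorm w.
Proof.
apply/cnorm_leP => [|i]; first by rewrite addr_ge0 ?cnorm_ge0.
rewrite mxE; apply: le_trans (cabsD _ _) _.
by rewrite lerD ?cabs_le_cnorm.
Qed.

Lemma cnormB z w : cnorm (z - w) <= cnorm z + cnorm w.
Proof. by rewrite -(cnormN w); exact: cnormD. Qed.

Lemma cdistC z w : cnorm (z - w) = cnorm (w - z).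
Proof. by rewrite -cnormN opprB. Qed.

Lemma cdistD y z w : cnorm (z - w) <= cnorm (z - y) + cnorm (y - w).
Proof. by apply: le_trans (cnormD _ _); rewrite addrA subrK. Qed.

Lemma ler_cnormD z w : cnorm z <= cnorm (z - w) + cnorm w.
Proof. by apply: le_trans (cnormD _ _); rewrite subrK. Qed.

Lemma cnormZ (a : R) z : cnorm (cscale a z) = `|a| * cnorm z.
Proof.
rewrite /cnorm (big_morph _ (fun x y => maxr_pMr x y (normr_ge0 a)) (mulr0 _)).
by apply: eq_bigr => i _; rewrite mxE cabs_realM.
Qed.

Lemma cscale1 z : cscale 1 z = z.
Proof. by rewrite /cscale rmorph1 scale1r. Qed.

Lemma cscaleA (a b : R) z : cscale a (cscale b z) = cscale (a * b) z.
Proof. by rewrite /cscale scalerA rmorphM. Qed.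

Lemma cscaleV (a : R) z : a != 0 -> cscale a (cscale a^-1 z) = z.
Proof. by move=> a0; rewrite cscaleA divff // cscale1. Qed.

Lemma cnorm_mulmx (A : 'M[R[i]]_n) z b : (forall i j, cabs (A i j) <= b) ->
  cnorm (A *m z) <= n%:R * 2 * b * cnorm z.
Proof.
(* For [n = 0] the hypothesis on the entries is vacuous and [b] may be negative. *)
move=> Ab; have [n0|n0] := posnP n.
  have -> : n%:R = 0 :> R by rewrite n0.
  by rewrite !mul0r; apply/cnorm_leP => // i; have := leq_ltn_trans (leq0n i) (ltn_ord i); rewrite {1}n0.
have b0 : 0 <= b by apply: le_trans (cabs_ge0 _) (Ab (Ordinal n0) (Ordinal n0)).
apply/cnorm_leP => [|i]; first by rewrite !mulr_ge0 ?cnorm_ge0.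
rewrite mxE; apply: le_trans (cabs_sum _ _) _.
apply: (@le_trans _ _ (\sum_(k < n) 2 * (b * cnorm z))); last first.
  by rewrite sumr_const card_ord -[_ *+ n]mulr_natl !mulrA.
apply: ler_sum => k _; apply: le_trans (cabsM _ _) _.
by rewrite ler_pM2l // ler_pM ?cabs_ge0 ?cabs_le_cnorm.
Qed.

End VectorNorm.

Section Intervals.
Variable R : realType.
Implicit Types (I J : itv R) (X Y : cbox R) (u e : R).

(** Inclusion up to an enlargement of [J] by [e] at both ends. A one-sided notion suffices because
    computed boxes only have to be bounded from above. *)
Definition isub (e : R) I J : Prop := lo J - e <= lo I /\ hi I <= hi J + e.
Definition csubx (e : R) X Y : Prop := isub e X.1 Y.1 /\ isub e X.2 Y.2.

Lemma isub_refl e I : 0 <= e -> isub e I I.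
Proof. by move=> e0; split; rewrite ?lerBlDr lerDl. Qed.

Lemma csubx_refl e X : 0 <= e -> csubx e X X.
Proof. by move=> e0; split; exact: isub_refl. Qed.

Lemma hullE (a r : R) : 0 <= r -> lo (hull (a - r) (a + r)) = a - r /\
  hi (hull (a - r) (a + r)) = a + r.
Proof. by move=> r0; rewrite /= min_l ?max_r //; lra. Qed.

Lemma lo_in I : in_itv I (lo I).
Proof. by rewrite /in_itv /= lexx lo_le_hi. Qed.

Lemma hi_in I : in_itv I (hi I).
Proof. by rewrite /in_itv /= lexx lo_le_hi. Qed.

Definition exact_add I J : itv R := Itv (lerD (lo_le_hi I) (lo_le_hi J)).

Definition min4 (a b c d : R) := Num.min (Num.min (a * c) (a * d)) (Num.min (b * c) (b * d)).
Definition max4 (a b c d : R) := Num.max (Num.max (a * c) (a * d)) (Num.max (b * c) (b * d)).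

Lemma min4_le_max4 (a b c d : R) : min4 a b c d <= max4 a b c d.
Proof. by rewrite /min4 /max4 !ge_min !le_max lexx. Qed.

Definition exact_mul I J : itv R := Itv (min4_le_max4 (lo I) (hi I) (lo J) (hi J)).

(** Exact interval operations in the shape of an [arithmetic]: exact and rounded evaluation of a
    circuit are then the same function and can be compared gate by gate. *)
Definition exact_arith : arithmetic R :=
  Arithmetic (fun _ => exact_add) (fun _ => exact_mul).

(** A product is affine in each factor, so moving the factors one after the other to an end of their
    intervals shows that the extremes are attained at the four corners. *)
Lemma exact_mul_in I J (x y : R) :
  in_itv I x -> in_itv J y -> in_itv (exact_mul I J) (x * y).
Proof.
case: I J => a b ab [c d cd]; rewrite /in_itv /= => /andP[ax xb] /andP[cy yd].
rewrite /min4 /max4 !ge_min !le_max.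
have key (p q m M z : R) : p <= z <= q -> m * p <= M -> m * q <= M -> m * z <= M.
  by move=> /andP[pz zq] mp mq; case: (lerP 0 m) => m0; nra.
have key' (p q m M z : R) : p <= z <= q -> M <= m * p -> M <= m * q -> M <= m * z.
  by move=> /andP[pz zq] mp mq; case: (lerP 0 m) => m0; nra.
have axb : a <= x <= b by rewrite ax xb.
have cyd : c <= y <= d by rewrite cy yd.
apply/andP; split.
  have : min4 a b c d <= x * y.
    rewrite mulrC; apply: (key' a b) => //; rewrite mulrC; apply: (key' c d) => //;
    by rewrite /min4 !ge_min lexx ?orbT.
  by rewrite /min4 !ge_min.
have : x * y <= max4 a b c d.
  rewrite mulrC; apply: (key a b) => //; rewrite mulrC; apply: (key c d) => //;
  by rewrite /max4 !le_max lexx ?orbT.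
by rewrite /max4 !le_max.
Qed.

Lemma exact_arith_valid : valid_arithmetic setT exact_arith.
Proof.
move=> u /andP[u0 u1]; split => //.
- move=> I J x y /andP[lx xh] /andP[ly yh]; rewrite /in_itv /=.
  by rewrite !lerD.
- move=> M I J M1 _ _ /=; have Mu : 0 <= M * u by apply: mulr_ge0; lra.
  by rewrite lerBlDr !lerDl.
- by move=> I J x y _ _; exact: exact_mul_in.
- move=> M I J M1 _ _ _ _ /=; have Mu : 0 <= M ^+ 2 * u by rewrite mulr_ge0 ?sqr_ge0 // ltW.
  by rewrite lerBlDr !lerDl.
Qed.

Lemma itvP I J : lo I = lo J -> hi I = hi J -> I = J.
Proof.
case: I J => a b ab [c d cd] /= e1 e2; subst c d; congr Itv.
exact: Prop_irrelevance.
Qed.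

Lemma exact_add_pt (a b : R) : exact_add (pt a) (pt b) = pt (a + b).
Proof. exact: itvP. Qed.

Lemma exact_mul_pt (a b : R) : exact_mul (pt a) (pt b) = pt (a * b).
Proof. by apply: itvP; rewrite /= /min4 /max4 ?minxx ?maxxx. Qed.

Lemma iopp_pt (a : R) : iopp (pt a) = pt (- a).
Proof. exact: itvP. Qed.

Variable u : R.

Lemma exact_cadd_pt (a b : R[i]) : cadd exact_arith u (cpt a) (cpt b) = cpt (a + b).
Proof. by rewrite /cadd /cpt /= !exact_add_pt ReD ImD. Qed.

Lemma exact_csub_pt (a b : R[i]) : csub exact_arith u (cpt a) (cpt b) = cpt (a - b).
Proof. by rewrite /csub -exact_cadd_pt /copp /cpt /= !iopp_pt ReN ImN. Qed.

Lemma exact_cmul_pt (a b : R[i]) : cmul exact_arith u (cpt a) (cpt b) = cpt (a * b).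
Proof.
by rewrite /cmul /cpt /= !exact_mul_pt iopp_pt !exact_add_pt ReM ImM.
Qed.

Lemma exact_csum_pt (T : Type) (f : T -> R[i]) (s : seq T) :
  csum exact_arith u [seq cpt (f k) | k <- s] = cpt (\sum_(k <- s) f k).
Proof.
case: s => [|k s]; first by rewrite big_nil.
rewrite big_cons /=; elim: s (f k) => [|l s IH] a /=.
  by rewrite big_nil addr0.
by rewrite exact_cadd_pt IH big_cons addrA.
Qed.

Lemma exact_mul_mxpt m n p (A : 'M[R[i]]_(m, n)) (B : 'M[R[i]]_(n, p)) :
  mxbox_mul exact_arith u (mxpt A) (mxpt B) = mxpt (A *m B).
Proof.
apply/matrixP => i j; rewrite !mxE -[RHS]/(cpt _).
transitivity (csum exact_arith u [seq cpt (A i k * B k j) | k <- enum 'I_n]).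
  by congr csum; apply: eq_map => k; rewrite !mxE exact_cmul_pt.
by rewrite exact_csum_pt big_enum.
Qed.

Lemma exact_sub_mxpt m n (A B : 'M[R[i]]_(m, n)) :
  mxbox_sub exact_arith u (mxpt A) (mxpt B) = mxpt (A - B).
Proof. by apply/matrixP => i j; rewrite !mxE exact_csub_pt. Qed.

End Intervals.

(** * Error bounds for circuit evaluation *)

Section Parametricity.
Variables (R : realType) (P : Type) (valid : P -> Prop) (repr : set R).
Variables (ar1 ar2 : P -> arithmetic R) (u1 u2 : P -> R).
Variable rel : P -> R -> itv R -> itv R -> Prop.

(* The error bounds that an operation turns into another bound are uniform in
   the parameter [p]. *)
Record parametric : Prop := Parametric {
  rel_mono : forall p C C' I J, C <= C' -> rel p C I J -> rel p C' I J;
  rel_pt : forall a, repr a -> exists C, forall p, valid p -> rel p C (pt a) (pt a);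
  rel_add : forall C, exists C', forall p I I' J J', valid p ->
    rel p C I I' -> rel p C J J' ->
    rel p C' (iadd (ar1 p) (u1 p) I J) (iadd (ar2 p) (u2 p) I' J');
  rel_mul : forall C, exists C', forall p I I' J J', valid p ->
    rel p C I I' -> rel p C J J' ->
    rel p C' (imul (ar1 p) (u1 p) I J) (imul (ar2 p) (u2 p) I' J');
  rel_opp : forall p C I J, rel p C I J -> rel p C (iopp I) (iopp J)
}.

Hypotheses (relP : parametric) (repr0 : repr 0).

Definition relc p C (X Y : cbox R) : Prop := rel p C X.1 Y.1 /\ rel p C X.2 Y.2.

Definition relmx p C m n (X Y : 'M[cbox R]_(m, n)) : Prop :=
  forall i j, relc p C (X i j) (Y i j).

Lemma relc_mono p C C' X Y : C <= C' -> relc p C X Y -> relc p C' X Y.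
Proof. by move=> CC' [r1 r2]; split; apply: (rel_mono relP CC'). Qed.

Lemma relmx_mono p C C' m n (X Y : 'M[cbox R]_(m, n)) :
  C <= C' -> relmx p C X Y -> relmx p C' X Y.
Proof. by move=> CC' rXY i j; apply: relc_mono CC' _. Qed.

Lemma relc_cpt a : repr_c repr a ->
  exists C, forall p, valid p -> relc p C (cpt a) (cpt a).
Proof.
move=> [/(rel_pt relP)[C1 h1] /(rel_pt relP)[C2 h2]].
exists (Num.max C1 C2) => p vp; split.
  by apply: (rel_mono relP _ (h1 p vp)); rewrite le_max lexx.
by apply: (rel_mono relP _ (h2 p vp)); rewrite le_max lexx orbT.
Qed.

Lemma relc_add C : exists C', forall p X X' Y Y', valid p ->
  relc p C X X' -> relc p C Y Y' ->
  relc p C' (cadd (ar1 p) (u1 p) X Y) (cadd (ar2 p) (u2 p) X' Y').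
Proof.
have [C' h] := rel_add relP C; exists C' => p X X' Y Y' vp [x1 x2] [y1 y2].
by split; apply: h.
Qed.

Lemma relc_opp p C X Y : relc p C X Y -> relc p C (copp X) (copp Y).
Proof. by move=> [r1 r2]; split; apply: (rel_opp relP). Qed.

Lemma relc_sub C : exists C', forall p X X' Y Y', valid p ->
  relc p C X X' -> relc p C Y Y' ->
  relc p C' (csub (ar1 p) (u1 p) X Y) (csub (ar2 p) (u2 p) X' Y').
Proof.
have [C' h] := relc_add C; exists C' => p X X' Y Y' vp rX rY.
by apply: h => //; exact: relc_opp.
Qed.

Lemma relc_mul C : exists C', forall p X X' Y Y', valid p ->
  relc p C X X' -> relc p C Y Y' ->
  relc p C' (cmul (ar1 p) (u1 p) X Y) (cmul (ar2 p) (u2 p) X' Y').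
Proof.
have [C1 h1] := rel_mul relP C; have [C2 h2] := rel_add relP C1.
exists C2 => p X X' Y Y' vp [x1 x2] [y1 y2].
by split; apply: h2 => //; rewrite ?/copp; try apply: (rel_opp relP); apply: h1.
Qed.

Lemma relc_sum (K : Type) (s : seq K) C : exists C', forall p F G, valid p ->
  (forall k, relc p C (F k) (G k)) ->
  relc p C' (csum (ar1 p) (u1 p) [seq F k | k <- s])
            (csum (ar2 p) (u2 p) [seq G k | k <- s]).
Proof.
case: s => [|k s].
  have [C' h] := @relc_cpt 0 (conj repr0 repr0).
  by exists C' => p F G vp _; apply: h.
rewrite /csum /=.
suff [C' h] : exists C', forall p F G X Y, valid p -> relc p C X Y ->
    (forall k, relc p C (F k) (G k)) ->
    relc p C' (foldl (cadd (ar1 p) (u1 p)) X [seq F k | k <- s])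
              (foldl (cadd (ar2 p) (u2 p)) Y [seq G k | k <- s]).
  by exists C' => p F G vp FG; apply: h.
elim: s C => [|l s IH] C /=; first by exists C.
have [C1 h1] := relc_add C; have [C2 h2] := IH (Num.max C C1).
exists C2 => p F G X Y vp rXY rFG; apply: h2 => //.
  by apply: relc_mono (h1 _ _ _ _ _ vp rXY (rFG l)); rewrite le_max lexx orbT.
by move=> k'; apply: relc_mono (rFG k'); rewrite le_max lexx.
Qed.

Lemma relmx_mul m n q C : exists C', forall p (X X' : 'M[cbox R]_(m, n))
    (Y Y' : 'M[cbox R]_(n, q)), valid p -> relmx p C X X' -> relmx p C Y Y' ->
  relmx p C' (mxbox_mul (ar1 p) (u1 p) X Y) (mxbox_mul (ar2 p) (u2 p) X' Y').
Proof.
have [C1 h1] := relc_mul C; have [C2 h2] := relc_sum (enum 'I_n) C1.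
exists C2 => p X X' Y Y' vp rX rY i j; rewrite !mxE.
by apply: h2 => // k; apply: h1.
Qed.

Lemma relmx_sub m n C : exists C', forall p (X X' Y Y' : 'M[cbox R]_(m, n)),
  valid p -> relmx p C X X' -> relmx p C Y Y' ->
  relmx p C' (mxbox_sub (ar1 p) (u1 p) X Y) (mxbox_sub (ar2 p) (u2 p) X' Y').
Proof.
have [C1 h1] := relc_sub C; exists C1 => p X X' Y Y' vp rX rY i j.
by rewrite !mxE; apply: h1.
Qed.

Definition repr_gate N (g : gate R N) : Prop :=
  if g is Const a then repr_c repr a else True.

Definition repr_gates N (s : seq (gate R N)) : Prop :=
  forall k, (k < size s)%N -> repr_gate (nth (Const 0) s k).

(** A gate may refer to any earlier node, so the induction on the list of gates bounds all nodes at
    once. *)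
Lemma relc_eval N (c : circuit R N) C : repr_circuit repr c ->
  exists C', forall p (F G : 'I_N -> cbox R) (m : node c), valid p ->
    (forall i, relc p C (F i) (G i)) ->
    relc p C' (eval_circuit (@cpt R) (cadd (ar1 p) (u1 p)) (cmul (ar1 p) (u1 p)) F m)
              (eval_circuit (@cpt R) (cadd (ar2 p) (u2 p)) (cmul (ar2 p) (u2 p)) G m).
Proof.
rewrite -/(repr_gates c) /eval_circuit.
suff H (s : seq (gate R N)) :
    repr_gates s -> exists C', forall p (F G : 'I_N -> cbox R), valid p ->
    (forall i, relc p C (F i) (G i)) -> forall k,
    relc p C'
      (nth (cpt 0) (foldl (fun v g => rcons v (eval_gate (@cpt R)
         (cadd (ar1 p) (u1 p)) (cmul (ar1 p) (u1 p)) F v g)) [::] s) k)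
      (nth (cpt 0) (foldl (fun v g => rcons v (eval_gate (@cpt R)
         (cadd (ar2 p) (u2 p)) (cmul (ar2 p) (u2 p)) G v g)) [::] s) k).
  by move=> /H[C' h]; exists C' => p F G m vp rFG; apply: h.
(* A reference out of range reads the default value [cpt 0], which the bound must cover as well. *)
have [C0 h0] := @relc_cpt 0 (conj repr0 repr0).
have szf p (a : arithmetic R) u F : size (foldl (fun v g => rcons v (eval_gate (@cpt R)
    (cadd a u) (cmul a u) F v g)) [::] p) = size p.
  elim/last_ind: p => [//|p g IH]; first by rewrite foldl_rcons !size_rcons IH.
elim/last_ind: s => [|s g IH] hs.
  by exists C0 => p F G vp _ k; rewrite /= nth_nil; apply: h0.
have [|C1 h1] := IH; first move=> k ks.
  by have := hs k; rewrite size_rcons nth_rcons ks => /(_ (leqW ks)).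
have hg : repr_gate g.
  by move: (hs (size s)); rewrite size_rcons nth_rcons ltnn eqxx; apply.
suff [C2 h2] : exists C2, forall p F G v w, valid p ->
    (forall i, relc p C (F i) (G i)) ->
    (forall k, relc p C1 (nth (cpt 0) v k) (nth (cpt 0) w k)) ->
    relc p C2
      (eval_gate (@cpt R) (cadd (ar1 p) (u1 p)) (cmul (ar1 p) (u1 p)) F v g)
      (eval_gate (@cpt R) (cadd (ar2 p) (u2 p)) (cmul (ar2 p) (u2 p)) G w g).
  exists (Num.max C1 C2) => p F G vp rFG k; have h := h1 p F G vp rFG.
  rewrite !foldl_rcons !nth_rcons !szf; case: ifP => _.
    by apply: relc_mono (h k); rewrite le_max lexx.
  case: ifP => _; last first.
    move: (h (size s)); rewrite !nth_default ?szf // => h'.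
    by apply: relc_mono h'; rewrite le_max lexx.
  by apply: relc_mono (h2 _ _ _ _ _ vp rFG h); rewrite le_max lexx orbT.
case: g hg {hs} => [i|a|i j|i j] /= hg.
- by exists C => p F G v w vp rFG _; apply: rFG.
- by have [C2 h2] := relc_cpt hg; exists C2 => p F G v w vp _ _; apply: h2.
- by have [C2 h2] := relc_add C1; exists C2 => p F G v w vp _ rvw; apply: h2.
- by have [C2 h2] := relc_mul C1; exists C2 => p F G v w vp _ rvw; apply: h2.
Qed.

End Parametricity.

Lemma uniform_const (R : realType) (T : finType) (Q : T -> R -> Prop) :
  (forall i C C', C <= C' -> Q i C -> Q i C') ->
  (forall i, exists C, Q i C) -> exists C, forall i, Q i C.
Proof.
move=> Qmono /choice[f Qf]; exists (\big[Num.max/0]_i f i) => i.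
by apply: Qmono (Qf i); exact: le_bigmax.
Qed.

Section Enclosures.
Variables (R : realType) (repr : set R) (hrepr : representable_numbers repr).
Variables (ar : arithmetic R) (har : valid_arithmetic repr ar).

Lemma repr1 : repr 1.
Proof.
have [h2 hD _ _] := hrepr.
by have := hD _ _ h2 h2; have -> : 2^-1 + 2^-1 = 1 :> R by lra.
Qed.

Lemma repr0 : repr 0.
Proof. by have [_ _ hB _] := hrepr; rewrite -(subrr 1); apply: hB repr1 repr1. Qed.

Lemma reprN a : repr a -> repr (- a).
Proof. by have [_ _ hB _] := hrepr => ra; rewrite -sub0r; apply: hB repr0 ra. Qed.

Lemma reprD a b : repr a -> repr b -> repr (a + b).
Proof. by have [_ hD _ _] := hrepr => ra rb; exact: hD. Qed.

Lemma reprB a b : repr a -> repr b -> repr (a - b).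
Proof. by have [_ _ hB _] := hrepr => ra rb; exact: hB. Qed.

Lemma repr_half a : repr a -> repr (a / 2).
Proof. by have [h2 _ _ hM] := hrepr => ra; exact: hM. Qed.

Lemma repr_double a : repr a -> repr (2 * a).
Proof. by move=> ra; rewrite mulr_natl mulr2n; exact: reprD. Qed.

Lemma repr_hull a b : repr a -> repr b -> repr_itv repr (hull a b).
Proof. by move=> ra rb; split; rewrite /= ?minEle ?maxEle; case: ifP. Qed.

Lemma repr_pt a : repr a -> repr_itv repr (pt a).
Proof. by []. Qed.

Lemma repr_iopp I : repr_itv repr I -> repr_itv repr (iopp I).
Proof. by move=> [rl rh]; split; exact: reprN. Qed.

Lemma repr_mx1 n : repr_mx repr (1%:M : 'M[R[i]]_n).
Proof.
move=> i j; rewrite mxE; case: eqP => _ /=; split;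
by [exact: repr0 | exact: repr1].
Qed.

Lemma repr_mxpt n (x : 'cV[R[i]]_n) : repr_mx repr x -> repr_vbox repr (mxpt x).
Proof. by move=> rx i; rewrite mxE; have [] := rx i 0. Qed.

Lemma repr_vball n (x : 'cV[R[i]]_n) r :
  repr_mx repr x -> repr r -> repr_vbox repr (vball x r).
Proof.
move=> rx rr i; rewrite mxE; have [rR rI] := rx i 0.
by split; apply: repr_hull; rewrite ?/=; (exact: reprB || exact: reprD).
Qed.

Lemma repr_vball01 n : repr_vbox repr (vball (0 : 'cV[R[i]]_n) 1).
Proof.
by apply: repr_vball repr1 => i j; rewrite mxE; split; exact: repr0.
Qed.

(** Representability of the outer interval belongs to the relation because [imul] is assumed to
    enclose products of representable intervals only. *)
Definition enclosed (u C : R) (I J : itv R) : Prop := repr_itv repr J /\ isub 0 I J.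

Lemma isub0P (I J : itv R) : isub 0 I J <-> in_itv J (lo I) /\ in_itv J (hi I).
Proof.
rewrite /isub subr0 addr0 /in_itv /=; have := lo_le_hi I.
by split=> [[h1 h2]|[/andP[h1 h2] /andP[h3 h4]]]; split; lra.
Qed.

(* [v] is arbitrary because the exact operations ignore their unit roundoff. *)
Lemma enclosed_parametric (v : R -> R) : parametric (fun u : R => 0 < u < 1) repr
  (fun=> exact_arith R) (fun=> ar) v id enclosed.
Proof.
split=> //.
- by move=> a ra; exists 0 => u u01; split=> //; rewrite /isub subr0 addr0.
- move=> C; exists C => u I I' J J' u01 [rI' /isub0P[II' II'']] [rJ' /isub0P[JJ' JJ'']].
  have [hrep hadd _ _ _] := har u01; split; first by have [] := hrep _ _ rI' rJ'.
  by apply/isub0P; split; apply: hadd.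
- move=> C; exists C => u I I' J J' u01 [rI' /isub0P[II' II'']] [rJ' /isub0P[JJ' JJ'']].
  have [hrep _ _ hmul _] := har u01; split; first by have [] := hrep _ _ rI' rJ'.
  have mem a b : in_itv I' a -> in_itv J' b -> in_itv (imul ar u I' J') (a * b).
    exact: hmul.
  apply/isub0P; rewrite /= /min4 /max4; split.
    by rewrite minEle; case: ifP => _; rewrite minEle; case: ifP => _; apply: mem.
  by rewrite maxEle; case: ifP => _; rewrite maxEle; case: ifP => _; apply: mem.
- move=> u C I J [rJ /isub0P[]]; rewrite /in_itv /= => h1 h2; split.
    exact: repr_iopp.
  by rewrite /isub /min4 /max4 /=; lra.
Qed.

(** Here [p = (u, e)] is a roundoff and a perturbation of the inputs, [I] is the computed and [J]
    the exact interval. The same [C] bounds the size of [J], on which the accuracy of the next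
    operation depends. *)
Definition near_itv (p : R * R) (C : R) (I J : itv R) : Prop :=
  [/\ 1 <= C, 0 <= p.2 + p.1, repr_itv repr I, bounded_itv C J &
      isub (C * (p.2 + p.1)) I J].

Lemma clamp (I : itv R) d x : 0 <= d -> lo I - d <= x <= hi I + d ->
  exists2 x', in_itv I x' & `|x - x'| <= d.
Proof.
move=> d0 /andP[lx xh]; have lh := lo_le_hi I.
have [xlo|lox] := ltP x (lo I); last have [hix|xhi] := ltP (hi I) x.
- by exists (lo I); [exact: lo_in | rewrite ler_norml; lra].
- by exists (hi I); [exact: hi_in | rewrite ler_norml; lra].
- exists x; first by rewrite /in_itv /= lox.
  by rewrite subrr normr0.
Qed.

Lemma min4_max4_bounds (I J : itv R) m M :
  (forall x y, in_itv I x -> in_itv J y -> m <= x * y <= M) ->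
  m <= min4 (lo I) (hi I) (lo J) (hi J) /\ max4 (lo I) (hi I) (lo J) (hi J) <= M.
Proof.
move=> mM; have [[[lI hI] lJ] hJ] := (lo_in I, hi_in I, lo_in J, hi_in J).
have /andP[a1 b1] := mM _ _ lI lJ; have /andP[a2 b2] := mM _ _ lI hJ.
have /andP[a3 b3] := mM _ _ hI lJ; have /andP[a4 b4] := mM _ _ hI hJ.
by rewrite /min4 /max4 !le_min !ge_max a1 a2 a3 a4 b1 b2 b3 b4.
Qed.

Lemma near_itv_parametric : parametric (fun p : R * R => 0 < p.1 < 1 /\ 0 <= p.2 <= 1)
  repr (fun=> ar) (fun=> exact_arith R) fst fst near_itv.
Proof.
split.
- move=> [u e] C C' I J CC' [/= C1 h0 rI [bl bh] [sl sh]]; split=> //=; first lra.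
    by split; lra.
  have : C * (e + u) <= C' * (e + u) by rewrite ler_wpM2r.
  by split; lra.
- move=> a ra; exists (1 + `|a|) => -[u e] [/= /andP[u0 u1] /andP[e0 e1]].
  have a0 := normr_ge0 a; have := ler_norm a; have := ler_norm (- a); rewrite normrN.
  have h : 0 <= (1 + `|a|) * (e + u) by apply: mulr_ge0; lra.
  move=> an aa; split=> //=; [lra|lra| |].
    by split=> /=; lra.
  by rewrite /isub /min4 /max4 /=; lra.
(* As [e + u <= 2], the computed operands lie in [[-3C, 3C]]; the inherited errors [2C(e + u)] and
   the rounding error [3Cu] sum to at most [5C(e + u)]. *)
- move=> C; exists (5 * C) => -[u e] I I' J J' [/= u01 e01].
  move=> [/= C1 h0 rI [bIl bIh] [sIl sIh]] [/= _ _ rJ [bJl bJh] [sJl sJh]].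
  have [hrep _ hacc _ _] := har u01.
  have [u0 u1] := andP u01; have [e0 e1] := andP e01.
  have Ch : C * (e + u) <= 2 * C by nra.
  have Cu : C * u <= C * (e + u) by nra.
  have [|||ha hb] := hacc (3 * C) I J; try by lra || (split; lra).
  split=> //=; [lra | by have [] := hrep _ _ rI rJ | by split=> /=; lra | ].
  by rewrite /isub /min4 /max4 /=; lra.
(* [13 = 9 + 4]: rounding costs [(3C)^2 u], and moving both factors to nearby points of the exact
   intervals changes the product by at most [3C^2(e + u) + C^2(e + u)]. *)
- move=> C; exists (13 * C ^+ 2) => -[u e] I I' J J' [/= u01 e01].
  move=> [/= C1 h0 rI [bIl bIh] [sIl sIh]] [/= _ _ rJ [bJl bJh] [sJl sJh]].
  have [hrep _ _ _ hacc] := har u01.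
  have [u0 u1] := andP u01; have [e0 e1] := andP e01.
  have Ch : C * (e + u) <= 2 * C by nra.
  have Ch0 : 0 <= C * (e + u) by nra.
  have [[[lhI lhJ] lhI'] lhJ'] := (lo_le_hi I, lo_le_hi J, lo_le_hi I', lo_le_hi J').
  have bI3 : bounded_itv (3 * C) I by clear -har hrepr bIl bIh sIl sIh Ch; split; lra.
  have bJ3 : bounded_itv (3 * C) J by clear -har hrepr bJl bJh sJl sJh Ch; split; lra.
  have [|ha hb] := hacc (3 * C) I J _ rI rJ bI3 bJ3; first by clear -har hrepr C1; lra.
  have C2u : (3 * C) ^+ 2 * u <= 9 * C ^+ 2 * (e + u).
    by rewrite exprMn; have := sqr_ge0 C; nra.
  have mem' x y : in_itv I' x -> in_itv J' y -> `|x * y| <= C ^+ 2.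
    move=> /andP[lx xh] /andP[ly yh]; rewrite normrM expr2.
    by apply: ler_pM => //; rewrite ler_norml; lra.
  have nearby x y : in_itv I x -> in_itv J y ->
      lo (exact_mul I' J') - 4 * C ^+ 2 * (e + u) <= x * y
      <= hi (exact_mul I' J') + 4 * C ^+ 2 * (e + u).
    move=> /andP[lx xh] /andP[ly yh].
    have [|x' x'I xx'] := @clamp I' _ x Ch0; first lra.
    have [|y' y'J yy'] := @clamp J' _ y Ch0; first lra.
    have /andP[m1 m2] := exact_mul_in x'I y'J.
    have : `|x * y - x' * y'| <= 4 * C ^+ 2 * (e + u).
      have -> : x * y - x' * y' = (x - x') * y + x' * (y - y') by ring.
      have ny : `|y| <= 3 * C by rewrite ler_norml; lra.
      have nx' : `|x'| <= C.
        by move: x'I => /andP[? ?]; rewrite ler_norml; lra.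
      apply: le_trans (ler_normD _ _) _; rewrite !normrM.
      apply: (@le_trans _ _ (C * (e + u) * (3 * C) + C * (C * (e + u)))).
        by apply: lerD; apply: ler_pM.
      by rewrite expr2; nra.
    by rewrite ler_norml; lra.
  have [fin1 fin2] := min4_max4_bounds nearby.
  have [c1 c2] : - C ^+ 2 <= lo (exact_mul I' J') /\ hi (exact_mul I' J') <= C ^+ 2.
    by apply: min4_max4_bounds => x y xI yJ; rewrite -ler_norml; exact: mem'.
  split=> //=.
  + by clear -har hrepr C1; nra.
  + by have [] := hrep _ _ rI rJ.
  + by split; have := sqr_ge0 C; clear -har hrepr c1 c2; lra.
  + by move: ha hb fin1 fin2; clear -har hrepr C2u; rewrite /isub /min4 /max4 /=; lra.
- move=> [u e] C I J [/= C1 h0 rI [bl bh] [sl sh]]; split=> //=.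
  + exact: repr_iopp.
  + by split=> /=; lra.
  + by rewrite /isub /min4 /max4 /=; lra.
Qed.

End Enclosures.

Section BoxEvaluation.
Variables (R : realType) (n : nat) (F : 'I_n -> mpoly n.+1 R[i]).
Variables (c dc : circuit R n.+1) (out : 'I_n -> node c) (dout : 'I_n -> 'I_n -> node dc).
Implicit Types (u v e M t : R) (T : itv R) (X W : 'cV[cbox R]_n) (x : 'cV[R[i]]_n) (A : 'M[R[i]]_n).
Hypotheses (hout : forall i, node_poly (out i) = F i)
  (hdout : forall i j, node_poly (dout i j) = mderiv (lift ord0 j) (F i)).

Definition evalF (ar : arithmetic R) u T X : 'cV[cbox R]_n :=
  \col_i eval_box ar u T X (out i).

Definition evaldF (ar : arithmetic R) u T X : 'M[cbox R]_n :=
  \matrix_(i, j) eval_box ar u T X (dout i j).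

(* The two terms of the box [K] computed by the test: the residual is enclosed in
   [newton_box], and [slope_box] is the product with [W], of which [B] is the case of
   interest. *)
Definition newton_box (ar : arithmetic R) u T X (A : 'M[R[i]]_n) : 'cV[cbox R]_n :=
  mxbox_mul ar u (mxpt A) (evalF ar u T X).

Definition slope_box (ar : arithmetic R) u T X (A : 'M[R[i]]_n) W : 'cV[cbox R]_n :=
  mxbox_mul ar u
    (mxbox_sub ar u (mxpt 1%:M) (mxbox_mul ar u (mxpt A) (evaldF ar u T X))) W.

Lemma eval_circuit_hom N (S T : Type) (h : S -> T) (k1 : R[i] -> S) add1 mul1
    inp1 k2 add2 mul2 inp2 (d : circuit R N) (m : node d) :
  (forall a, h (k1 a) = k2 a) -> (forall p q, h (add1 p q) = add2 (h p) (h q)) ->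
  (forall p q, h (mul1 p q) = mul2 (h p) (h q)) -> (forall i, h (inp1 i) = inp2 i) ->
  h (eval_circuit k1 add1 mul1 inp1 m) = eval_circuit k2 add2 mul2 inp2 m.
Proof.
move=> hk hadd hmul hinp; rewrite /eval_circuit.
suff H s k : h (nth (k1 0)
    (foldl (fun vals g => rcons vals (eval_gate k1 add1 mul1 inp1 vals g)) [::] s) k) =
    nth (k2 0) (foldl (fun vals g => rcons vals (eval_gate k2 add2 mul2 inp2 vals g)) [::] s) k.
  exact: H.
have sz (U : Type) kc ad mu inp (t : seq (gate R N)) : size (foldl (fun vals g =>
    rcons vals (@eval_gate R N U kc ad mu inp vals g)) [::] t) = size t.
  by elim/last_ind: t => [//|t g IH]; rewrite foldl_rcons !size_rcons IH.
elim/last_ind: s k => [|s g IH] k; first by rewrite /= !nth_nil hk.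
rewrite !foldl_rcons !nth_rcons !sz; case: ifP => _; first exact: IH.
case: ifP => _; last by rewrite hk.
by case: g => [i|a|i j|i j] /=; rewrite ?hinp ?hk ?hadd ?hmul ?IH.
Qed.

(** Evaluating a polynomial at a point and taking the point box is a homomorphism into exact box
    arithmetic, so it commutes with circuit evaluation. Every link between boxes and [F] goes
    through this identity. *)
Lemma eval_box_point u t (x : 'cV[R[i]]_n) (d : circuit R n.+1) (m : node d) :
  eval_box (exact_arith R) u (pt t) (mxpt x) m =
  cpt (meval (family_point t x) (node_poly m)).
Proof.
symmetry; rewrite /eval_box /node_poly.
apply: (@eval_circuit_hom _ _ _ (fun p => cpt (meval (family_point t x) p))) => [a|p q|p q|i].
- by rewrite mevalC.
- by rewrite mevalD exact_cadd_pt.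
- by rewrite mevalM exact_cmul_pt.
- by rewrite mevalXU /family_point; case: unlift => [j|] //; rewrite mxE.
Qed.

Lemma newton_box_point u t x A : newton_box (exact_arith R) u (pt t) (mxpt x) A =
  mxpt (A *m Fmap F t x).
Proof.
have eqF : evalF (exact_arith R) u (pt t) (mxpt x) = mxpt (Fmap F t x).
  by apply/matrixP => i j; rewrite !mxE eval_box_point hout.
by rewrite /newton_box eqF exact_mul_mxpt.
Qed.

Lemma slope_box_point u t x A W : slope_box (exact_arith R) u (pt t) (mxpt x) A W =
  mxbox_mul (exact_arith R) u (mxpt (1%:M - A *m dFmap F t x)) W.
Proof.
have eqd : evaldF (exact_arith R) u (pt t) (mxpt x) = mxpt (dFmap F t x).
  by apply/matrixP => i j; rewrite !mxE eval_box_point hdout.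
by rewrite /slope_box eqd exact_mul_mxpt exact_sub_mxpt.
Qed.

Lemma in_cboxP (X : cbox R) z : in_cbox X z <-> csubx 0 (cpt z) X.
Proof.
rewrite /in_cbox /csubx !isub0P /in_itv /=.
by split=> [[h1 h2]|[[h1 _] [h2 _]]].
Qed.

Variables (repr : set R) (hrepr : representable_numbers repr).
Hypotheses (hc : repr_circuit repr c) (hdc : repr_circuit repr dc).

Section Parametric.
Variables (P : Type) (valid : P -> Prop).
Variables (ar1 ar2 : P -> arithmetic R) (u1 u2 : P -> R).
Variable rel : P -> R -> itv R -> itv R -> Prop.
Hypothesis relP : parametric valid repr ar1 ar2 u1 u2 rel.

Lemma relc_eval_box C (d : circuit R n.+1) (m : node d) : repr_circuit repr d ->
  exists C', forall p T T' X X', valid p -> rel p C T T' -> relmx rel p C X X' ->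
  relc rel p C' (eval_box (ar1 p) (u1 p) T X m) (eval_box (ar2 p) (u2 p) T' X' m).
Proof.
move=> hd; have r0 := repr0 hrepr.
have [C0 h0] := rel_pt relP r0.
have [C' h'] := relc_eval relP r0 (Num.max C C0) hd.
exists C' => p T T' X X' vp rT rX; apply: h' => // i.
case: unlift => [j|]; first by apply: (relc_mono relP _ (rX j 0)); rewrite le_max lexx.
split=> /=; first by apply: (rel_mono relP _ rT); rewrite le_max lexx.
by apply: (rel_mono relP _ (h0 p vp)); rewrite le_max lexx orbT.
Qed.

Lemma relmx_newton C : exists C', forall p T T' X X' A, valid p ->
  rel p C T T' -> relmx rel p C X X' -> relmx rel p C (mxpt A) (mxpt A) ->
  relmx rel p C' (newton_box (ar1 p) (u1 p) T X A) (newton_box (ar2 p) (u2 p) T' X' A).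
Proof.
have [C1 h1] : exists C1, forall i p T T' X X', valid p -> rel p C T T' ->
    relmx rel p C X X' -> relc rel p C1
      (eval_box (ar1 p) (u1 p) T X (out i)) (eval_box (ar2 p) (u2 p) T' X' (out i)).
  apply: uniform_const => [i C1 C1' le1 h p T T' X X' vp rT rX|i].
    by apply: (relc_mono relP _ (h _ _ _ _ _ vp rT rX)).
  exact: relc_eval_box.
have [C2 h2] := relmx_mul relP (repr0 hrepr) n n 1 (Num.max C C1).
exists C2 => p T T' X X' A vp rT rX rA; apply: h2 => // i j.
  by apply: (relc_mono relP _ (rA i j)); rewrite le_max lexx.
by rewrite !mxE; apply: (relc_mono relP _ (h1 i _ _ _ _ _ vp rT rX)); rewrite le_max lexx orbT.
Qed.

Lemma relmx_slope C : exists C', forall p T T' X X' A W W', valid p ->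
  rel p C T T' -> relmx rel p C X X' -> relmx rel p C (mxpt A) (mxpt A) ->
  relmx rel p C W W' ->
  relmx rel p C' (slope_box (ar1 p) (u1 p) T X A W)
                 (slope_box (ar2 p) (u2 p) T' X' A W').
Proof.
have [C1 h1] : exists C1, forall ij p T T' X X', valid p -> rel p C T T' ->
    relmx rel p C X X' -> relc rel p C1
      (eval_box (ar1 p) (u1 p) T X (dout ij.1 ij.2))
      (eval_box (ar2 p) (u2 p) T' X' (dout ij.1 ij.2)).
  apply: uniform_const => [ij C1 C1' le1 h p T T' X X' vp rT rX|ij].
    by apply: (relc_mono relP _ (h _ _ _ _ _ vp rT rX)).
  exact: relc_eval_box.
have [C2 h2] := relmx_mul relP (repr0 hrepr) n n n (Num.max C C1).
have [C0 h0] : exists C0, forall (ij : 'I_n * 'I_n) p, valid p ->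
    relc rel p C0 (mxpt 1%:M ij.1 ij.2) (mxpt 1%:M ij.1 ij.2).
  apply: uniform_const => [ij C0 C0' le0 h p vp|ij].
    by apply: (relc_mono relP _ (h _ vp)).
  have [C0 h0] := relc_cpt relP (repr_mx1 hrepr ij.1 ij.2).
  by exists C0 => p vp; rewrite mxE; exact: h0.
have [C3 h3] := relmx_sub relP n n (Num.max C0 C2).
have [C4 h4] := relmx_mul relP (repr0 hrepr) n n 1 (Num.max C C3).
exists C4 => p T T' X X' A W W' vp rT rX rA rW; apply: h4 => //; last first.
  by apply: (relmx_mono relP _ rW); rewrite le_max lexx.
apply: (relmx_mono relP _ (h3 _ _ _ _ _ vp _ _)) => //.
- by rewrite le_max lexx orbT.
- by move=> i j; apply: (relc_mono relP _ (h0 (i, j) _ vp)); rewrite le_max lexx.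
apply: (relmx_mono relP _ (h2 _ _ _ _ _ vp _ _)) => //.
- by rewrite le_max lexx orbT.
- by apply: (relmx_mono relP _ rA); rewrite le_max lexx.
move=> i j; rewrite !mxE; apply: (relc_mono relP _ (h1 (i, j) _ _ _ _ _ vp rT rX)) => //.
by rewrite le_max lexx orbT.
Qed.

End Parametric.

Variables (ar : arithmetic R) (har : valid_arithmetic repr ar).

Lemma enclosed_mxpt p q u C (A : 'M[R[i]]_(p, q)) : repr_mx repr A ->
  relmx (enclosed repr) u C (mxpt A) (mxpt A).
Proof.
by move=> rA i j; rewrite mxE; have [r1 r2] := rA i j; split; split=> //;
  rewrite /isub subr0 addr0.
Qed.

Lemma newton_box_incl u v T T' X X' A : 0 < u < 1 -> repr_itv repr T' ->
  repr_vbox repr X' -> repr_mx repr A -> isub 0 T T' ->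
  (forall i, csubx 0 (X i 0) (X' i 0)) -> forall i,
  csubx 0 (newton_box (exact_arith R) v T X A i 0) (newton_box ar u T' X' A i 0).
Proof.
move=> u01 rT rX rA TT' XX' i.
have [C h] := relmx_newton (enclosed_parametric hrepr har (fun=> v)) 0.
have rXX : relmx (enclosed repr) u 0 X X'.
  by move=> k j; rewrite !ord1; have [? ?] := rX k; have [? ?] := XX' k.
by have [[_ ?] [_ ?]] := h u T T' X X' A u01 (conj rT TT') rXX (enclosed_mxpt _ _ rA) i 0.
Qed.

Lemma slope_box_incl u v T T' X X' A W W' : 0 < u < 1 -> repr_itv repr T' ->
  repr_vbox repr X' -> repr_mx repr A -> repr_vbox repr W' -> isub 0 T T' ->
  (forall i, csubx 0 (X i 0) (X' i 0)) -> (forall i, csubx 0 (W i 0) (W' i 0)) ->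
  forall i,
  csubx 0 (slope_box (exact_arith R) v T X A W i 0) (slope_box ar u T' X' A W' i 0).
Proof.
move=> u01 rT rX rA rW TT' XX' WW' i.
have [C h] := relmx_slope (enclosed_parametric hrepr har (fun=> v)) 0.
have rXX : relmx (enclosed repr) u 0 X X'.
  by move=> k j; rewrite !ord1; have [? ?] := rX k; have [? ?] := XX' k.
have rWW : relmx (enclosed repr) u 0 W W'.
  by move=> k j; rewrite !ord1; have [? ?] := rW k; have [? ?] := WW' k.
by have [[_ ?] [_ ?]] :=
  h u T T' X X' A W W' u01 (conj rT TT') rXX (enclosed_mxpt _ _ rA) rWW i 0.
Qed.

Definition bounded_cbox M (X : cbox R) : Prop := bounded_itv M X.1 /\ bounded_itv M X.2.

Lemma bounded_itv_mono M M' (J : itv R) : M <= M' -> bounded_itv M J -> bounded_itv M' J.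
Proof. by move=> MM' [h1 h2]; split; lra. Qed.

Lemma near_mxpt p q u e C (A : 'M[R[i]]_(p, q)) : repr_mx repr A -> 0 < u < 1 ->
  0 <= e <= 1 -> 1 <= C -> (forall i j, cabs (A i j) <= C) ->
  relmx (near_itv repr) (u, e) C (mxpt A) (mxpt A).
Proof.
move=> rA /andP[u0 u1] /andP[e0 e1] C1 AC i j; rewrite mxE.
have [r1 r2] := rA i j; have := AC i j; rewrite cabs_le !ler_norml.
move=> /andP[/andP[h1 h2] /andP[h3 h4]].
have h : 0 <= C * (e + u) by apply: mulr_ge0; lra.
have h' : 0 <= e + u by lra.
by split; split=> //; rewrite /isub /=; lra.
Qed.

Lemma near_itv_ext u e C (I J : itv R) : 0 < u < 1 -> 0 <= e <= 1 -> 1 <= C ->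
  repr_itv repr I -> bounded_itv C J -> isub e I J -> near_itv repr (u, e) C I J.
Proof.
move=> /andP[u0 u1] /andP[e0 e1] C1 rI bJ [h1 h2].
have h : e <= C * (e + u).
  apply: (@le_trans _ _ (1 * (e + u))); first lra.
  by rewrite ler_wpM2r //; lra.
by split=> //=; [lra | split; lra].
Qed.

(** The constant depends on the size [M] of the exact data alone. In this lemma and in
    [slope_box_near], [e] is how far the input boxes extend beyond the exact ones; later it is the
    step [h] of the parameter, or the radius of a ball compared with its centre. *)
Lemma newton_box_near M : exists2 C, 1 <= C & forall u e T T' X X' A,
  0 < u < 1 -> 0 <= e <= 1 -> repr_itv repr T -> repr_vbox repr X -> repr_mx repr A ->
  bounded_itv M T' -> (forall i, bounded_cbox M (X' i 0)) ->
  (forall i j, cabs (A i j) <= M) -> isub e T T' ->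
  (forall i, csubx e (X i 0) (X' i 0)) -> forall i,
  csubx (C * (e + u)) (newton_box ar u T X A i 0)
    (newton_box (exact_arith R) u T' X' A i 0).
Proof.
pose M' := Num.max 1 M; have M1 : 1 <= M' by rewrite le_max lexx.
have MM' : M <= M' by rewrite le_max lexx orbT.
have [C h] := relmx_newton (near_itv_parametric hrepr har) M'.
exists (Num.max 1 C); first by rewrite le_max lexx.
move=> u e T T' X X' A u01 e01 rT rX rA bT bX bA TT' XX' i.
have rXX : relmx (near_itv repr) (u, e) M' X X'.
  move=> k j; rewrite !ord1; have [? ?] := rX k; have [? ?] := XX' k; have [? ?] := bX k.
  by split; apply: near_itv_ext => //; apply: bounded_itv_mono MM' _.
have rTT : near_itv repr (u, e) M' T T'.
  by apply: near_itv_ext => //; apply: bounded_itv_mono MM' _.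
have rAA : relmx (near_itv repr) (u, e) M' (mxpt A) (mxpt A).
  by apply: near_mxpt => // k j; apply: le_trans (bA k j) MM'.
have := h (u, e) T T' X X' A (conj u01 e01) rTT rXX rAA i 0.
have CC : C <= Num.max 1 C by rewrite le_max lexx orbT.
by case/(relc_mono (near_itv_parametric hrepr har) CC) => [[_ _ _ _ ?] [_ _ _ _ ?]].
Qed.

Lemma slope_box_near M : exists2 C, 1 <= C & forall u e T T' X X' A W,
  0 < u < 1 -> 0 <= e <= 1 -> repr_itv repr T -> repr_vbox repr X -> repr_mx repr A ->
  repr_vbox repr W ->
  bounded_itv M T' -> (forall i, bounded_cbox M (X' i 0)) ->
  (forall i j, cabs (A i j) <= M) -> (forall i, bounded_cbox M (W i 0)) -> isub e T T' ->
  (forall i, csubx e (X i 0) (X' i 0)) -> forall i,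
  csubx (C * (e + u)) (slope_box ar u T X A W i 0)
    (slope_box (exact_arith R) u T' X' A W i 0).
Proof.
pose M' := Num.max 1 M; have M1 : 1 <= M' by rewrite le_max lexx.
have MM' : M <= M' by rewrite le_max lexx orbT.
have [C h] := relmx_slope (near_itv_parametric hrepr har) M'.
exists (Num.max 1 C); first by rewrite le_max lexx.
move=> u e T T' X X' A W u01 e01 rT rX rA rW bT bX bA bW TT' XX' i.
have rXX : relmx (near_itv repr) (u, e) M' X X'.
  move=> k j; rewrite !ord1; have [? ?] := rX k; have [? ?] := XX' k; have [? ?] := bX k.
  by split; apply: near_itv_ext => //; apply: bounded_itv_mono MM' _.
have rWW : relmx (near_itv repr) (u, e) M' W W.
  move=> k j; rewrite !ord1; have [? ?] := rW k; have [? ?] := bW k.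
  have /andP[e0 e1] := e01.
  split; apply: near_itv_ext => //;
  by [apply: bounded_itv_mono MM' _ | exact: isub_refl].
have rTT : near_itv repr (u, e) M' T T'.
  by apply: near_itv_ext => //; apply: bounded_itv_mono MM' _.
have rAA : relmx (near_itv repr) (u, e) M' (mxpt A) (mxpt A).
  by apply: near_mxpt => // k j; apply: le_trans (bA k j) MM'.
have := h (u, e) T T' X X' A W W (conj u01 e01) rTT rXX rAA rWW i 0.
have CC : C <= Num.max 1 C by rewrite le_max lexx orbT.
by case/(relc_mono (near_itv_parametric hrepr har) CC) => [[_ _ _ _ ?] [_ _ _ _ ?]].
Qed.

End BoxEvaluation.

(** * Norms of boxes and the test *)

Section BoxNorm.
Variables (R : realType) (n : nat).
Implicit Types (X Y : 'cV[cbox R]_n) (z : 'cV[R[i]]_n) (a e : R).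

Definition vbounded a X : Prop := forall i, bounded_cbox a (X i 0).

Lemma vboundedW a b X : a <= b -> vbounded a X -> vbounded b X.
Proof. by move=> ab Xa i; have [h1 h2] := Xa i; split; apply: bounded_itv_mono ab _. Qed.

Definition lo_corner X : 'cV[R[i]]_n := \col_i Complex (lo (X i 0).1) (lo (X i 0).2).
Definition hi_corner X : 'cV[R[i]]_n := \col_i Complex (hi (X i 0).1) (hi (X i 0).2).

Lemma lo_corner_in X : in_vbox X (lo_corner X).
Proof. by move=> i; rewrite mxE; split; exact: lo_in. Qed.

Lemma hi_corner_in X : in_vbox X (hi_corner X).
Proof. by move=> i; rewrite mxE; split; exact: hi_in. Qed.

Lemma vboundedP X a : 0 <= a ->
  vbounded a X <-> forall z, in_vbox X z -> cnorm z <= a.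
Proof.
move=> a0; split=> [Xa z Xz|Xa i].
  apply/cnorm_leP => // i; have [[l1 h1] [l2 h2]] := Xa i.
  have [/andP[? ?] /andP[? ?]] := Xz i.
  by rewrite cabs_le !ler_norml; apply/andP; split; lra.
have /cnorm_leP := Xa _ (lo_corner_in X) => /(_ a0 i).
have /cnorm_leP := Xa _ (hi_corner_in X) => /(_ a0 i).
by rewrite !mxE !cabs_le !ler_norml /=; move=> *; split; split; lra.
Qed.

Lemma vbounded_ex X : exists2 a, 0 <= a & vbounded a X.
Proof.
have [a ha] : exists a, forall i, bounded_cbox a (X i 0).
  apply: uniform_const => [i a a' aa' [h1 h2]|i].
    by split; apply: bounded_itv_mono aa' _.
  exists (`|lo (X i 0).1| + `|hi (X i 0).1| + `|lo (X i 0).2| + `|hi (X i 0).2|).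
  have abs (w : R) : - `|w| <= w <= `|w| by rewrite -ler_norml.
  have /andP[h1 h1'] := abs (lo (X i 0).1); have /andP[h2 h2'] := abs (hi (X i 0).1).
  have /andP[h3 h3'] := abs (lo (X i 0).2); have /andP[h4 h4'] := abs (hi (X i 0).2).
  by split; split; lra.
exists `|a| => // i; have [h1 h2] := ha i.
by split; apply: bounded_itv_mono (ler_norm a) _.
Qed.

Lemma boxnorm_leP X a : 0 <= a -> boxnorm X <= a <-> vbounded a X.
Proof.
move=> a0; rewrite /boxnorm; set S := [set cnorm x | x in _].
have S0 : S !=set0 by exists (cnorm (lo_corner X)), (lo_corner X) => //; exact: lo_corner_in.
split=> [Sa|Xa].
  apply/(vboundedP _ a0) => z Xz; apply: le_trans Sa.
  have [b b0 /(vboundedP _ b0) Xb] := vbounded_ex X.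
  apply: ub_le_sup; last by exists z.
  by exists b => _ [y Xy <-]; exact: Xb.
by apply: ge_sup => // _ [z Xz <-]; move/(vboundedP _ a0): Xa; apply.
Qed.

Lemma boxnorm_ge0 X : 0 <= boxnorm X.
Proof.
have [b b0 /(vboundedP _ b0) Xb] := vbounded_ex X.
apply: le_trans (cnorm_ge0 (lo_corner X)) _; apply: ub_le_sup.
  by exists b => _ [y Xy <-]; exact: Xb.
by exists (lo_corner X) => //; exact: lo_corner_in.
Qed.

Lemma cnorm_le_boxnorm X z : in_vbox X z -> cnorm z <= boxnorm X.
Proof.
have b0 := boxnorm_ge0 X.
by move: z; apply/(vboundedP _ b0); apply/(boxnorm_leP _ b0).
Qed.

Lemma cdist_le_width X y z : in_vbox X y -> in_vbox X z -> cnorm (y - z) <= width X.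
Proof.
move=> Xy Xz; have [b b0 /(vboundedP _ b0) Xb] := vbounded_ex X.
apply: ub_le_sup; last by exists y, z.
exists (b + b) => _ [p [q [Xp Xq ->]]].
by apply: le_trans (cnormB _ _) _; apply: lerD; exact: Xb.
Qed.

Lemma width_le X a : 0 <= a ->
  (forall y z, in_vbox X y -> in_vbox X z -> cnorm (y - z) <= a) -> width X <= a.
Proof.
move=> a0 Xa; apply: ge_sup => [|_ [y [z [Xy Xz ->]]]]; last exact: Xa.
by exists (cnorm (lo_corner X - lo_corner X)), (lo_corner X), (lo_corner X); split;
  rewrite //; exact: lo_corner_in.
Qed.

Lemma vbounded_csubx X Y a e :
  (forall i, csubx e (X i 0) (Y i 0)) -> vbounded a Y -> vbounded (a + e) X.
Proof.
move=> XY Ya i; have [[h1 h2] [h3 h4]] := XY i; have [[k1 k2] [k3 k4]] := Ya i.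
by split; split; lra.
Qed.

Lemma in_vbox_mxptP X z : in_vbox X z <-> forall i, csubx 0 (mxpt z i 0) (X i 0).
Proof.
by split=> Xz i; have := Xz i; rewrite mxE; move/in_cboxP.
Qed.

Lemma in_vball x r z : 0 <= r -> cnorm (z - x) <= r -> in_vbox (vball x r) z.
Proof.
move=> r0 /(cnorm_leP _ r0) zx i; have := zx i.
rewrite !mxE cabs_le !ler_norml ReD ImD ReN ImN => /andP[/andP[? ?] /andP[? ?]].
have [l1 h1] := hullE (complex.Re (x i 0)) r0; have [l2 h2] := hullE (complex.Im (x i 0)) r0.
by split; rewrite /= /in_itv /mkset ?l1 ?h1 ?l2 ?h2; apply/andP; split; lra.
Qed.

Lemma csubx_vball_mxpt (x y : 'cV[R[i]]_n) r e : 0 <= r -> cnorm (x - y) + r <= e ->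
  forall i, csubx e (vball x r i 0) (mxpt y i 0).
Proof.
move=> r0 xy i; rewrite !mxE.
have : cabs ((x - y) i 0) <= e - r by apply: le_trans (cabs_le_cnorm _ _) _; lra.
rewrite !mxE cabs_le !ler_norml ReD ImD ReN ImN => /andP[/andP[? ?] /andP[? ?]].
have [l1 h1] := hullE (complex.Re (x i 0)) r0; have [l2 h2] := hullE (complex.Im (x i 0)) r0.
by split; rewrite /isub ?l1 ?h1 ?l2 ?h2 /=; split; lra.
Qed.

Lemma vbounded_mxpt x a : cnorm x <= a -> vbounded a (mxpt x).
Proof.
move=> xa i; have := le_trans (cabs_le_cnorm x i) xa.
by rewrite mxE cabs_le !ler_norml => /andP[/andP[? ?] /andP[? ?]]; split.
Qed.

Lemma vbounded_vball x r : 0 <= r -> vbounded (cnorm x + r) (vball x r).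
Proof.
move=> r0; apply: vbounded_csubx (vbounded_mxpt (lexx _)).
by apply: csubx_vball_mxpt; rewrite // subrr cnorm0 add0r.
Qed.

End BoxNorm.

Section MooreTest.
Variables (R : realType) (n : nat) (repr : set R) (ar : arithmetic R).
Hypothesis har : valid_arithmetic repr ar.
Implicit Types (V J : 'cV[cbox R]_n) (u r : R).

Definition moore_sum u V J r : 'cV[cbox R]_n :=
  mxbox_add ar u (map_mx (fun X => copp (cboxscale r^-1 X)) V) J.

Lemma iscaleE (a : R) (I : itv R) : 0 <= a ->
  lo (iscale a I) = a * lo I /\ hi (iscale a I) = a * hi I.
Proof.
move=> a0; have h : a * lo I <= a * hi I by rewrite ler_wpM2l ?lo_le_hi.
by rewrite /= min_l // max_r.
Qed.

Lemma moore_sum_in u V J r v j : 0 < u < 1 -> 0 < r -> in_vbox V v -> in_vbox J j ->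
  in_vbox (moore_sum u V J r) (- cscale r^-1 v + j).
Proof.
move=> u01 r0 Vv Jj i; have [_ hadd _ _ _] := har u01.
have r'0 : 0 <= r^-1 by rewrite invr_ge0 ltW.
have [/andP[h1 h2] /andP[h3 h4]] := Vv i; have [j1 j2] := Jj i.
have scaled (I : itv R) x : lo I <= x <= hi I -> in_itv (iopp (iscale r^-1 I)) (- (r^-1 * x)).
  have [lI hI] := iscaleE I r'0 => /andP[h h'].
  change (- hi (iscale r^-1 I) <= - (r^-1 * x) <= - lo (iscale r^-1 I)).
  by rewrite lI hI !lerN2 !ler_wpM2l.
rewrite !mxE; split; rewrite ?ReD ?ImD ?ReN ?ImN ?Re_realM ?Im_realM; apply: hadd => //;
by apply: scaled; apply/andP.
Qed.

(** The residual box is scaled exactly before the addition, so both summands lie in [[-1, 1]] and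
    this last addition costs [u], whatever the size of [r]. *)
Lemma moore_sum_bounded u V J r a b : 0 < u < 1 -> 0 < r -> 0 <= a <= 1 -> 0 <= b <= 1 ->
  vbounded (a * r) V -> vbounded b J -> vbounded (a + b + u) (moore_sum u V J r).
Proof.
move=> u01 r0 /andP[a0 a1] /andP[b0 b1] Va Jb i; have [_ _ hacc _ _] := har u01.
have r'0 : 0 <= r^-1 by rewrite invr_ge0 ltW.
have scaled (I : itv R) : bounded_itv (a * r) I -> bounded_itv a (iopp (iscale r^-1 I)).
  move=> [h1 h2]; have [l1 k1] := iscaleE I r'0.
  have : - a <= r^-1 * lo I /\ r^-1 * hi I <= a.
    by rewrite ler_pdivlMl // ler_pdivrMl // mulrN ![r * _]mulrC.
  move=> [h3 h4]; split.
    by change (- a <= - hi (iscale r^-1 I)); rewrite k1 lerN2.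
  by change (- lo (iscale r^-1 I) <= a); rewrite l1 lerNl.
have [/scaled V1 /scaled V2] := Va i; have [J1 J2] := Jb i.
have ge (I : itv R) c : c <= 1 -> bounded_itv c I -> bounded_itv 1 I.
  by move=> c1; exact: bounded_itv_mono.
have add (I J' : itv R) : bounded_itv a I -> bounded_itv b J' ->
    bounded_itv (a + b + u) (iadd ar u I J').
  move=> Ia Jb'; have [] := hacc 1 I J' (lexx _) (ge _ _ a1 Ia) (ge _ _ b1 Jb').
  by case: Ia Jb' => [? ?] [? ?]; split; lra.
by rewrite !mxE; split; exact: add.
Qed.

End MooreTest.

(** * Mean value inequality and Moore boxes *)

Section ComplexPolynomial.
Variable R : realType.
Implicit Types (q : {poly R[i]}) (s : R) (z : R[i]).

Lemma Re_sum (T : Type) (r : seq T) (f : T -> R[i]) :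
  complex.Re (\sum_(k <- r) f k) = \sum_(k <- r) complex.Re (f k).
Proof. exact: (big_morph _ (@ReD R)). Qed.

Lemma Re_mulrn z k : complex.Re (z *+ k) = complex.Re z *+ k.
Proof. by elim: k => [//|k IH]; rewrite !mulrS ReD IH. Qed.

Definition re_poly q : {poly R} := \poly_(k < size q) complex.Re q`_k.

Lemma coef_re_poly q k : (re_poly q)`_k = complex.Re q`_k.
Proof. by rewrite coef_poly; case: ltnP => // h; rewrite nth_default. Qed.

Lemma horner_re_poly q s : (re_poly q).[s] = complex.Re q.[(s%:C)%C].
Proof.
rewrite horner_poly horner_coef Re_sum; apply: eq_bigr => k _.
by rewrite -rmorphXn /= mulrC -Re_realM mulrC.
Qed.

Lemma deriv_re_poly q : (re_poly q)^`() = re_poly q^`().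
Proof. by apply/polyP => k; rewrite coef_deriv !coef_re_poly coef_deriv Re_mulrn. Qed.

Lemma Re_mvt q : exists2 s : R, 0 <= s <= 1 &
  complex.Re (q.[1] - q.[0]) = complex.Re q^`().[(s%:C)%C].
Proof.
have [s] := poly_mvt (re_poly q) (@ltr01 R); rewrite interval.in_itv /= => /andP[s0 s1].
rewrite deriv_re_poly !horner_re_poly subr0 mulr1 ReD ReN => h.
by exists s; rewrite ?ltW.
Qed.

(** The mean value theorem is applied to the real part and, through multiplication by [-i], to the
    imaginary part. The two intermediate points may differ, but [cabs] is a maximum, so no constant
    is lost. *)
Lemma cabs_mvt q b : (forall s : R, 0 <= s <= 1 -> cabs q^`().[(s%:C)%C] <= b) ->
  cabs (q.[1] - q.[0]) <= b.
Proof.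
move=> qb; have ImE z : complex.Im z = complex.Re (Complex 0 (-1) * z).
  by rewrite ReM /=; ring.
rewrite cabs_le; apply/andP; split.
  by have [s s01 ->] := Re_mvt q; apply: le_trans (Re_le_cabs _) (qb s s01).
have [s s01] := Re_mvt (Complex 0 (-1) *: q).
rewrite derivZ !hornerZ -mulrBr -!ImE => ->.
by apply: le_trans (Im_le_cabs _) (qb s s01).
Qed.

End ComplexPolynomial.

Section Line.
Variables (R : realType) (N : nat) (v w : 'I_N -> R[i]).
Implicit Types p q : mpoly N R[i].

(** The restriction of [p] to the complex line [z -> v + z w]. It reduces the mean value inequality
    in several variables to formal derivatives in one variable. *)
Definition line_poly p : {poly R[i]} := mmap polyC (fun i => (v i)%:P + w i *: 'X) p.

Lemma horner_line_poly p z : (line_poly p).[z] = meval (fun i => v i + z * w i) p.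
Proof.
rewrite /line_poly /mmap horner_sum mevalE; apply: eq_bigr => m _.
rewrite hornerM hornerC; congr (_ * _); rewrite /mmap1 horner_prod.
apply: eq_bigr => i _; rewrite horner_exp; congr (_ ^+ _).
by rewrite hornerD hornerC hornerZ hornerX mulrC.
Qed.

Let chain_rule p :=
  (line_poly p)^`() = \sum_i (w i)%:P * line_poly (mderiv i p).

Let chain_ruleD p q : chain_rule p -> chain_rule q -> chain_rule (p + q).
Proof.
rewrite /chain_rule /line_poly => hp hq; rewrite mmapD derivD hp hq -big_split.
by apply: eq_bigr => i _; rewrite mderivD mmapD mulrDr.
Qed.

Let chain_ruleM p q : chain_rule p -> chain_rule q -> chain_rule (p * q).
Proof.
rewrite /chain_rule /line_poly => hp hq; rewrite rmorphM derivM hp hq.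
rewrite mulr_suml mulr_sumr -big_split; apply: eq_bigr => i _ /=.
by rewrite mderivM mmapD !rmorphM /= mulrDr mulrCA !mulrA.
Qed.

Let chain_ruleC a : chain_rule (mpolyC N a).
Proof.
rewrite /chain_rule /line_poly mmapC derivC big1 // => i _.
by rewrite mderivC mmap0 mulr0.
Qed.

Let chain_ruleX i : chain_rule (mpolyX R[i] (mnm1 i)).
Proof.
rewrite /chain_rule /line_poly mmapX mmap1U derivD derivC add0r derivZ derivX.
rewrite (bigD1 i) //= big1 ?addr0 => [|j ji].
  rewrite mderivX mnm1E eqxx scale1r.
  have -> : mnm_sub (mnm1 i) (mnm1 i) = mnm0 by apply/mnmP => k; rewrite mnmBE subnn mnm0E.
  by rewrite mmapX mmap11 mulr1 alg_polyC.
by rewrite mderivX mnm1E eq_sym (negbTE ji) scale0r mmap0 mulr0.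
Qed.

(** The chain rule passes to sums and products, hence from constants and variables to all
    polynomials along their monomial expansion. *)
Lemma deriv_line_poly p : chain_rule p.
Proof.
rewrite [p]mpolyE; elim/big_ind: _ => [|p1 p2|m _].
- by rewrite -(mpolyC0 N); exact: chain_ruleC.
- exact: chain_ruleD.
rewrite -mul_mpolyC; apply: chain_ruleM => //; rewrite mpolyXE_id.
elim/big_ind: _ => [|p1 p2|i _].
- by rewrite -mpolyC1; exact: chain_ruleC.
- exact: chain_ruleM.
elim: (m i) => [|k IH]; first by rewrite expr0 -mpolyC1; exact: chain_ruleC.
by rewrite exprS; exact: (chain_ruleM (chain_ruleX i) IH).
Qed.

End Line.

Section MeanValue.
Variables (R : realType) (n : nat) (F : 'I_n -> mpoly n.+1 R[i]).
Implicit Types (t s : R) (x y z b w : 'cV[R[i]]_n) (A : 'M[R[i]]_n).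

(** This is the mean value inequality for [s -> s b - A F_t(x + s w)] on [[0, 1]]. Keeping [b]
    inside the norm preserves the cancellation against the linear part of [A F_t]. *)
Lemma mean_value t x w b A rho :
  (forall s, 0 <= s <= 1 ->
     cnorm (b - A *m (dFmap F t (x + cscale s w) *m w)) <= rho) ->
  cnorm (b - A *m (Fmap F t (x + w) - Fmap F t x)) <= rho.
Proof.
move=> bound.
have rho0 : 0 <= rho by apply: le_trans (cnorm_ge0 _) (bound 0 _); rewrite lexx ler01.
apply/cnorm_leP => // i.
(* The direction has parameter coordinate 0, since [t] is fixed along the segment. *)
pose wd k := if unlift ord0 k is Some j then w j 0 else 0.
pose L := @line_poly R n.+1 (family_point t x) wd.
have pointE (s : R) : family_point t (x + cscale s w) =1
    (fun k => family_point t x k + (s%:C)%C * wd k).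
  by move=> k; rewrite /family_point /wd; case: unlift => [j|]; rewrite ?mxE ?mulr0 ?addr0.
pose q := (b i 0)%:P * 'X - \sum_j (A i j)%:P * L (F j).
have qE (s : R) : q.[(s%:C)%C] =
    b i 0 * (s%:C)%C - (A *m Fmap F t (x + cscale s w)) i 0.
  rewrite /q hornerD hornerN hornerM hornerC hornerX horner_sum mxE; congr (_ - _).
  apply: eq_bigr => j _; rewrite hornerM hornerC horner_line_poly mxE.
  by congr (_ * _); symmetry; exact: meval_eq.
have dL (s : R) j : (L (F j))^`().[(s%:C)%C] = (dFmap F t (x + cscale s w) *m w) j 0.
  rewrite deriv_line_poly horner_sum mxE big_ord_recl.
  rewrite [X in X + _]hornerM hornerC {1}/wd unlift_none mul0r add0r.
  apply: eq_bigr => k _; rewrite hornerM hornerC {1}/wd liftK mulrC horner_line_poly mxE.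
  by congr (_ * _); symmetry; exact: meval_eq.
have q'E (s : R) : q^`().[(s%:C)%C] =
    (b - A *m (dFmap F t (x + cscale s w) *m w)) i 0.
  rewrite /q derivB derivM derivC mul0r add0r derivX mulr1 hornerD hornerN hornerC.
  rewrite mxE [in RHS]mxE mxE raddf_sum horner_sum; congr (_ - _); apply: eq_bigr => j _.
  by rewrite /= derivM derivC mul0r add0r hornerM hornerC dL.
have := qE 1; have := qE 0; rewrite cscale1 /cscale.
rewrite (_ : (0%:C)%C = 0 :> R[i]) // (_ : (1%:C)%C = 1 :> R[i]) //.
rewrite scale0r addr0 mulr0 mulr1 sub0r mulmxBr => q0 q1.
have -> : (b - (A *m Fmap F t (x + w) - A *m Fmap F t x)) i 0 =
    b i 0 - (A *m Fmap F t (x + w)) i 0 - - (A *m Fmap F t x) i 0.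
  by rewrite !mxE; ring.
rewrite -q0 -q1; apply: cabs_mvt => s s01; rewrite q'E; apply: le_trans (cabs_le_cnorm _ _) _; exact: bound.
Qed.

End MeanValue.

Section Moore.
Variables (R : realType) (n : nat) (F : 'I_n -> mpoly n.+1 R[i]).
Implicit Types (t r rho : R) (x y z u v w : 'cV[R[i]]_n) (A : 'M[R[i]]_n).

Local Notation f := (Fmap F).
Local Notation df := (dFmap F).

(** The differential of the Newton map [y -> y - A F_t(y)] has operator norm at most [rho] on the
    ball: what is left of the Moore condition without its residual term. *)
Definition contracting rho t x r A : Prop := forall z v, cnorm (z - x) <= r ->
  cnorm ((1%:M - A *m df t z) *m v) <= rho * cnorm v.

Lemma cscaleB (a : R) v w : cscale a (v - w) = cscale a v - cscale a w.
Proof. exact: scalerBr. Qed.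

Lemma cscaleD (a : R) v w : cscale a (v + w) = cscale a v + cscale a w.
Proof. exact: scalerDr. Qed.

Lemma mulmx_cscale (a : R) A v : A *m cscale a v = cscale a (A *m v).
Proof. by rewrite /cscale -scalemxAr. Qed.

(** Subtracting the Moore conditions for [v] and [-v] cancels the residual and leaves twice the
    linear term, of norm at most [2 rho]. *)
Lemma moore_contracting rho t x r A :
  moore_box (f t) (df t) rho x r A -> contracting rho t x r A.
Proof.
move=> [r0 mA] z v zx.
have [/cnorm0_eq0 ->|v0] := lerP (cnorm v) 0.
  by rewrite mulmx0 cnorm0 mulr0.
have vv : cnorm (cscale (cnorm v)^-1 v) <= 1.
  by rewrite cnormZ gtr0_norm ?invr_gt0 // mulVf // gt_eqF.
have uu : cnorm (cscale r^-1 (z - x)) <= 1.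
  by rewrite cnormZ gtr0_norm ?invr_gt0 // ler_pdivrMl // mulr1.
have zE : x + cscale r (cscale r^-1 (z - x)) = z by rewrite cscaleV ?gt_eqF // addrCA subrr addr0.
have := mA _ (cscale (cnorm v)^-1 v) uu vv; have := mA _ (- cscale (cnorm v)^-1 v) uu.
rewrite cnormN zE => /(_ vv); set a := - cscale _ _; set M := 1%:M - _.
rewrite mulmxN mulmx_cscale => h1 h2.
have : cnorm (cscale 2 (cscale (cnorm v)^-1 (M *m v))) <= rho + rho.
  have -> (w : 'cV[R[i]]_n) : cscale 2 w = (a + w) - (a - w).
    by rewrite /cscale rmorph_nat scaler_nat mulr2n opprB [a + w]addrC addrACA subrr addr0.
  by apply: le_trans (cnormB _ _) _; apply: lerD.
rewrite !cnormZ ger0_norm // gtr0_norm ?invr_gt0 // mulrCA -ler_pdivlMl ?invr_gt0 //.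
by rewrite invrK; lra.
Qed.

Lemma mooreW rho rho' t x r A : rho <= rho' ->
  moore_box (f t) (df t) rho x r A -> moore_box (f t) (df t) rho' x r A.
Proof. by move=> le [r0 h]; split=> // u v u1 v1; apply: le_trans (h u v u1 v1) le. Qed.

Lemma ball_convex x r y z (s : R) : 0 <= s <= 1 -> cnorm (y - x) <= r -> cnorm (z - x) <= r ->
  cnorm (z + cscale s (y - z) - x) <= r.
Proof.
move=> /andP[s0 s1] yx zx.
have -> : z + cscale s (y - z) - x = cscale (1 - s) (z - x) + cscale s (y - x).
  have e : cscale (1 - s) (z - x) = (z - x) - cscale s (z - x).
    by rewrite /cscale rmorphB rmorph1 scalerBl scale1r.
  have -> : y - z = (y - x) - (z - x) by rewrite opprB addrA subrK.
  rewrite e cscaleB.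
  by apply/matrixP => i j; rewrite !mxE; ring.
apply: le_trans (cnormD _ _) _; rewrite !cnormZ !ger0_norm ?subr_ge0 //.
have : (1 - s) * cnorm (z - x) <= (1 - s) * r by rewrite ler_wpM2l ?subr_ge0.
have : s * cnorm (y - x) <= s * r by rewrite ler_wpM2l.
by lra.
Qed.

Lemma newton_dist rho t x r A y z : contracting rho t x r A ->
  cnorm (y - x) <= r -> cnorm (z - x) <= r ->
  cnorm ((y - z) - A *m (f t y - f t z)) <= rho * cnorm (y - z).
Proof.
move=> cA yx zx; rewrite -[in f t y](subrK z y) [y - z + z]addrC.
apply: mean_value => s s01; have h := cA _ (y - z) (ball_convex s01 yx zx).
by apply: le_trans h; rewrite mulmxBl mul1mx mulmxA.
Qed.

(** Along the segment from [x] to [y], the vector to be bounded is [r] times the Moore expression at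
    [u = s (y - x) / r] and [v = (y - x) / r]. *)
Lemma newton_center rho t x r A y : moore_box (f t) (df t) rho x r A ->
  cnorm (y - x) <= r -> cnorm (y - A *m f t y - x) <= rho * r.
Proof.
move=> [r0 mA] yx.
have -> : y - A *m f t y - x = (- (A *m f t x) + (y - x)) - A *m (f t (x + (y - x)) - f t x).
  rewrite [x + _]addrC subrK mulmxBr opprB.
  by apply/matrixP => i j; rewrite !mxE; ring.
apply: mean_value => s s01.
have uu : cnorm (cscale r^-1 (cscale s (y - x))) <= 1.
  rewrite cnormZ gtr0_norm ?invr_gt0 // ler_pdivrMl // mulr1 cnormZ.
  case/andP: s01 => s0 s1; rewrite ger0_norm //.
  by apply: le_trans yx; rewrite ler_piMl ?cnorm_ge0.
have vv : cnorm (cscale r^-1 (y - x)) <= 1.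
  by rewrite cnormZ gtr0_norm ?invr_gt0 // ler_pdivrMl // mulr1.
have := mA _ _ uu vv; rewrite cscaleV ?gt_eqF // mulmx_cscale.
set M := (1%:M - _) *m _; have -> : - cscale r^-1 (A *m f t x) + cscale r^-1 M =
    cscale r^-1 (- (A *m f t x) + M) by rewrite cscaleD /cscale scalerN.
rewrite cnormZ gtr0_norm ?invr_gt0 // ler_pdivrMl // [r * _]mulrC.
by rewrite /M mulmxBl mul1mx mulmxA addrA.
Qed.

Section Zero.
Variables (rho t r : R) (x zeta : 'cV[R[i]]_n) (A : 'M[R[i]]_n).
Hypotheses (zeta0 : f t zeta = 0) (zetax : cnorm (zeta - x) <= r).

(** A zero is a fixed point of the Newton map, so [newton_center] applies to it. The resulting
    margin [(1 - rho) r] to the boundary is what continuation lives on. *)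
Lemma zero_center : moore_box (f t) (df t) rho x r A -> cnorm (zeta - x) <= rho * r.
Proof. by move=> /newton_center/(_ zetax); rewrite zeta0 mulmx0 subr0. Qed.

Hypothesis cA : contracting rho t x r A.

Lemma newton_zero y : cnorm (y - x) <= r ->
  cnorm (y - A *m f t y - zeta) <= rho * cnorm (y - zeta).
Proof.
move=> yx; have := newton_dist cA yx zetax.
by rewrite zeta0 subr0 addrAC.
Qed.

Lemma residual_le y : cnorm (y - x) <= r ->
  cnorm (A *m f t y) <= (1 + rho) * cnorm (y - zeta).
Proof.
move=> /newton_zero h.
have := ler_cnormD (- (A *m f t y)) (- (y - zeta)).
have -> : - (A *m f t y) - - (y - zeta) = y - A *m f t y - zeta.
  by rewrite opprK addrC addrAC.
by rewrite !cnormN => h'; lra.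
Qed.

Lemma le_residual y : cnorm (y - x) <= r ->
  (1 - rho) * cnorm (y - zeta) <= cnorm (A *m f t y).
Proof.
move=> /newton_zero h.
have := ler_cnormD (y - zeta) (A *m f t y).
have -> : y - zeta - A *m f t y = y - A *m f t y - zeta by rewrite addrAC.
by move=> h'; lra.
Qed.

Lemma zero_unique z : rho < 1 -> f t z = 0 -> cnorm (z - x) <= r -> z = zeta.
Proof.
move=> rho1 z0 zx; have := le_residual zx; rewrite z0 mulmx0 cnorm0 => h.
apply/eqP; rewrite -subr_eq0; apply/eqP/cnorm0_eq0.
by rewrite leNgt; apply/negP => h'; nra.
Qed.

End Zero.

Lemma cnorm_unitmx (M : 'M[R[i]]_n) rho : rho < 1 ->
  (forall v, cnorm ((1%:M - M) *m v) <= rho * cnorm v) -> M \in unitmx.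
Proof.
move=> rho1 hM; rewrite -unitmx_tr -row_free_unit; apply: inj_row_free => v vM.
have Mv : M *m v^T = 0 by rewrite -[M]trmxK -trmx_mul vM trmx0.
have := hM v^T; rewrite mulmxBl mul1mx Mv subr0 => h.
have : cnorm v^T <= 0 by rewrite leNgt; apply/negP => h'; nra.
by move/cnorm0_eq0 => vT; rewrite -[v]trmxK vT trmx0.
Qed.

Lemma cnorm_inverse (A D : 'M[R[i]]_n) rho v : rho < 1 ->
  (forall v, cnorm ((1%:M - A *m D) *m v) <= rho * cnorm v) ->
  [/\ A \in unitmx, D \in unitmx & (1 - rho) * cnorm (invmx D *m v) <= cnorm (A *m v)].
Proof.
move=> rho1 hAD; have := cnorm_unitmx rho1 hAD; rewrite unitmx_mul => /andP[uA uD].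
split=> //; have := hAD (invmx D *m v).
rewrite mulmxBl mul1mx -mulmxA mulKVmx // => h.
by have := ler_cnormD (invmx D *m v) (A *m v); lra.
Qed.

End Moore.

Section TestSoundness.
Variables (R : realType) (n : nat) (F : 'I_n -> mpoly n.+1 R[i]).
Variables (c dc : circuit R n.+1) (out : 'I_n -> node c) (dout : 'I_n -> 'I_n -> node dc).
Hypotheses (hout : forall i, node_poly (out i) = F i)
  (hdout : forall i j, node_poly (dout i j) = mderiv (lift ord0 j) (F i)).
Variables (repr : set R) (hrepr : representable_numbers repr).
Hypotheses (hc : repr_circuit repr c) (hdc : repr_circuit repr dc).
Variables (ar : arithmetic R) (har : valid_arithmetic repr ar).

Variables (u : R) (T : itv R) (x : 'cV[R[i]]_n) (r : R) (A : 'M[R[i]]_n).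
Hypotheses (u01 : 0 < u < 1) (rT : repr_itv repr T) (rx : repr_mx repr x).
Hypotheses (rr : repr r) (rA : repr_mx repr A) (r0 : 0 < r).

Local Notation V := (newton_box out ar u T (mxpt x) A).
Local Notation J := (slope_box dout ar u T (vball x r) A (vball 0 1)).
Local Notation test := (testM ar u (evalF out ar u T) (evaldF dout ar u T) x r A).

Lemma pt_isub t : in_itv T t -> isub 0 (pt t) T.
Proof. by move=> /andP[h1 h2]; split=> /=; rewrite ?subr0 ?addr0. Qed.

Lemma residual_in t : in_itv T t -> in_vbox V (A *m Fmap F t x).
Proof.
move=> /pt_isub Tt.
have rX : repr_vbox repr (mxpt x) by exact: repr_mxpt.
have XX i := csubx_refl (mxpt x i 0) (lexx 0).
have := newton_box_incl out hrepr hc har u u01 rT rX rA Tt XX.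
by rewrite (newton_box_point hout) => h; apply/in_vbox_mxptP.
Qed.

Lemma slope_in t z v : in_itv T t -> cnorm (z - x) <= r -> cnorm v <= 1 ->
  in_vbox J ((1%:M - A *m dFmap F t z) *m v).
Proof.
move=> /pt_isub Tt zx v1; have r0' := ltW r0.
have rX : repr_vbox repr (vball x r) by exact: repr_vball.
have /in_vbox_mxptP XX := in_vball r0' zx.
have /in_vbox_mxptP WW : in_vbox (vball 0 1) v by apply: in_vball; rewrite ?subr0.
have := slope_box_incl dout hrepr hdc har u u01 rT rX rA (@repr_vball01 _ _ hrepr n) Tt XX WW.
by rewrite (slope_box_point hdout) exact_mul_mxpt => h; apply/in_vbox_mxptP.
Qed.

Lemma test_in rho v j : 0 <= rho -> test rho -> in_vbox V v -> in_vbox J j ->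
  cnorm (- cscale r^-1 v + j) <= rho.
Proof.
move=> rho0 /(boxnorm_leP _ rho0)/(vboundedP _ rho0) h Vv Jj.
by apply: h; apply: (moore_sum_in har).
Qed.

Lemma test_moore rho t : 0 <= rho -> test rho -> in_itv T t ->
  moore_box (Fmap F t) (dFmap F t) rho x r A.
Proof.
move=> rho0 tst Tt; split=> // w v w1 v1.
apply: test_in => //; first exact: residual_in.
apply: slope_in => //; rewrite [x + _]addrC addrK cnormZ gtr0_norm //.
by rewrite ler_piMr // ltW.
Qed.

(** The slope box contains 0 (take [v = 0]), so a passed test bounds the residual box alone, and
    then the slope box by a difference. Separate bounds make it possible to transfer a passed test
    to another radius, precision or parameter interval. *)
Lemma test_bounds rho : 0 <= rho -> test rho ->
  vbounded (rho * r) V /\ vbounded (2 * rho) J.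
Proof.
move=> rho0 tst; have Tt := lo_in T.
have J0 : in_vbox J 0.
  have := @slope_in (lo T) x 0 Tt; rewrite subrr !cnorm0 mulmx0.
  by apply; rewrite ?ler01 ?ltW.
have r'0 : 0 < r^-1 by rewrite invr_gt0.
have Vb : forall v, in_vbox V v -> cnorm (cscale r^-1 v) <= rho.
  by move=> v Vv; have := test_in rho0 tst Vv J0; rewrite addr0 cnormN.
have r0' := ltW r0; split; apply/vboundedP; rewrite ?mulr_ge0 //.
  by move=> v /Vb; rewrite cnormZ gtr0_norm // ler_pdivrMl // mulrC.
move=> j Jj; have Vv := residual_in Tt.
have := ler_cnormD j (cscale r^-1 (A *m Fmap F (lo T) x)).
have := test_in rho0 tst Vv Jj; rewrite [- _ + j]addrC; have := Vb _ Vv; lra.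
Qed.

Lemma test_complete a b rho : 0 <= a <= 1 -> 0 <= b <= 1 -> a + b + u <= rho ->
  vbounded (a * r) V -> vbounded b J -> test rho.
Proof.
move=> a01 b01 abr Va Jb; have /andP[u0 _] := u01.
have [/andP[a0 _] /andP[b0 _]] := (a01, b01).
have abu : 0 <= a + b + u by lra.
apply: le_trans abr; apply/(boxnorm_leP _ abu).
exact: (moore_sum_bounded har).
Qed.

End TestSoundness.

(** * Continuation of zeros in Moore boxes *)

Section RealInduction.
Variables (R : realType) (a b : R) (P : R -> Prop).

(** This takes the place of the compactness of [[a, b]]. The supremum of the initial segments on
    which [P] holds satisfies [P] by the first condition and cannot be less than [b] by the
    second. *)
Lemma real_induction :
  (forall t, a <= t <= b -> (forall s, a <= s < t -> P s) -> P t) ->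
  (forall t, a <= t < b -> (forall s, a <= s <= t -> P s) ->
     exists2 d, 0 < d & forall s, t < s < t + d -> s <= b -> P s) ->
  forall t, a <= t <= b -> P t.
Proof.
move=> Pclosed Popen t0 /andP[at0 t0b].
have ab : a <= b by lra.
pose S := [set t | a <= t <= b /\ forall s, a <= s <= t -> P s].
have Pa : P a by apply: Pclosed => [|s /andP[h1 h2]]; [rewrite lexx | lra].
have Sa : S a.
  by split=> [|s /andP[h1 h2]]; rewrite ?lexx // (_ : s = a) //; apply/eqP; rewrite eq_le h1 h2.
have Sb : has_sup S by split; [exists a | exists b => t [/andP[]]].
set m := sup S.
have am : a <= m by apply: sup_upper_bound Sb _ Sa.
have mb : m <= b by apply: ge_sup; [exists a | move=> t [/andP[]]].
have Pm s : a <= s < m -> P s.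
  move=> /andP[as_ sm]; have e0 : 0 < m - s by lra.
  have [t [tab Pt] st] := sup_adherent e0 Sb.
  by apply: Pt; rewrite as_ -/m in st *; lra.
have Pmm s : a <= s <= m -> P s.
  move=> /andP[as_ sm]; have [lt|ge] := ltP s m; first by apply: Pm; rewrite as_.
  have -> : s = m by apply/eqP; rewrite eq_le sm ge.
  by apply: Pclosed => //; rewrite am mb.
suff bm : b <= m by apply: Pmm; rewrite at0 (le_trans t0b bm).
rewrite leNgt; apply/negP => ltmb.
have [|d d0 hd] := Popen m _ Pmm; first by rewrite am ltmb.
pose t := m + Num.min (d / 2) (b - m).
have [k1 k2] : Num.min (d / 2) (b - m) <= d / 2 /\ Num.min (d / 2) (b - m) <= b - m.
  by rewrite !ge_min !lexx orbT.
have k0 : 0 < Num.min (d / 2) (b - m) by rewrite lt_min; apply/andP; split; lra.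
have : S t.
  split=> [|s /andP[as_ st]]; first by rewrite /t; lra.
  have [lt|ge] := leP s m; first by apply: Pmm; rewrite as_.
  by apply: hd; rewrite /t in st; lra.
by move/(sup_upper_bound Sb); rewrite -/m /t; lra.
Qed.

End RealInduction.

Section MatrixBounds.
Variables (R : realType) (n : nat).
Implicit Types (W A D : 'M[R[i]]_n) (b : R).

Lemma cabs1 : cabs (1 : R[i]) = 1.
Proof. by rewrite -(rmorph1 (real_complex R)) cabs_real normr1. Qed.

Lemma cabs_det_bound b : exists2 C, 0 < C &
  forall W, (forall i j, cabs (W i j) <= b) -> cabs (\det W) <= C.
Proof.
pose B := Num.max 1 b; have B1 : 1 <= B by rewrite le_max lexx.
exists (1 + \sum_(s : 'S_n) \prod_(i < n) (2 * B)).
  by apply: ltr_wpDr => //; apply: sumr_ge0 => s _; apply: prodr_ge0 => i _; lra.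
move=> W Wb; rewrite -[cabs _]add0r; apply: lerD => //.
apply: le_trans (cabs_sum _ _) _; apply: ler_sum => s _.
have -> (z : R[i]) : cabs ((-1) ^+ s * z) = cabs z.
  by case: (odd_perm s); rewrite ?expr0 ?expr1 ?mul1r ?mulN1r ?cabsN.
elim/big_rec2: _ => [|i x y _ yx]; first by rewrite cabs1.
apply: le_trans (cabsM _ _) _; rewrite -mulrA ler_pM2l //.
apply: ler_pM; rewrite ?cabs_ge0 //; apply: le_trans (Wb _ _) _.
by rewrite le_max lexx orbT.
Qed.

Lemma entry_le_cnorm W b : 0 <= b ->
  (forall v, cnorm v <= 1 -> cnorm (W *m v) <= b) -> forall i j, cabs (W i j) <= b.
Proof.
move=> b0 Wb i j; have -> : W i j = (W *m (delta_mx j 0 : 'cV_n)) i 0.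
  by rewrite -colE mxE.
apply: le_trans (cabs_le_cnorm _ _) (Wb _ _); apply/cnorm_leP => // k.
by rewrite mxE; case: (_ && _); rewrite ?cabs1 ?cabs0.
Qed.

(** Since [A D] differs from the identity by a map of norm at most 7/8, the norm of [D^-1 v] is at
    most 8 times that of [A v]. *)
Lemma inverse_entry_bound b : exists2 C, 0 < C & forall A D,
  (forall v, cnorm ((1%:M - A *m D) *m v) <= 7 / 8 * cnorm v) ->
  (forall i j, cabs (A i j) <= b) -> forall i j, cabs (invmx D i j) <= C.
Proof.
exists (8 * (n%:R * 2 * Num.max 1 b) + 1) => [|A D cAD Ab].
  by apply: ltr_wpDl => //; rewrite !mulr_ge0 // le_max ler01.
have B0 : 0 <= n%:R * 2 * Num.max 1 b by rewrite !mulr_ge0 // le_max ler01.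
apply: entry_le_cnorm => [|v v1]; first lra.
have [|_ _ h] := cnorm_inverse v _ cAD; first lra.
have h' : cnorm (A *m v) <= n%:R * 2 * Num.max 1 b * cnorm v.
  by apply: cnorm_mulmx => i j; apply: le_trans (Ab i j) _; rewrite le_max lexx orbT.
have : n%:R * 2 * Num.max 1 b * cnorm v <= n%:R * 2 * Num.max 1 b by rewrite ler_piMr.
by lra.
Qed.

(** The entries of [D^-1] are bounded, hence so is its determinant, the inverse of [det D]. The
    bound depends on [A] only, so it is the same for all parameters at which a fixed box is a Moore
    box. *)
Lemma cabs_det_ge b : exists2 C, 0 < C & forall A D,
  (forall v, cnorm ((1%:M - A *m D) *m v) <= 7 / 8 * cnorm v) ->
  (forall i j, cabs (A i j) <= b) -> C <= cabs (\det D).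
Proof.
have [C1 C10 h1] := inverse_entry_bound b; have [C2 C20 h2] := cabs_det_bound C1.
exists (2 * C2)^-1 => [|A D cAD Ab]; first by rewrite invr_gt0 mulr_gt0.
have [|_ uD _] := cnorm_inverse 0 _ cAD; first lra.
have := cabsM (\det D) (\det (invmx D)); rewrite -det_mulmx mulmxV // det1 cabs1.
have := h2 _ (h1 _ _ cAD Ab); have := cabs_ge0 (\det D).
move=> d0 hd h; rewrite -[(_)^-1]mul1r ler_pdivrMr ?mulr_gt0 //.
apply: le_trans h _; rewrite mulrCA; apply: ler_wpM2l => //.
by rewrite ler_pM2l.
Qed.

End MatrixBounds.

Section Extension.
Variables (R : realType) (n : nat) (F : 'I_n -> mpoly n.+1 R[i]).
Variables (zeta : 'cV[R[i]]_n) (I : set R) (Z : R -> 'cV[R[i]]_n).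
Hypothesis hZ : continuation F zeta I Z.

Lemma continuation_near t e : I t -> 0 < e ->
  exists2 d, 0 < d & forall s, `|s - t| < d -> I s /\ cnorm (Z s - Z t) < e.
Proof.
move=> It e0; have [[openI _ _] contZ _ _ _] := hZ.
have /cvgrPdist_lt/(_ e e0) := contZ t It.
have /nbhs_ballP[d1 /= d10 h1] := open_nbhs_nbhs (conj openI It).
move=> /nbhs_ballP[d2 /= d20 h2].
exists (Num.min d1 d2) => [|s]; first by rewrite lt_min d10.
rewrite lt_min distrC => /andP[s1 s2]; have Is := h1 s s1; split=> //.
have := h2 s s2 Is; rewrite sub0r normrN ger0_norm ?cnorm_ge0 //.
Qed.

Lemma extension t0 t1 x r A : I t0 -> cnorm (Z t0 - x) <= r ->
  (forall t, t0 <= t <= t1 -> moore_box (Fmap F t) (dFmap F t) (7 / 8) x r A) ->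
  forall t, t0 <= t <= t1 -> I t /\ cnorm (Z t - x) <= r.
Proof.
move=> It0 Zt0 mA; have [_ _ _ zeroZ maxI] := hZ.
apply: real_induction => [t t01 Ps|t t01 Ps]; last first.
  have /andP[h1 h2] := t01; have tt1 : t0 <= t <= t1 by rewrite h1 ltW.
  have [It Ztx] : I t /\ cnorm (Z t - x) <= r by apply: Ps; rewrite h1 lexx.
  have [Ft _] := zeroZ t It; have [r0 _] := mA t tt1.
  have zc := zero_center Ft Ztx (mA t tt1).
  (* The zero lies within [7/8 r] of [x], so a move by less than [r / 8] keeps it in the ball. *)
  have e0 : 0 < r / 8 by lra.
  have [d d0 hd] := continuation_near It e0; exists d => // s /andP[s1 s2] _.
  have [|Is Zs] := hd s; first by rewrite ger0_norm; lra.
  by split=> //; have := cdistD (Z t) (Z s) x; lra.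
have /andP[h1 h2] := t01.
have [-> //|neq] := eqVneq t t0.
have lt0 : t0 < t by rewrite lt_neqAle eq_sym neq.
(* Points just before [t], where the induction hypothesis holds: they contradict both ways in which
   [I] could end at [t], and later give the bound at [t] by continuity. *)
have approach d : 0 < d -> exists s, [/\ `|s - t| < d, s < t, I s, cnorm (Z s - x) <= r &
    t0 <= s <= t1].
  move=> d0; pose m := Num.min (d / 2) (t - t0).
  have [k1 k2] : m <= d / 2 /\ m <= t - t0 by rewrite !ge_min !lexx orbT.
  have k0 : 0 < m by rewrite lt_min; apply/andP; split; lra.
  have [|Is Zs] := Ps (t - m); first by lra.
  by exists (t - m); split=> //; [rewrite ltr_norml; lra | lra | lra].
have It : I t.
  apply: contrapT => nIt.
  have clI : closure I t.
    move=> B /nbhs_ballP[d /= d0 hB]; have [s [sd _ Is _ _]] := approach d d0.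
    by exists s; split=> //; apply: hB; rewrite /ball /= distrC.
  have [cvg_oo|cvg_0] := maxI t clI nIt.
    have /cvgryPgt/(_ (cnorm x + r)) := cvg_oo.
    move=> /nbhs_ballP[d /= d0 hd]; have [s [sd _ Is Zs _]] := approach d d0.
    have : cnorm x + r < cnorm (Z s) by apply: hd => //; rewrite /ball /= distrC.
    by have := ler_cnormD (Z s) x; lra.
  have [b Ab] : exists b, forall ij : 'I_n * 'I_n, cabs (A ij.1 ij.2) <= b.
    apply: uniform_const => [ij b b' bb' hb|ij]; first exact: le_trans hb bb'.
    by exists (cabs (A ij.1 ij.2)).
  have [C C0 hC] := cabs_det_ge n b.
  have /cvgrPdist_lt/(_ C C0) := cvg_0.
  move=> /nbhs_ballP[d /= d0 hd]; have [s [sd _ Is Zs s01]] := approach d d0.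
  have : `|0 - cabs (\det (dFmap F s (Z s)))| < C.
    by apply: hd => //; rewrite /ball /= distrC.
  rewrite sub0r normrN ger0_norm ?cabs_ge0 // ltNge => /negP; apply.
  apply: (hC A) => [v|i j]; last exact: (Ab (i, j)).
  by apply: (moore_contracting (mA s s01)).
split=> //; apply/ler_addgt0Pr => e e0.
have [d d0 hd] := continuation_near It e0; have [s [sd _ Is Zs _]] := approach d d0.
have [_] := hd s sd; have := cdistD (Z s) (Z t) x; rewrite (cdistC (Z t) (Z s)); lra.
Qed.

End Extension.

(** * Uniform bounds along the continuation *)

Section Lipschitz.
Variables (R : realType) (n : nat) (F : 'I_n -> mpoly n.+1 R[i]).
Variables (dc : circuit R n.+1) (dout : 'I_n -> 'I_n -> node dc).
Hypothesis hdout : forall i j, node_poly (dout i j) = mderiv (lift ord0 j) (F i).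

Lemma subm_entry p q (A B : 'M[R[i]]_(p, q)) i j : (A - B) i j = A i j - B i j.
Proof. by rewrite !mxE. Qed.

(* The exact interval evaluation at two points gives the Lipschitz estimate. *)
Lemma dFmap_lipschitz M : exists2 C, 1 <= C & forall t x,
  `|t| <= M -> cnorm x <= M -> (forall i j, cabs (dFmap F t x i j) <= C) /\
  forall e t' x', 0 < e <= 1 -> `|t' - t| <= e -> cnorm (x' - x) <= e ->
  forall i j, cabs ((dFmap F t' x' - dFmap F t x) i j) <= C * e.
Proof.
pose M' := Num.max 1 M; have M1 : 1 <= M' by rewrite le_max lexx.
have MM' : M <= M' by rewrite le_max lexx orbT.
have reprT : representable_numbers ([set: R]) by [].
have hdT : repr_circuit [set: R] dc by move=> k _; case: nth.
have relP := near_itv_parametric reprT (@exact_arith_valid R).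
have [C h] : exists C, forall (ij : 'I_n * 'I_n) p T T' X X',
    0 < p.1 < 1 /\ 0 <= p.2 <= 1 -> near_itv setT p M' T T' ->
    relmx (near_itv setT) p M' X X' ->
    relc (near_itv setT) p C (eval_box (exact_arith R) p.1 T X (dout ij.1 ij.2))
      (eval_box (exact_arith R) p.1 T' X' (dout ij.1 ij.2)).
  apply: uniform_const => [ij C C' CC' h p T T' X X' vp rT rX|ij].
    exact: (relc_mono relP CC' (h _ _ _ _ _ vp rT rX)).
  exact: (relc_eval_box reprT relP).
exists (Num.max 1 (2 * C)) => [|t x tM xM]; first by rewrite le_max lexx.
(* The roundoff must lie strictly between 0 and 1; [e / 2] does and adds only [O(e)] to the error.
   The size bound comes from the comparison of a point with itself at [e = 1]. *)
have near e t' x' : 0 < e <= 1 -> `|t' - t| <= e -> cnorm (x' - x) <= e ->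
    forall i j, 1 <= C /\ relc (near_itv setT) (e / 2, e) C
      (cpt (dFmap F t' x' i j)) (cpt (dFmap F t x i j)).
  move=> /andP[e0 e1] tt' xx' i j.
  have ve : 0 < e / 2 < 1 /\ 0 <= e <= 1 by split; apply/andP; split; lra.
  have [ve1 ve2] := ve.
  have rT : near_itv setT (e / 2, e) M' (pt t') (pt t).
    apply: near_itv_ext => //; move: tM tt'; rewrite !ler_norml => /andP[? ?] /andP[? ?].
      by split=> /=; lra.
    by split=> /=; lra.
  have rX : relmx (near_itv setT) (e / 2, e) M' (mxpt x') (mxpt x).
    move=> k l; rewrite !ord1 !mxE.
    have := le_trans (cabs_le_cnorm x k) xM; have := le_trans (cabs_le_cnorm _ k) xx'.
    rewrite !mxE !cabs_le !ler_norml ReD ImD ReN ImN.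
    move: {h} (x k 0) (x' k 0) => [a1 a2] [b1 b2] /= /andP[/andP[? ?] /andP[? ?]] /andP[/andP[? ?] /andP[? ?]].
    by split; apply: near_itv_ext => //; split=> /=; lra.
  have := h (i, j) (e / 2, e) _ _ _ _ ve rT rX.
  by rewrite /= !eval_box_point !hdout !mxE => r; split=> //; case: r => [[]].
split=> [i j|e t' x' e01 tt' xx' i j].
  have e1 : 0 < (1 : R) <= 1 by rewrite ltr01 lexx.
  have := near 1 t x e1; rewrite !subrr normr0 cnorm0 => /(_ ler01 ler01 i j).
  move=> [C1 [[_ _ _ [/= ? ?] _] [_ _ _ [/= ? ?] _]]].
  apply: (@le_trans _ _ C); last by rewrite le_max; apply/orP; right; lra.
  by rewrite cabs_le !ler_norml; apply/andP; split; apply/andP; split.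
have [C1 [[_ _ _ _ [/= h1 h2]] [_ _ _ _ [/= h3 h4]]]] := near e t' x' e01 tt' xx' i j.
have e0 : 0 < e by case/andP: e01.
apply: (@le_trans _ _ (C * (e + e / 2))); last first.
  apply: (@le_trans _ _ (2 * C * e)); first by nra.
  by rewrite ler_pM2r // le_max lexx orbT.
move: h1 h2 h3 h4; rewrite subm_entry cabs_le !ler_norml ReD ImD ReN ImN.
move: (dFmap F t' x' i j) (dFmap F t x i j) => [a1 a2] [b1 b2] /= h1 h2 h3 h4.
by apply/andP; split; apply/andP; split; lra.
Qed.

End Lipschitz.

Section Tube.
Variables (R : realType) (n : nat).

Lemma ccompact_ball (t e : R) (z : 'cV[R[i]]_n) :
  ccompact [set p : R * 'cV[R[i]]_n | `|p.1 - t| <= e /\ cnorm (p.2 - z) <= e].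
Proof.
have [e0|e0] := ltP e 0.
  rewrite /ccompact (_ : [set coords p | p in _] = set0); first exact: compact0.
  apply/seteqP; split=> // _ [p [/= pt _] _].
  by have := normr_ge0 (p.1 - t); lra.
pose box (c : 'I_n -> R) : set 'rV[R]_n := [set v | forall i, [set` `[c i - e, c i + e]] (v ord0 i)].
have cbox c : compact (box c).
  apply: (@rV_compact _ n (fun i => [set` `[c i - e, c i + e]])) => i.
  exact: segment_compact.
rewrite /ccompact (_ : [set coords p | p in _] =
  [set` `[t - e, t + e]] `*` (box (fun i => complex.Re (z i 0)) `*` box (fun i => complex.Im (z i 0)))).
  apply: compact_setX; first exact: segment_compact.
  by apply: compact_setX; exact: cbox.
apply/seteqP; split=> [_ [[s y] [/= st yz] <-]|[s [v w]] /= [st [vz wz]]].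
  move/(cnorm_leP _ e0): yz => yz.
  split=> /=; first by rewrite interval.in_itv /=; move: st; rewrite ler_norml => /andP[? ?]; lra.
  split=> i /=; rewrite interval.in_itv /= !mxE; have := yz i;
    rewrite !mxE cabs_le ReD ImD ReN ImN !ler_norml => /andP[/andP[? ?] /andP[? ?]]; lra.
exists (s, \col_i Complex (v 0 i) (w 0 i)) => /=; last first.
  rewrite /coords /=; congr (_, (_, _)); apply/rowP => i; by rewrite !mxE.
split; first by move: st; rewrite interval.in_itv /= ler_norml => /andP[? ?]; lra.
apply/(cnorm_leP _ e0) => i; have := vz i; have := wz i; rewrite /= !interval.in_itv /=.
rewrite !mxE cabs_le ReD ImD ReN ImN /= !ler_norml => /andP[? ?] /andP[? ?].
by apply/andP; split; lra.
Qed.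

End Tube.

Section Tame.
Variables (R : realType) (n : nat) (F : 'I_n -> mpoly n.+1 R[i]).
Variables (dc : circuit R n.+1) (dout : 'I_n -> 'I_n -> node dc).
Hypothesis hdout : forall i j, node_poly (dout i j) = mderiv (lift ord0 j) (F i).
Variables (repr : set R) (inv : R -> R -> 'cV[R[i]]_n -> 'M[R[i]]_n).
Hypothesis hinv : valid_inv repr (dFmap F) inv.
Variables (zeta : 'cV[R[i]]_n) (I : set R) (Z : R -> 'cV[R[i]]_n).
Hypothesis hZ : continuation F zeta I Z.
Implicit Types (t u d : R) (y : 'cV[R[i]]_n).

(** One number [d] serves as radius, as threshold for the roundoff and, inverted, as size bound. The
    property is then inherited by smaller [d], so that bounds on different parameter ranges can be
    merged by a minimum. *)
Definition tame (e0 d t : R) : Prop :=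
  [/\ cnorm (Z t) <= d^-1, forall i j, cabs (invmx (dFmap F t (Z t)) i j) <= d^-1 &
   forall u y, 0 < u < 1 -> u < d -> repr t -> repr_mx repr y -> cnorm (y - Z t) <= d ->
     (forall i j, cabs (inv u t y i j) <= d^-1) /\
     (forall i j, cabs ((1%:M - inv u t y *m dFmap F t y) i j) <= e0)].

Lemma tame_mono (e0 d d' t : R) : 0 < d' <= d -> tame e0 d t -> tame e0 d' t.
Proof.
move=> /andP[d'0 d'd] [h1 h2 h3]; have d0 : 0 < d by lra.
have dd : d^-1 <= d'^-1 by rewrite lef_pV2.
split=> [|i j|u y u01 ud' rt ry yZ]; [exact: le_trans h1 dd|exact: le_trans (h2 i j) dd|].
have [||k1 k2] := h3 u y u01 _ rt ry; [lra | lra |].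
by split=> // i j; exact: le_trans (k1 i j) dd.
Qed.

Lemma entries_mulmx (A B : 'M[R[i]]_n) a b : 0 <= a -> 0 <= b ->
  (forall i j, cabs (A i j) <= a) -> (forall i j, cabs (B i j) <= b) ->
  forall i j, cabs ((A *m B) i j) <= n%:R * 2 * a * (n%:R * 2 * b).
Proof.
move=> a0 b0 Aa Bb; have c0 : 0 <= n%:R * 2 * a by rewrite !mulr_ge0.
have d0 : 0 <= n%:R * 2 * b by rewrite !mulr_ge0.
apply: entry_le_cnorm => [|v v1]; first exact: mulr_ge0.
rewrite -mulmxA; apply: le_trans (cnorm_mulmx _ Aa) _; apply: ler_wpM2l => //.
apply: le_trans (cnorm_mulmx _ Bb) _.
by rewrite ler_piMr.
Qed.

(** The fixed matrix [V0], the inverse at [t0], is an approximate inverse on a whole ball around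
    [(t0, Z t0)]. The differential is therefore invertible with bounded inverse on this compact set,
    where the accuracy of [inv] is uniform. *)
Lemma tame_near (e0 t0 : R) : 0 < e0 <= 1 -> I t0 ->
  exists2 d, 0 < d & forall t, `|t - t0| < d -> I t /\ tame e0 d t.
Proof.
move=> /andP[e00 e01] It0; have [_ _ _ zeroZ _] := hZ; have [_ uD0] := zeroZ t0 It0.
set D0 := dFmap F t0 (Z t0) in uD0; set V0 := invmx D0.
pose M := `|t0| + cnorm (Z t0) + 2.
have [C C1 lipC] := dFmap_lipschitz hdout M.
have t00 := normr_ge0 t0; have Z00 := cnorm_ge0 (Z t0).
have [b b0 V0b] : exists2 b, 0 <= b & forall i j, cabs (V0 i j) <= b.
  have [b hb] : exists b, forall ij : 'I_n * 'I_n, cabs (V0 ij.1 ij.2) <= b.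
    apply: uniform_const => [ij b b' bb' hb|ij]; first exact: le_trans hb bb'.
    by exists (cabs (V0 ij.1 ij.2)).
  by exists `|b| => // i j; apply: le_trans (hb (i, j)) (ler_norm b).
(* Within distance [eta], the Lipschitz bound gives [1 - V0 dF] a norm at most [kappa * eta <= 1/2];
   it is weakened to 7/8, the factor for which [inverse_entry_bound] is stated. *)
pose kappa := n%:R * 2 * b * (n%:R * 2 * C).
have kappa0 : 0 <= kappa by rewrite !mulr_ge0 //; lra.
pose eta := (2 * kappa + 1)^-1.
have eta0 : 0 < eta by rewrite invr_gt0; lra.
have eta2 : eta / 2 <= eta by lra.
have eta1 : eta <= 1 by rewrite invf_le1; lra.
have keta : kappa * eta <= 1 / 2 by rewrite /eta ler_pdivrMr; lra.
have local t y : `|t - t0| <= eta -> cnorm (y - Z t0) <= eta ->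
    (forall v, cnorm ((1%:M - V0 *m dFmap F t y) *m v) <= 7 / 8 * cnorm v) /\
    (forall i j, cabs (dFmap F t y i j) <= C).
  move=> tt0 yZ; have tM : `|t| <= M.
    by have := ler_normD (t - t0) t0; rewrite subrK /M; lra.
  have yM : cnorm y <= M by have := ler_cnormD y (Z t0); rewrite /M; lra.
  split=> [v|]; last by have [] := lipC t y tM yM.
  have [||_ lip] := lipC t0 (Z t0); [by rewrite /M; lra | by rewrite /M; lra |].
  have eta01 : 0 < eta <= 1 by rewrite eta0.
  have hD := lip eta t y eta01 tt0 yZ.
  have -> : 1%:M - V0 *m dFmap F t y = V0 *m (D0 - dFmap F t y).
    by rewrite mulmxBr mulVmx.
  rewrite -mulmxA; apply: le_trans (cnorm_mulmx _ V0b) _.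
  have hv : cnorm ((D0 - dFmap F t y) *m v) <= n%:R * 2 * (C * eta) * cnorm v.
    by apply: cnorm_mulmx => i j; rewrite -opprB mxE cabsN; exact: hD.
  apply: (@le_trans _ _ (kappa * eta * cnorm v)).
    rewrite /kappa; have -> : n%:R * 2 * b * (n%:R * 2 * C) * eta * cnorm v =
      n%:R * 2 * b * (n%:R * 2 * (C * eta) * cnorm v) by ring.
    by apply: ler_wpM2l => //; rewrite !mulr_ge0.
  by apply: ler_wpM2r; rewrite ?cnorm_ge0 //; lra.
have [C2 C20 invb] := inverse_entry_bound n b.
have [B [B0 BZ BC BC']] : exists B : R,
    [/\ 0 < B, cnorm (Z t0) + 1 <= B, C2 + 1 <= B & C2 <= B].
  by exists (cnorm (Z t0) + C2 + 2); move: (cnorm (Z t0)) Z00 => z z0; split; lra.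
(* If the computed inverse [U] has entrywise error [eps], the defect [1 - U dF = -(U - dF^-1) dF]
   has entries at most [kappa2 * eps <= e0]. *)
pose kappa2 := n%:R * 2 * (n%:R * 2 * C).
have kappa20 : 0 <= kappa2 by rewrite !mulr_ge0 //; lra.
pose eps := e0 / (kappa2 + 1).
have eps0 : 0 < eps by apply: divr_gt0; lra.
have eps1 : eps <= 1 by rewrite /eps ler_pdivrMr; lra.
have keps : kappa2 * eps <= e0.
  rewrite /eps mulrCA ler_piMr //; first lra.
  by rewrite ler_pdivrMr; lra.
have C00 : 0 <= C by lra.
have lt1 : 7 / 8 < 1 :> R by lra.
have [rinv accinv] := hinv.
pose K := [set p : R * 'cV[R[i]]_n | `|p.1 - t0| <= eta /\ cnorm (p.2 - Z t0) <= eta].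
have unitK p : K p -> dFmap F p.1 p.2 \in unitmx.
  move=> [p1 p2]; have [h _] := local _ _ p1 p2.
  by have [] := cnorm_inverse 0 lt1 h.
have [d0 d00 hd0] := accinv K (@ccompact_ball _ _ t0 eta (Z t0)) unitK eps eps0.
have eta20 : 0 < eta / 2 by lra.
have [d1 d10 hd1] := continuation_near hZ It0 eta20.
pose d := Num.min (Num.min d0 d1) (Num.min (eta / 2) B^-1).
have [dd0 dd1 deta dB] : [/\ d <= d0, d <= d1, d <= eta / 2 & d <= B^-1].
  by split; rewrite !ge_min lexx ?orbT.
have dpos : 0 < d by rewrite !lt_min d00 d10 eta20 invr_gt0.
have Bd : B <= d^-1 by rewrite -[B]invrK lef_pV2 // posrE invr_gt0.
have deta' := le_trans deta eta2.
exists d => // t tt0.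
have [|It Zt] := hd1 t; first exact: lt_le_trans tt0 dd1.
have tt0' : `|t - t0| <= eta by rewrite ltW // (lt_le_trans tt0).
have Zt' : cnorm (Z t - Z t0) <= eta by apply: le_trans eta2; exact: ltW.
have [hZt _] := local t (Z t) tt0' Zt'.
split=> //; split.
- apply: le_trans (ler_cnormD (Z t) (Z t0)) _; apply: le_trans Bd.
  by apply: le_trans BZ; rewrite addrC lerD2l (le_trans Zt').
- by move=> i j; apply: le_trans Bd; apply: le_trans (invb _ _ hZt V0b i j) BC'.
move=> u y u01 ud rt ry yZ.
have yZ0 : cnorm (y - Z t0) <= eta.
  apply: le_trans (cdistD (Z t) y (Z t0)) _.
  by rewrite [leRHS]splitr lerD ?(le_trans yZ) // ltW.
have [hy hyC] := local t y tt0' yZ0.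
have ud0 := lt_le_trans ud dd0.
have Ky : K (t, y) by [].
have hu := hd0 u t y u01 ud0 Ky rt ry.
have hinvb := invb _ _ hy V0b.
split=> i j.
  have -> : inv u t y i j = (inv u t y - invmx (dFmap F t y)) i j + invmx (dFmap F t y) i j.
    by rewrite subm_entry subrK.
  apply: le_trans (cabsD _ _) _; apply: le_trans Bd; apply: le_trans BC.
  rewrite [leRHS]addrC; apply: lerD; first exact: le_trans (hu i j) eps1.
  exact: hinvb.
have [_ uD _] := cnorm_inverse 0 lt1 hy.
have -> : 1%:M - inv u t y *m dFmap F t y =
    - ((inv u t y - invmx (dFmap F t y)) *m dFmap F t y).
  by rewrite mulmxBl mulVmx // opprB.
rewrite mxE cabsN; apply: le_trans (entries_mulmx _ _ hu hyC i j) _; [exact: ltW|exact: C00|].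
apply: le_trans keps; rewrite /kappa2.
by have -> : n%:R * 2 * eps * (n%:R * 2 * C) = n%:R * 2 * (n%:R * 2 * C) * eps by ring.
Qed.

Lemma tame_uniform (e0 : R) : 0 < e0 <= 1 -> (forall t, 0 <= t <= 1 -> I t) ->
  exists2 d, 0 < d & forall t, 0 <= t <= 1 -> tame e0 d t.
Proof.
move=> e00 I01.
(* The property carried by the real induction is the existence of one [d] for all of [[0, t]]. *)
suff H : forall t, 0 <= t <= 1 ->
    exists2 d, 0 < d & forall s, 0 <= s <= t -> tame e0 d s.
  by apply: H; rewrite ler01 lexx.
have glue t d' s0 : 0 < d' -> (forall s, 0 <= s <= s0 -> tame e0 d' s) ->
    forall d, 0 < d -> (forall s, s0 < s <= t -> tame e0 d s) ->
    exists2 d, 0 < d & forall s, 0 <= s <= t -> tame e0 d s.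
  move=> d'0 h' d dd0 h; exists (Num.min d d') => [|s /andP[s1 s2]].
    by rewrite lt_min dd0.
  have [le|lt] := leP s s0.
    apply: tame_mono (h' s _); last by rewrite s1.
    by rewrite lt_min dd0 d'0 ge_min lexx orbT.
  apply: tame_mono (h s _); last by rewrite lt.
  by rewrite lt_min dd0 d'0 ge_min lexx.
apply: real_induction => [t t01 Ps|t t01 Ps].
  have [d d0 hd] := tame_near e00 (I01 t t01).
  have [lt|ge] := ltP (t - d / 2) 0.
    exists d => // s /andP[s1 s2].
    by have [|//] := hd s; rewrite ltr_norml; lra.
  have [|d' d'0 hd'] := Ps (t - d / 2); first lra.
  apply: (glue t d' _ d'0 hd' d d0) => s /andP[s1 s2].
  by have [|//] := hd s; rewrite ltr_norml; lra.
have /andP[t0 t1] := t01.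
have [|d d0 hd] := @tame_near e0 t e00; first by apply: I01; lra.
have [|d' d'0 hd'] := Ps t; first by rewrite t0 lexx.
exists d => // s /andP[s1 s2] _.
apply: (glue s d' _ d'0 hd' d d0) => s' /andP[s'1 s'2].
by have [|//] := hd s'; rewrite ltr_norml; lra.
Qed.

End Tame.

Section ExactBounds.
Variables (R : realType) (u : R).
Implicit Types (a b : R).

Lemma exact_csum_bounded a (s : seq (cbox R)) :
  (forall k, (k < size s)%N -> bounded_cbox a (nth (cpt 0) s k)) ->
  bounded_cbox ((size s)%:R * a) (csum (exact_arith R) u s).
Proof.
case: s => [|X s] /= sa; first by rewrite mul0r; split; split; rewrite /= ?oppr0.
have Xa : bounded_cbox a X by exact: (sa 0%N).
have {}sa k : (k < size s)%N -> bounded_cbox a (nth (cpt 0) s k) by exact: (sa k.+1).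
rewrite -add1n natrD mulrDl mul1r.
elim: s X {1 3}a Xa sa => [|Y s IH] X b Xb sa /=; first by rewrite mul0r addr0.
rewrite -add1n natrD mulrDl mul1r addrA; apply: IH => [|k ks]; last exact: (sa k.+1).
have [[? ?] [? ?]] := sa 0%N isT; have [[? ?] [? ?]] := Xb.
by split; split=> /=; lra.
Qed.

Lemma exact_mul_ball_bounded n (B : 'M[R[i]]_n) b : 0 <= b ->
  (forall i j, cabs (B i j) <= b) ->
  vbounded (n%:R * (2 * b)) (mxbox_mul (exact_arith R) u (mxpt B) (vball 0 1)).
Proof.
move=> b0 Bb i; rewrite mxE.
have := @exact_csum_bounded (2 * b) [seq cmul (exact_arith R) u (mxpt B i k) (vball 0 1 k 0) | k <- enum 'I_n].
rewrite size_map size_enum_ord; apply=> k kn.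
rewrite (nth_map (Ordinal kn)) ?size_enum_ord //; set l := nth _ _ _.
have := Bb i l; rewrite cabs_le !ler_norml => /andP[/andP[p1 p2] /andP[p3 p4]].
have unit_ball : bounded_cbox 1 (vball 0 1 l 0 : cbox R).
  by have := @vbounded_vball R n 0 1 ler01 l; rewrite cnorm0 add0r.
have mul_bounded (z : R) (J : itv R) : - b <= z <= b -> bounded_itv 1 J ->
    bounded_itv b (exact_mul (pt z) J).
  move=> /andP[z1 z2] [j1 j2]; apply: min4_max4_bounds => p q.
  rewrite /in_itv /mkset /= => /andP[zp pz] /andP[q1 q2].
  have -> : p = z by apply/eqP; rewrite eq_le zp pz.
  rewrite -ler_norml normrM -[b]mulr1; apply: ler_pM => //; rewrite ler_norml; lra.
rewrite mxE; case: unit_ball => u1 u2.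
have add_bounded (J K : itv R) : bounded_itv b J -> bounded_itv b K ->
    bounded_itv (2 * b) (exact_add J K).
  by move=> [h1 h2] [h3 h4]; split=> /=; lra.
have opp_bounded (J : itv R) : bounded_itv b J -> bounded_itv b (iopp J).
  by move=> [h1 h2]; split=> /=; lra.
by split; apply: add_bounded; try apply: opp_bounded; apply: mul_bounded => //; apply/andP.
Qed.

End ExactBounds.

Lemma linear_bound (R : realType) n (M : 'M[R[i]]_n) (b : R) :
  (forall v, cnorm v <= 1 -> cnorm (M *m v) <= b) ->
  forall v, cnorm (M *m v) <= b * cnorm v.
Proof.
move=> Mb v; have [/cnorm0_eq0 ->|v0] := lerP (cnorm v) 0.
  by rewrite mulmx0 cnorm0 mulr0.
have := Mb (cscale (cnorm v)^-1 v).
rewrite mulmx_cscale !cnormZ gtr0_norm ?invr_gt0 // mulVf ?gt_eqF // => /(_ (lexx _)).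
by rewrite ler_pdivrMl // mulrC.
Qed.

Section NearZero.
Variables (R : realType) (n : nat) (F : 'I_n -> mpoly n.+1 R[i]).
Variables (c dc : circuit R n.+1) (out : 'I_n -> node c) (dout : 'I_n -> 'I_n -> node dc).
Hypotheses (hout : forall i, node_poly (out i) = F i)
  (hdout : forall i j, node_poly (dout i j) = mderiv (lift ord0 j) (F i)).
Variables (repr : set R) (hrepr : representable_numbers repr).
Hypotheses (hc : repr_circuit repr c) (hdc : repr_circuit repr dc).
Variables (ar : arithmetic R) (har : valid_arithmetic repr ar).
Variables (inv : R -> R -> 'cV[R[i]]_n -> 'M[R[i]]_n).
Hypothesis hinv : valid_inv repr (dFmap F) inv.
Variable Z : R -> 'cV[R[i]]_n.

Local Notation test u T x r A := (testM ar u (evalF out ar u T) (evaldF dout ar u T) x r A).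

(* The product of a matrix with entries of size [slope_tol] and the unit ball has norm
   at most 1/128. *)
Definition slope_tol : R := (256 * n.+1%:R)^-1.

Lemma slope_tol_gt0 : 0 < slope_tol <= 1.
Proof.
have h : 1 <= n.+1%:R :> R by rewrite ler1n.
have h' : 0 < 256 * n.+1%:R :> R by lra.
by rewrite /slope_tol invr_gt0 h' invf_le1 //; lra.
Qed.

Lemma slope_tolE : n%:R * (2 * slope_tol) <= 1 / 128.
Proof.
rewrite /slope_tol; have h : n%:R <= n.+1%:R :> R by rewrite ler_nat.
have n0 : 0 < n.+1%:R :> R by rewrite ltr0n.
rewrite invfM; have e : (n.+1%:R^-1 : R) * n.+1%:R = 1 by rewrite mulVf ?gt_eqF.
have : 0 <= (n.+1%:R^-1 : R) by rewrite invr_ge0 ltW.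
move: (n.+1%:R) (n.+1%:R^-1) (n%:R) h n0 e => p q m h n0 e q0.
by have := ler_wpM2l q0 h; lra.
Qed.

Definition near_zero d cst u t s y : Prop :=
  [/\ 0 <= t <= 1, tame F repr inv Z slope_tol d t, repr t &
      [/\ 0 < u < 1, u <= cst, 0 < s <= cst, repr s & repr_mx repr y /\ cnorm (y - Z t) <= s]].

Lemma point_bound d t y : 0 < d -> 0 <= t <= 1 -> tame F repr inv Z slope_tol d t ->
  cnorm (y - Z t) <= 1 -> bounded_itv (d^-1 + 2) (pt t) /\ cnorm y <= d^-1 + 2.
Proof.
rewrite -invr_gt0 => d0 /andP[t0 t1] [Zd _ _] yZ.
split; first by split=> /=; lra.
by have := ler_cnormD y (Z t); lra.
Qed.

(** At the point [y] the exact slope matrix has entries at most [slope_tol], which contributes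
    1/128. The radius and the roundoff add [C * (s + u)], and [256 C cst <= 1] bounds this by
    another 1/128. *)
Lemma slope_small d : 0 < d -> exists2 cst, 0 < cst <= 1 & forall u t s y, near_zero d cst u t s y ->
  vbounded (1 / 64)
    (slope_box dout ar u (pt t) (vball y s) (inv u t y) (vball 0 1)).
Proof.
move=> d0; have dinv0 : 0 < d^-1 by rewrite invr_gt0.
have [C C1 hC] := slope_box_near dout hrepr hdc har (d^-1 + 2).
pose cst := Num.min (Num.min (1 / 2) (d / 2)) (256 * C)^-1.
have C2560 : 0 < 256 * C by lra.
have c0 : 0 < cst.
  by rewrite !lt_min invr_gt0 C2560 andbT; apply/andP; split; lra.
have [c1 cd cC] : [/\ cst <= 1 / 2, cst <= d / 2 & cst <= (256 * C)^-1].
  by split; rewrite /cst !ge_min lexx ?orbT.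
have Cc : C * cst <= 1 / 256.
  have : 256 * C * cst <= 1 by rewrite -ler_pdivlMl // mulr1.
  by lra.
exists cst => [|u t s y [t01 tm rt [u01 uc /andP[s0 sc] rs [ry yZ]]]].
  by apply/andP; split; lra.
have yZ1 : cnorm (y - Z t) <= 1 by lra.
have [bt by_] := point_bound d0 t01 tm yZ1.
have [ud yd] : u < d /\ cnorm (y - Z t) <= d by split; lra.
have [_ _ tm3] := tm; have [Ub Ue] := tm3 u y u01 ud rt ry yd.
have [rinv _] := hinv; have rU : repr_mx repr (inv u t y) by exact: rinv.
have s01 : 0 <= s <= 1 by apply/andP; split; lra.
have s0' := ltW s0.
have Xe : forall i, csubx s (vball y s i 0) (mxpt y i 0).
  by apply: csubx_vball_mxpt => //; rewrite subrr cnorm0 add0r.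
have Te := isub_refl (pt t) s0'.
have WM : vbounded (d^-1 + 2) (vball 0 1 : 'cV[cbox R]_n).
  by apply: vboundedW _ (vbounded_vball 0 ler01); rewrite cnorm0; clear -hout hdout hrepr hc hdc har hinv Z dinv0; lra.
have UM i j : cabs (inv u t y i j) <= d^-1 + 2 by have := Ub i j; lra.
have := hC u s (pt t) (pt t) (vball y s) (mxpt y) (inv u t y) (vball 0 1) u01 s01
  (repr_pt rt) (repr_vball hrepr ry rs) rU (@repr_vball01 _ _ hrepr n) bt
  (vbounded_mxpt by_) UM WM Te Xe.
rewrite (slope_box_point hdout) => sub.
have /andP[e0 _] := slope_tol_gt0.
have := vbounded_csubx sub (exact_mul_ball_bounded u (ltW e0) Ue) => h.
have su : C * (s + u) <= 1 / 128.
  apply: (@le_trans _ _ (C * (cst + cst))); last lra.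
  by apply: ler_wpM2l; clear -hout hdout hrepr hc hdc har hinv Z C1 sc uc; lra.
have tol := slope_tolE.
by apply: vboundedW _ h; clear -hout hdout hrepr hc hdc har hinv Z su tol; lra.
Qed.

Lemma slope_contracting u t s y :
  0 < u < 1 -> repr t -> repr s -> repr_mx repr y -> repr_mx repr (inv u t y) -> 0 < s ->
  vbounded (1 / 64) (slope_box dout ar u (pt t) (vball y s) (inv u t y) (vball 0 1)) ->
  contracting F (1 / 64) t y s (inv u t y).
Proof.
move=> u01 rt rs ry rU s0 Jb z v zy.
have b0 : 0 <= 1 / 64 :> R by lra.
apply: linear_bound => w w1; move/(vboundedP _ b0): Jb; apply.
apply: (slope_in hdout hrepr hdc har u01 (repr_pt rt) ry rs rU s0) => //.
exact: lo_in.
Qed.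

(** The tolerance 1/8 is shared out as 5/64 for the residual, 1/64 for the slope and 1/64 for the
    final addition. The residual is measured relative to [s], so its rounding error has to be
    [O(s)]: this is the purpose of [u <= cst * s], which the rule [u_prec = o(s)] supplies. *)
Lemma test_pass d : 0 < d -> exists2 cst, 0 < cst <= 1 & forall u t s y, near_zero d cst u t s y ->
  Fmap F t (Z t) = 0 -> u <= cst * s -> cnorm (y - Z t) <= s / 32 ->
  test u (pt t) y s (inv u t y) (1 / 8).
Proof.
have e12 : 0 <= (5 / 64 : R) <= 1 /\ 0 <= (1 / 64 : R) <= 1 by split; lra.
move=> d0; have [c1 /andP[c10 c11] hslope] := slope_small d0.
have dinv0 : 0 < d^-1 by rewrite invr_gt0.
have [C C1 hC] := newton_box_near out hrepr hc har (d^-1 + 2).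
have C640 : 0 < 64 * C by lra.
pose cst := Num.min (Num.min c1 (1 / 64)) (Num.min (d / 2) (64 * C)^-1).
have c0 : 0 < cst.
  by rewrite !lt_min invr_gt0 C640 c10; apply/andP; split; apply/andP; split; lra.
have [cc1 c64 cd cC] : [/\ cst <= c1, cst <= 1 / 64, cst <= d / 2 & cst <= (64 * C)^-1].
  by split; rewrite /cst !ge_min lexx ?orbT.
have Cc : C * cst <= 1 / 64.
  have : 64 * C * cst <= 1 by rewrite -ler_pdivlMl // mulr1.
  by lra.
exists cst => [|u t s y nz Fz us yZs]; first by apply/andP; split; lra.
have [t01 tm rt [u01 uc /andP[s0 sc] rs [ry yZ]]] := nz.
have [ud yd] : u < d /\ cnorm (y - Z t) <= d by split; lra.
have [_ _ tm3] := tm; have [Ub Ue] := tm3 u y u01 ud rt ry yd.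
have [rinv _] := hinv; have rU : repr_mx repr (inv u t y) by exact: rinv.
have Jb : vbounded (1 / 64) (slope_box dout ar u (pt t) (vball y s) (inv u t y) (vball 0 1)).
  apply: hslope; split=> //; split=> //; last by apply/andP; split; lra.
  by lra.
have cU := slope_contracting u01 rt rs ry rU s0 Jb.
have Zy : cnorm (Z t - y) <= s by rewrite cdistC.
have yy : cnorm (y - y) <= s by rewrite subrr cnorm0 ltW.
have := residual_le Fz Zy cU yy => hres.
have yZ1 : cnorm (y - Z t) <= 1 by lra.
have [bt by_] := point_bound d0 t01 tm yZ1.
have UM i j : cabs (inv u t y i j) <= d^-1 + 2 by have := Ub i j; lra.
have e01 : 0 <= (0 : R) <= 1 by rewrite lexx ler01.
have Te := isub_refl (pt t) (lexx 0).
have Xe i := csubx_refl (mxpt y i 0) (lexx 0).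
have := hC u 0 (pt t) (pt t) (mxpt y) (mxpt y) (inv u t y) u01 e01 (repr_pt rt)
  (repr_mxpt ry) rU bt (vbounded_mxpt by_) UM Te Xe.
rewrite (newton_box_point hout) add0r => sub.
have := vbounded_csubx sub (vbounded_mxpt (lexx _)) => Vb.
have Cu : C * u <= s / 64.
  apply: (@le_trans _ _ (C * (cst * s))); first by rewrite ler_pM2l //; lra.
  by rewrite mulrA; have := ler_wpM2r (ltW s0) Cc; lra.
have Vb' : vbounded (5 / 64 * s) (newton_box out ar u (pt t) (mxpt y) (inv u t y)).
  by apply: vboundedW _ Vb; clear -hout hdout hrepr hc hdc har hinv Z s0 Cu hres yZs; lra.
have e3 : 5 / 64 + 1 / 64 + u <= 1 / 8 by lra.
exact: (test_complete har u01 s0 e12.1 e12.2 e3 Vb' Jb).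
Qed.

(** The residual box does not depend on the radius: a bound [1/8 s] is [1/16] of the doubled radius.
    With 1/64 for the slope and 1/64 for rounding the sum stays below 1/8. *)
Lemma test_enlarge d : 0 < d -> exists2 cst, 0 < cst <= 1 & forall u t s y, near_zero d cst u t (2 * s) y ->
  repr s -> 0 < s -> test u (pt t) y s (inv u t y) (1 / 8) ->
  test u (pt t) y (2 * s) (inv u t y) (1 / 8).
Proof.
move=> d0; have [c1 /andP[c10 c11] hslope] := slope_small d0.
pose cst := Num.min c1 (Num.min (d / 2) (1 / 64)).
have c0 : 0 < cst by rewrite !lt_min c10; apply/andP; split=> //; apply/andP; split; lra.
have [cc1 cd c64] : [/\ cst <= c1, cst <= d / 2 & cst <= 1 / 64].
  by split; rewrite /cst !ge_min lexx ?orbT.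
exists cst => [|u t s y nz rs s0 tst]; first by apply/andP; split; lra.
have [t01 tm rt [u01 uc /andP[s20 sc] rs2 [ry yZ]]] := nz.
have [rinv _] := hinv; have rU : repr_mx repr (inv u t y) by exact: rinv.
have Jb : vbounded (1 / 64) (slope_box dout ar u (pt t) (vball y (2 * s)) (inv u t y) (vball 0 1)).
  apply: hslope; split=> //; split=> //; last by apply/andP; split; lra.
  by lra.
have b0 : 0 <= 1 / 8 :> R by lra.
have [Vb _] := test_bounds hout hdout hrepr hc hdc har u01 (repr_pt rt) ry rs rU s0 b0 tst.
have Vb' : vbounded (1 / 16 * (2 * s)) (newton_box out ar u (pt t) (mxpt y) (inv u t y)).
  by have -> : 1 / 16 * (2 * s) = 1 / 8 * s by lra.
apply: (test_complete har u01 s20 _ _ _ Vb' Jb); lra.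
Qed.

End NearZero.

(** * The algorithm refine *)

Section While.
Variables (S : Type) (P : S -> bool) (body : S -> S -> Prop).

Lemma while_invariant (Inv : S -> Prop) :
  (forall s s', Inv s -> P s -> body s s' -> Inv s') ->
  forall s s', while P body s s' -> Inv s -> Inv s' /\ ~~ P s'.
Proof.
move=> step s s'; elim=> [{}s nP Is|{}s s1 s2 Ps bs _ IH Is]; first by [].
exact/IH/(step _ _ Is Ps bs).
Qed.

Definition terminates s : Prop := exists s', while P body s s'.

Lemma terminates_step s :
  (P s -> exists2 s', body s s' & terminates s') -> terminates s.
Proof.
have [Ps /(_ isT)[s' bs [s2 w]]|nPs _] := boolP (P s).
  by exists s2; apply: while_step w.
by exists s; apply: while_done.
Qed.

End While.

Section Descent.
Variable R : realType.

(** A real measure that drops by a fixed amount bounds the number of steps by the Archimedean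
    property. States with a negative measure are left to the caller. *)
Lemma descent (S : Type) (mu : S -> R) (Q : S -> Prop) (d : R) : 0 < d ->
  (forall s, 0 <= mu s -> (forall s', 0 <= mu s' -> mu s' <= mu s - d -> Q s') -> Q s) ->
  forall s, 0 <= mu s -> Q s.
Proof.
move=> d0 step s mu0.
have [m hm] : exists m : nat, mu s < m%:R * d.
  exists (Num.bound (mu s / d)); rewrite -ltr_pdivrMr //.
  by apply: archi_boundP; rewrite divr_ge0 // ltW.
elim: m s mu0 hm => [|m IH] s mu0 hm; first by move: hm; rewrite mul0r; lra.
apply: step => // s' mu0' hs'; apply: IH => //.
by move: hm; rewrite -natr1 mulrDl; lra.
Qed.

End Descent.

Section Boxes.
Variables (R : realType) (n : nat) (repr : set R) (ar : arithmetic R).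
Hypotheses (hrepr : representable_numbers repr) (har : valid_arithmetic repr ar).

Lemma mxbox_sub_in u (X Y : 'cV[cbox R]_n) a b : 0 < u < 1 ->
  in_vbox X a -> in_vbox Y b -> in_vbox (mxbox_sub ar u X Y) (a - b).
Proof.
move=> u01 Xa Yb i; have [_ hadd _ _ _] := har u01.
have [x1 x2] := Xa i; have [/andP[y1 y2] /andP[y3 y4]] := Yb i.
rewrite !mxE; split; rewrite ?ReD ?ImD ?ReN ?ImN; apply: hadd => //;
by rewrite /in_itv /mkset /= !lerN2; apply/andP.
Qed.

Lemma mxbox_sub_repr u (X Y : 'cV[cbox R]_n) : 0 < u < 1 ->
  repr_vbox repr X -> repr_vbox repr Y -> repr_vbox repr (mxbox_sub ar u X Y).
Proof.
move=> u01 rX rY i; have [hr _ _ _ _] := har u01.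
have [x1 x2] := rX i; have [y1 y2] := rY i.
by rewrite mxE; split; [have [] := hr _ _ x1 (repr_iopp hrepr y1) |
  have [] := hr _ _ x2 (repr_iopp hrepr y2)].
Qed.

Lemma mxbox_sub_near u M e (X : 'cV[cbox R]_n) a b : 0 < u < 1 -> 1 <= M ->
  0 <= e <= 1 -> cnorm a <= M -> cnorm b + 1 <= M ->
  (forall i, csubx e (X i 0) (mxpt b i 0)) ->
  forall i, csubx (e + M * u) (mxbox_sub ar u (mxpt a) X i 0) (mxpt (a - b) i 0).
Proof.
move=> u01 M1 /andP[e0 e1] aM bM sub i; have [_ _ hacc _ _] := har u01.
have := sub i; have := le_trans (cabs_le_cnorm a i) aM.
have bM' : cnorm b <= M - 1 by lra.
have := le_trans (cabs_le_cnorm b i) bM'.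
rewrite !mxE !cabs_le !ler_norml => /andP[/andP[b1 b2] /andP[b3 b4]].
move=> /andP[/andP[a1 a2] /andP[a3 a4]] [[/= s1 s2] [/= s3 s4]].
have acc (p q : R) (J : itv R) : - M <= p <= M -> - (M - 1) <= q <= M - 1 ->
    q - e <= lo J -> hi J <= q + e ->
    isub (e + M * u) (iadd ar u (pt p) (iopp J)) (pt (p - q)).
  move=> /andP[p1 p2] /andP[q1 q2] J1 J2; have lh := lo_le_hi J.
  have [||h1 h2] := hacc M (pt p) (iopp J) M1; [by split | by split=> /=; lra |].
  by split=> /=; move: h1 h2 => /=; lra.
by split; rewrite /= ?ReD ?ImD ?ReN ?ImN; apply: acc => //; apply/andP.
Qed.

Lemma csubx_mxpt_dist e (X : 'cV[cbox R]_n) p z : 0 <= e ->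
  (forall i, csubx e (X i 0) (mxpt p i 0)) -> in_vbox X z -> cnorm (z - p) <= e.
Proof.
move=> e0 sub Xz; apply/cnorm_leP => // i.
have := sub i; have [/andP[z1 z2] /andP[z3 z4]] := Xz i.
rewrite !mxE cabs_le !ler_norml ReD ImD ReN ImN => -[[/= s1 s2] [/= s3 s4]].
by apply/andP; split; lra.
Qed.

End Boxes.

Section Refinement.
Variables (R : realType) (n : nat) (F : 'I_n -> mpoly n.+1 R[i]).
Variables (c dc : circuit R n.+1) (out : 'I_n -> node c) (dout : 'I_n -> 'I_n -> node dc).
Hypotheses (hout : forall i, node_poly (out i) = F i)
  (hdout : forall i j, node_poly (dout i j) = mderiv (lift ord0 j) (F i)).
Variables (repr : set R) (hrepr : representable_numbers repr).
Hypotheses (hc : repr_circuit repr c) (hdc : repr_circuit repr dc).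
Variables (im : implementation R n) (him : valid_implementation repr (dFmap F) im).

Local Notation ar := (impl_arith im).
Local Notation prec := (impl_prec im).
Local Notation omega := (impl_omega im).
Local Notation inv := (impl_inv im).

Lemma impl_arithP : valid_arithmetic repr ar. Proof. by case: him. Qed.

Lemma impl_invP : valid_inv repr (dFmap F) inv. Proof. by case: him. Qed.

Lemma prec01 k : 0 < prec k < 1.
Proof. by case: him => _ [h _ _] _ _ _. Qed.

Lemma prec_le k k' : (k <= k')%N -> prec k' <= prec k.
Proof.
case: him => _ [_ h _] _ _ _; elim: k' => [|k' IH]; first by rewrite leqn0 => /eqP ->.
rewrite leq_eqVlt => /predU1P[->//|]; rewrite ltnS => /IH; exact/le_trans/h.
Qed.

Lemma prec_small b : 0 < b -> exists K, forall k, (K <= k)%N -> prec k < b.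
Proof.
case: him => _ [p01 _ /cvgrPdist_lt h] _ _ _ /h[K _ hK]; exists K => k Kk.
have := hK k Kk; rewrite sub0r normrN ger0_norm //.
by have /andP[/ltW] := p01 k.
Qed.

Lemma lower_prec_exists b k : 0 < b -> exists k', lower_prec im b k k'.
Proof.
move=> /prec_small[K hK].
pose P k' := (k <= k')%N && (prec k' <= b).
have exP : exists k', P k'.
  by exists (maxn k K); rewrite /P leq_maxl /= ltW // hK // leq_maxr.
have [k' /andP[kk' pk'] kmin] := ex_minnP exP; exists k'; split=> // j /andP[kj jk'].
rewrite ltNge; apply: contraL jk' => pj; rewrite -leqNgt; apply: kmin.
by rewrite /P kj.
Qed.

Lemma omega_small b : 0 < b -> exists2 d, 0 < d & forall s, 0 < s < d -> omega s <= b * s.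
Proof.
case: him => _ _ [hom /cvgrPdist_lt h] _ _ /h /nbhs_ballP[d /= d0 hd].
exists d => // s /andP[s0 sd]; have := hd s.
rewrite /ball /= sub0r normrN gtr0_norm // => /(_ sd s0).
rewrite sub0r normrN ger0_norm; last first.
  by rewrite divr_ge0 ?ltW //; have /andP[] := hom s s0.
by rewrite ltr_pdivrMr // => /ltW.
Qed.

Section Point.
Variables (t r : R) (x : 'cV[R[i]]_n) (A : 'M[R[i]]_n) (Z : R -> 'cV[R[i]]_n).
Hypotheses (rt : repr t) (rx : repr_mx repr x) (rr : repr r) (rA : repr_mx repr A).
Hypothesis hbox : moore_box (Fmap F t) (dFmap F t) (7 / 8) x r A.
Hypotheses (Ft0 : Fmap F t (Z t) = 0) (Zx : cnorm (Z t - x) <= r).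

Local Notation delta k y := (newton_box out ar (prec k) (pt t) (mxpt y) A).
Local Notation newton k y := (mxbox_sub ar (prec k) (mxpt y) (delta k y)).
Local Notation body := (refine_body im out t r A 8^-1).
Local Notation loop := (fun S : bstate R n =>
  let: (k, y, s, U) := S in ~~ testMF im out dout k (pt t) y s U 8^-1).
Local Notation grow := (fun S : bstate R n =>
  let: (k, y, s, U) := S in
  (2 * s <= 1) && testMF im out dout k (pt t) y (2 * s) U 8^-1).

(** The point stays in the initial box, where [A] contracts, and [s] bounds its distance to the
    zero. [U] is only required to be representable, since correctness of the output comes from the
    test. *)
Definition refine_inv (S : bstate R n) : Prop :=
  let: (k, y, s, U) := S in
  [/\ repr_mx repr y, repr s, repr_mx repr U, 0 < s <= r &
      cnorm (y - x) <= r /\ cnorm (y - Z t) <= s].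

Lemma r_gt0 : 0 < r. Proof. by case: hbox. Qed.

Lemma delta_in k y : repr_mx repr y -> in_vbox (delta k y) (A *m Fmap F t y).
Proof.
move=> ry; apply: (residual_in hout hrepr hc impl_arithP (prec01 k) (repr_pt rt) ry rA).
exact: lo_in.
Qed.

Lemma delta_repr k y : repr_mx repr y -> repr_vbox repr (delta k y).
Proof.
move=> ry i; have [C h] := relmx_newton out hrepr hc (enclosed_parametric hrepr impl_arithP id) 0.
have rX : relmx (enclosed repr) (prec k) 0 (mxpt y) (mxpt y) by exact: enclosed_mxpt.
have rT : enclosed repr (prec k) 0 (pt t) (pt t).
  by split; [exact: repr_pt | split; rewrite ?subr0 ?addr0].
by have [[? _] [? _]] := h _ _ _ _ _ _ (prec01 k) rT rX (enclosed_mxpt _ _ rA) i 0.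
Qed.

(** The algorithm measures the width of [y - delta], not of [delta]. The identity
    [w - A f(y) = (y - A f(y)) - (y - w)] passes from one to the other, both differences on the
    right being in the computed box. *)
Lemma delta_le k y : repr_mx repr y ->
  boxnorm (delta k y) <= cnorm (A *m Fmap F t y) + width (newton k y).
Proof.
move=> ry; have y_in : in_vbox (mxpt y) y by move=> i; rewrite mxE; split; exact: lo_in.
have sub w : in_vbox (delta k y) w -> in_vbox (newton k y) (y - w).
  exact: (mxbox_sub_in impl_arithP (prec01 k) y_in).
have b0 : 0 <= cnorm (A *m Fmap F t y) + width (newton k y).
  apply: addr_ge0; first exact: cnorm_ge0.
  have h := sub _ (delta_in k ry); apply: le_trans (cdist_le_width h h).
  exact: cnorm_ge0.
apply/(boxnorm_leP _ b0)/(vboundedP _ b0) => w dw; rewrite addrC.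
apply: le_trans (ler_cnormD w (A *m Fmap F t y)) _; rewrite lerD2r.
have -> : w - A *m Fmap F t y = (y - A *m Fmap F t y) - (y - w).
  by rewrite opprB [_ + (w - y)]addrC addrA subrK.
by apply: cdist_le_width; apply: sub => //; exact: delta_in.
Qed.

Lemma residual_bounds y : cnorm (y - x) <= r ->
  1 / 8 * cnorm (y - Z t) <= cnorm (A *m Fmap F t y) <= 15 / 8 * cnorm (y - Z t).
Proof.
move=> yx; have cA := moore_contracting hbox.
have := le_residual Ft0 Zx cA yx; have := residual_le Ft0 Zx cA yx.
by move=> h1 h2; apply/andP; split; lra.
Qed.

(** Let [a], [b] and [e] be the norms of [A f(y)], of [delta] and of [y - Z t]. From [b <= a + b/40]
    and [a <= 15/8 e] follow [b <= 25/13 e] and a width at most [5/104 e]. The choice of the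
    midpoint thus worsens the factor 7/8 to [7/8 + 5/104 = 12/13]. The same computation with [r] for
    [e] keeps the new point in the box. *)
Lemma newton_step k y : repr_mx repr y -> cnorm (y - x) <= r ->
  width (newton k y) <= 40^-1 * boxnorm (delta k y) ->
  [/\ repr_mx repr (impl_mid im (newton k y)),
      cnorm (impl_mid im (newton k y) - x) <= r,
      cnorm (impl_mid im (newton k y) - Z t) <= 12 / 13 * cnorm (y - Z t) &
      boxnorm (delta k y) <= 25 / 13 * cnorm (y - Z t)].
Proof.
move=> ry yx hw; have [_ _ _ hmid _] := him; have r0 := r_gt0.
have [ry' y'_in] := hmid _ (mxbox_sub_repr hrepr impl_arithP (prec01 k) (repr_mxpt ry) (delta_repr k ry)).
have y_in : in_vbox (mxpt y) y by move=> i; rewrite mxE; split; exact: lo_in.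
have Ny_in := mxbox_sub_in impl_arithP (prec01 k) y_in (delta_in k ry).
have dist := cdist_le_width y'_in Ny_in.
have dle := delta_le k ry.
have /andP[_ res_le] := residual_bounds yx.
have N1 := newton_zero Ft0 Zx (moore_contracting hbox) yx.
have N2 := newton_center hbox yx.
set a := cnorm (A *m Fmap F t y) in dle res_le.
have al : a <= 15 / 8 * r.
  have := ler_cnormD (- (A *m Fmap F t y)) (- (y - x)).
  have -> : - (A *m Fmap F t y) - - (y - x) = y - A *m Fmap F t y - x.
    by rewrite opprK addrC addrAC.
  by rewrite !cnormN -/a; lra.
have t1 := cdistD (y - A *m Fmap F t y) (impl_mid im (newton k y)) x.
have t2 := cdistD (y - A *m Fmap F t y) (impl_mid im (newton k y)) (Z t).
by split=> //; lra.
Qed.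

(** The residual is at least 1/8 of the distance, so a norm below [s / 512] means a distance at most
    [s / 64]. This is 1/32 of the halved radius, as [test_pass] requires. *)
Lemma halving_step k y s : repr_mx repr y -> cnorm (y - x) <= r ->
  boxnorm (delta k y) <= 64^-1 * 8^-1 * s -> cnorm (y - Z t) <= s / 64.
Proof.
move=> ry yx hs; have := cnorm_le_boxnorm (delta_in k ry).
by have /andP[h _] := residual_bounds yx; lra.
Qed.

Lemma width_small : exists2 C, 0 < C & forall k y, repr_mx repr y -> cnorm (y - x) <= r ->
  C * prec k <= 1 -> width (newton k y) <= C * prec k.
Proof.
have [B hB] : exists B, forall ij : 'I_n * 'I_n, cabs (A ij.1 ij.2) <= B.
  apply: uniform_const => [ij b b' bb' h|ij]; first exact: le_trans h bb'.
  by exists (cabs (A ij.1 ij.2)).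
have x0 := cnorm_ge0 x; have t0 := normr_ge0 t; have r0 := r_gt0.
(* The part [4 * r + 1] makes room for the norm of [A f(y)] plus 1, as that norm is at most
   [15/8 * 2r]. *)
pose M := `|B| + `|t| + cnorm x + 4 * r + 1.
have BM : B <= M by have := ler_norm B; rewrite /M; lra.
have [C C1 hC] := newton_box_near out hrepr hc impl_arithP M.
have B0 := normr_ge0 B.
exists (2 * (C + M)) => [|k y ry yx small]; first by rewrite /M; lra.
have /andP[u0 u1] := prec01 k.
have yM : cnorm y <= M by have := ler_cnormD y x; rewrite /M; lra.
have e01 : 0 <= (0 : R) <= 1 by rewrite lexx ler01.
have Te := isub_refl (pt t) (lexx 0).
have Xe i := csubx_refl (mxpt y i 0) (lexx 0).
have bT : bounded_itv M (pt t).
  have := ler_norm t; have := ler_norm (- t); rewrite normrN => h1 h2.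
  by split=> /=; rewrite /M; lra.
have AM i j : cabs (A i j) <= M by apply: le_trans (hB (i, j)) BM.
have := hC _ 0 (pt t) (pt t) _ _ A (prec01 k) e01 (repr_pt rt) (repr_mxpt ry) rA bT
  (vbounded_mxpt yM) AM Te Xe.
rewrite (newton_box_point hout) add0r => sub.
have Cu0 : 0 <= C * prec k by rewrite mulr_ge0 //; lra.
have Mu0 : 0 <= M * prec k by rewrite mulr_ge0 // /M; lra.
have Cu1 : 0 <= C * prec k <= 1 by apply/andP; split; lra.
have resM : cnorm (A *m Fmap F t y) + 1 <= M.
  have /andP[_ h] := residual_bounds yx.
  have := cdistD x y (Z t); rewrite (cdistC x) => h'; have Zx' := Zx.
  by rewrite /M; lra.
have M1 : 1 <= M by rewrite /M; lra.
have nsub := mxbox_sub_near impl_arithP (prec01 k) M1 Cu1 yM resM sub.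
have e0 : 0 <= C * prec k + M * prec k by lra.
apply: width_le => [|p q pn qn]; first lra.
have := csubx_mxpt_dist e0 nsub pn; have := csubx_mxpt_dist e0 nsub qn.
have := cdistD (y - A *m Fmap F t y) p q; rewrite (cdistC (y - A *m Fmap F t y) q); lra.
Qed.

Lemma refine_body_inv S S' : refine_inv S -> body S S' ->
  refine_inv S' /\ (S.1.1.1 <= S'.1.1.1)%N.
Proof.
move: S S' => [[[k y] s] U] [[[k' y'] s'] U'] [ry rs rU /andP[s0 sr] [yx yZ]] [hif ->].
have [rinv _] := impl_invP.
suff [ry' rs' s0r' yx' [yZ' kk']] : [/\ repr_mx repr y', repr s', 0 < s' <= r,
    cnorm (y' - x) <= r & cnorm (y' - Z t) <= s' /\ (k <= k')%N].
  by split=> //; split=> //; apply: rinv (prec01 k') rt ry'.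
move: hif; case: ifP => [small [-> -> hk]|_].
  have h := halving_step ry yx small.
  split=> //; [exact: repr_half | by apply/andP; split; lra | split; first lra].
  by move: hk; case: ifP => [_ []|_ ->].
case: ifP => [_ [-> -> ->]|/negbT]; first by split=> //; rewrite s0.
rewrite -leNgt => hw [-> -> ->]; have [ry' yx' yZ' _] := newton_step ry yx hw.
split=> //; first by rewrite s0.
by split=> //; have := cnorm_ge0 (y - Z t); lra.
Qed.

(** The final alternative records whether the first loop ran. If not, the radius never fell below
    [r]; otherwise [U] is a computed inverse at [y], and enlarging stopped because one more doubling
    is refused. This is what bounds the output radius from below. *)
Lemma refine_spec k S : refine im out dout t r A 8^-1 k x S ->
  let: (k1, y, s, U) := S in
  [/\ (k <= k1)%N, [/\ repr_mx repr y, repr s & repr_mx repr U], 0 < s <= Num.max r 1,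
      cnorm (y - Z t) <= s & testMF im out dout k1 (pt t) y s U 8^-1] /\
  (r <= s \/ U = inv (prec k1) t y /\
     ~~ ((2 * s <= 1) && testMF im out dout k1 (pt t) y (2 * s) U 8^-1)).
Proof.
have r0 := r_gt0; move: S => [[[k2 y2] s2] U2] [[[[k1 y1] s1] U1] [w1 w2]].
pose inv1 (S : bstate R n) := [/\ refine_inv S, (k <= S.1.1.1)%N &
  r <= S.1.2 \/ S.2 = inv (prec S.1.1.1) t S.1.1.2].
have step1 S S' : inv1 S -> loop S -> body S S' -> inv1 S'.
  move=> [i1 kk _] _ bS; have [i1' kk'] := refine_body_inv i1 bS.
  split=> //; first exact: leq_trans kk kk'.
  by move: S S' bS {i1 kk i1' kk'} => [[[? ?] ?] ?] [[[? ?] ?] ?] [_ ->]; right.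
have start1 : inv1 (k, x, r, A).
  split=> //; last by left.
  split=> //; first by rewrite lexx r0.
  by rewrite subrr cnorm0 (cdistC x) ltW.
have [[[ry rs rU /andP[s0 sr] [_ yZ]] /= kk1 alt] /negPn tst] :=
  while_invariant step1 w1 start1.
pose inv3 (S : bstate R n) := [/\ (k1, y1, U1) = (S.1.1.1, S.1.1.2, S.2), repr S.1.2,
   s1 <= S.1.2 <= Num.max r 1 & testMF im out dout k1 (pt t) y1 S.1.2 U1 8^-1].
have step3 S S' : inv3 S -> grow S -> @enlarge_body R n S S' -> inv3 S'.
  move: S S' => [[[? ?] s] ?] [[[? ?] s'] ?] [/= [<- <- <-] rs' /andP[h1 h2] _].
  move=> /andP[s21 tst'] [-> -> -> ->]; split=> //=; first exact: repr_double.
  by apply/andP; split; first lra; rewrite le_max s21 orbT.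
have start3 : inv3 (k1, y1, s1, U1).
  by split=> //=; rewrite lexx le_max sr.
have [[/= [<- <- <-] rs2 /andP[s12 s2m] tst2] ngrow] := while_invariant step3 w2 start3.
split; first by split=> //; [rewrite s2m andbT; lra | lra].
case: alt => [rs1|U1E]; first by left; lra.
by right; split; [exact: U1E | exact: ngrow].
Qed.

Lemma loop_step k y s U : refine_inv (k, y, s, U) ->
  (forall k', cnorm (y - Z t) <= s / 64 -> (k <= k')%N ->
     (s / 2 < 16^-1 * 8^-1 * r -> prec k' <= omega (s / 2)) ->
     terminates loop body (k', y, s / 2, inv (prec k') t y)) ->
  (64^-1 * 8^-1 * s < boxnorm (delta k y) ->
     40^-1 * boxnorm (delta k y) < width (newton k y) ->
     terminates loop body (k.+1, y, s, inv (prec k.+1) t y)) ->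
  (64^-1 * 8^-1 * s < boxnorm (delta k y) ->
     width (newton k y) <= 40^-1 * boxnorm (delta k y) ->
     terminates loop body
       (k, impl_mid im (newton k y), s, inv (prec k) t (impl_mid im (newton k y)))) ->
  terminates loop body (k, y, s, U).
Proof.
move=> [ry _ _ /andP[s0 _] [yx _]] halve refine_prec newt; apply: terminates_step => _.
have [small|big] := leP (boxnorm (delta k y)) (64^-1 * 8^-1 * s).
  have h := halving_step ry yx small.
  have [lt|ge] := boolP (s / 2 < 16^-1 * 8^-1 * r).
    have o0 : 0 < omega (s / 2).
      have [_ _ [hom _] _ _] := him; have s20 : 0 < s / 2 by lra.
      by have /andP[] := hom _ s20.
    have [k' lk'] := lower_prec_exists k o0.
    exists (k', y, s / 2, inv (prec k') t y).
      by split=> //; rewrite ifT //; split=> //; rewrite lt.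
    by case: lk' => kk' pk' _; apply: halve.
  exists (k, y, s / 2, inv (prec k) t y).
    by split=> //; rewrite ifT //; split=> //; rewrite (negbTE ge).
  by apply: halve => // lt; rewrite lt in ge.
have big' : (boxnorm (delta k y) <= 64^-1 * 8^-1 * s) = false by rewrite leNgt big.
have [le|lt] := leP (width (newton k y)) (40^-1 * boxnorm (delta k y)).
  exists (k, impl_mid im (newton k y), s, inv (prec k) t (impl_mid im (newton k y))).
    by split=> //; rewrite ifF // ifF // ltNge le.
  exact: newt.
exists (k.+1, y, s, inv (prec k.+1) t y); last exact: refine_prec.
by split=> //; rewrite ifF // ifT.
Qed.

(** Between two halvings the loop is finite: from index [K] on the width criterion holds, so the
    precision is raised finitely often, and at a given precision there are finitely many Newton
    steps. *)
Lemma loop_ends_same_radius s :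
  (forall k y U k', refine_inv (k, y, s, U) -> cnorm (y - Z t) <= s / 64 -> (k <= k')%N ->
    (s / 2 < 16^-1 * 8^-1 * r -> prec k' <= omega (s / 2)) ->
    terminates loop body (k', y, s / 2, inv (prec k') t y)) ->
  forall k y U, refine_inv (k, y, s, U) -> terminates loop body (k, y, s, U).
Proof.
move=> halve; have [s0|s0] := ltP 0 s; last first.
  by move=> k y U [_ _ _ /andP[]]; lra.
have [C C0 hw] := width_small.
(* No halving means that [delta] has norm above [s / 512]; a width at most [s / 512 / 80] is then
   below 1/40 of it. *)
pose b := Num.min 1 (s / 512 / 80).
have b0 : 0 < b by rewrite lt_min ltr01; lra.
have [b1 bs] : b <= 1 /\ b <= s / 512 / 80 by split; rewrite ge_min lexx ?orbT.
have bC : 0 < b / C by rewrite divr_gt0.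
have [K hK] := prec_small bC.
have narrow k y : (K <= k)%N -> repr_mx repr y -> cnorm (y - x) <= r ->
    64^-1 * 8^-1 * s < boxnorm (delta k y) ->
    width (newton k y) <= 40^-1 * boxnorm (delta k y).
  move=> Kk ry yx big.
  have Cp : C * prec k <= b by rewrite mulrC -ler_pdivlMr // ltW // hK.
  by have := hw k y ry yx; lra.
(* A Newton step gains 1/13 of the distance, and the distance exceeds [13/25] of [s / 512] because
   [delta] has norm at most 25/13 of it. *)
have c0 : 0 < s / 512 / 25 by lra.
(* The distance to the zero decreases by a fixed amount at each Newton step. *)
have ends_newton k : (forall y U, refine_inv (k, y, s, U) ->
      terminates loop body (k.+1, y, s, inv (prec k.+1) t y)) \/ (K <= k)%N ->
    forall y U, refine_inv (k, y, s, U) -> terminates loop body (k, y, s, U).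
  move=> hk; pose mu (yU : 'cV[R[i]]_n * 'M[R[i]]_n) := cnorm (yU.1 - Z t).
  suff H yU : refine_inv (k, yU.1, s, yU.2) -> terminates loop body (k, yU.1, s, yU.2).
    by move=> y U; apply: (H (y, U)).
  have : 0 <= mu yU by exact: cnorm_ge0.
  move: yU; apply: (descent c0) => -[y U] _ IH /= Iy.
  have [ry rs rU s0r [yx yZ]] := Iy.
  apply: loop_step => //.
  - by move=> k' h kk' hk'; apply: halve Iy h kk' hk'.
  - move=> big wide; case: hk => [hk|Kk]; first exact: hk Iy.
    by have := narrow k y Kk ry yx big; lra.
  move=> big le; have [ry' yx' yZ' hb] := newton_step ry yx le.
  have [rinv _] := impl_invP.
  set y' := impl_mid _ _ in ry' yx' yZ' *.
  have := IH (y', inv (prec k) t y'); rewrite /mu /=; apply.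
  - exact: cnorm_ge0.
  - by lra.
  split=> //; first exact: rinv (prec01 k) rt ry'.
  by split=> //; have := cnorm_ge0 (y - Z t); lra.
have [rinv _] := impl_invP.
suff H m : forall k, (K - k <= m)%N -> forall y U, refine_inv (k, y, s, U) ->
    terminates loop body (k, y, s, U) by move=> k; exact: (H (K - k)%N).
elim: m => [|m IH] k Km; apply: ends_newton.
  by right; rewrite -subn_eq0 -leqn0.
left=> y U [ry rs rU s0r yy]; apply: IH; first by move: Km; rewrite subnS; case: (K - k)%N.
by split=> //; exact: rinv (prec01 _) rt ry.
Qed.

Hypothesis t01 : 0 <= t <= 1.

Lemma refine_terminates d k : 0 < d -> tame F repr inv Z (slope_tol R n) d t ->
  exists S, refine im out dout t r A 8^-1 k x S.
Proof.
move=> d0 ht; have r0 := r_gt0.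
have [c1 /andP[c10 c11] pass] := test_pass hout hdout hrepr hc hdc impl_arithP impl_invP Z d0.
have [e e0 he] := omega_small c10.
have [rinv _] := impl_invP.
(* Below [s1] a halved radius passes the test: [r / 128] is the threshold [16^-1 * 8^-1 * r] that
   triggers the choice of precision, [e] makes [omega] at most [c1 s], and [c1] is the threshold of
   [test_pass]. A halving that stays above [s1] lowers [s] by at least [s1]. *)
pose s1 := Num.min (Num.min e (r / 128)) c1.
have [se sr sc] : [/\ s1 <= e, s1 <= r / 128 & s1 <= c1].
  by split; rewrite !ge_min lexx ?orbT.
have s10 : 0 < s1.
  by rewrite !lt_min e0 c10 andbT /=; lra.
have ends s : 0 <= s -> forall k y U, refine_inv (k, y, s, U) ->
    terminates loop body (k, y, s, U).
  move: s; apply: (descent (mu := id) s10) => s s0 IH.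
  apply: loop_ends_same_radius => k0 y U k' Iy h kk' hk'.
  have [ry rs rU /andP[s0' sr'] [yx yZ]] := Iy.
  have rU' : repr_mx repr (inv (prec k') t y) by exact: rinv (prec01 k') rt ry.
  have [lt|ge] := ltP (s / 2) s1.
    apply: terminates_step; suff -> : testMF im out dout k' (pt t) y (s / 2)
        (inv (prec k') t y) 8^-1 by [].
    have -> : 8^-1 = 1 / 8 :> R by lra.
    have s2p : 0 < s / 2 by lra.
    have s2e : 0 < s / 2 < e by rewrite s2p; lra.
    have om := he _ s2e; have := hk'.
    have small : s / 2 < 16^-1 * 8^-1 * r by lra.
    move=> /(_ small) pk'.
    have c1s : c1 * (s / 2) <= c1 by rewrite ler_piMr // ?ltW //; lra.
    have pk1 : prec k' <= c1 * (s / 2) by lra.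
    have yZs : cnorm (y - Z t) <= s / 2 by lra.
    have yZ32 : cnorm (y - Z t) <= s / 2 / 32 by lra.
    apply: pass => //; split=> //; split=> //; first exact: prec01.
    - exact: le_trans pk1 c1s.
    - by rewrite s2p; lra.
    - exact: repr_half.
  apply: IH; [lra | lra |].
  split=> //; [exact: repr_half | by apply/andP; split; lra | by split=> //; lra].
have start : refine_inv (k, x, r, A).
  split=> //; first by rewrite r0 lexx.
  by rewrite subrr cnorm0 (cdistC x); split; first exact: ltW.
have [[[[k1 y1] s1'] U1] w1] := ends r (ltW r0) _ _ _ start.
have step1 S S' : refine_inv S -> loop S -> body S S' -> refine_inv S'.
  by move=> i1 _ bS; have [] := refine_body_inv i1 bS.
have [[ry rs rU /andP[s0 sr'] _] _] := while_invariant step1 w1 start.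
suff [S2 w2] : terminates grow (@enlarge_body R n) (k1, y1, s1', U1).
  by exists S2, (k1, y1, s1', U1).
(* Each doubling adds at least the initial radius [s1'], and the guard keeps the radius at most
   1. *)
have grows : forall s, 0 <= 1 - s -> s1' <= s ->
    terminates grow (@enlarge_body R n) (k1, y1, s, U1).
  apply: (@descent R R (fun s => 1 - s) (fun s => s1' <= s ->
    terminates grow (@enlarge_body R n) (k1, y1, s, U1)) s1' s0) => s _ IH s1s.
  apply: terminates_step => /andP[s21 _].
  by exists (k1, y1, 2 * s, U1) => //; apply: IH; lra.
have [le|lt] := leP s1' 1; first by apply: grows => //; rewrite subr_ge0.
by apply: terminates_step => /andP[]; lra.
Qed.

End Point.

(** If the first loop ran and the final radius were below [c1 / 2], its double would be at most
    [c1], and [test_enlarge] would let the enlarging loop go on. The constant depends on [d] only,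
    not on the box. *)
Lemma refine_radius (Z : R -> 'cV[R[i]]_n) d : 0 < d -> exists2 cst, 0 < cst &
  forall t r x A k S, repr t -> repr_mx repr x -> repr r -> repr_mx repr A ->
    moore_box (Fmap F t) (dFmap F t) (7 / 8) x r A ->
    Fmap F t (Z t) = 0 -> cnorm (Z t - x) <= r ->
    0 <= t <= 1 -> tame F repr inv Z (slope_tol R n) d t -> prec k <= cst ->
    refine im out dout t r A 8^-1 k x S -> Num.min r cst <= S.1.2.
Proof.
move=> d0; have [c1 /andP[c10 c11] enl] :=
  test_enlarge hout hdout hrepr hc hdc impl_arithP impl_invP Z d0.
exists (c1 / 2) => [|t r x A k [[[k1 y] s] U] rt rx rr rA hbox Ft0 Zx t01 ht pk ref]; first lra.
have := refine_spec rt rx rr rA hbox Ft0 Zx ref => /=.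
move=> [[kk1 [ry rs rU] /andP[s0 sm] yZ tst] alt].
rewrite ge_min; case: alt => [-> //|[UE ngrow]]; apply/orP; right.
rewrite leNgt; apply/negP => lt; move/negP: ngrow; apply; apply/andP; split; first lra.
have pk1 := prec_le kk1.
rewrite UE in tst *; have e8 : 8^-1 = 1 / 8 :> R by lra.
rewrite e8 in tst *; apply: enl => //; split=> //; split=> //.
- exact: prec01.
- by lra.
- by apply/andP; split; lra.
- exact: repr_double.
- by split=> //; lra.
Qed.

End Refinement.

(** * The algorithm track *)

Section Tracking.
Variables (R : realType) (n : nat) (F : 'I_n -> mpoly n.+1 R[i]).
Variables (c dc : circuit R n.+1) (out : 'I_n -> node c) (dout : 'I_n -> 'I_n -> node dc).
Hypotheses (hout : forall i, node_poly (out i) = F i)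
  (hdout : forall i j, node_poly (dout i j) = mderiv (lift ord0 j) (F i)).
Variables (repr : set R) (hrepr : representable_numbers repr).
Hypotheses (hc : repr_circuit repr c) (hdc : repr_circuit repr dc).
Variables (im : implementation R n) (him : valid_implementation repr (dFmap F) im).
Variables (zeta : 'cV[R[i]]_n) (I : set R) (Z : R -> 'cV[R[i]]_n).
Hypothesis hZ : continuation F zeta I Z.
Implicit Types (d g h t r cst M : R).

Local Notation ar := (impl_arith im).
Local Notation prec := (impl_prec im).
Local Notation inv := (impl_inv im).

Lemma hull_step (t h : R) : 0 <= h -> lo (hull t (t + h)) = t /\ hi (hull t (t + h)) = t + h.
Proof. by move=> h0; rewrite /= min_l ?max_r // lerDl. Qed.

Lemma in_hull_step (t h s : R) : 0 <= h -> t <= s <= t + h -> in_itv (hull t (t + h)) s.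
Proof. by move=> h0 ts; rewrite /in_itv /mkset; have [-> ->] := hull_step t h0. Qed.

(** Here the gap between 1/8 and 7/8 is spent. The test at index [k1] bounds the exact boxes at [t]
    by [r / 8] and 1/4; widening the parameter to [[t, t + h]] and rounding at index [k] add at most
    [r / 8] and 1/8, and the final addition costs at most 1/4: [1/4 + 3/8 + 1/4 = 7/8]. The exact
    box mediates between the two precisions. *)
Lemma shrink_pass M r0 r1 : 0 < r0 -> exists2 cst, 0 < cst &
  forall k k1 t h x r A, repr t -> repr h -> repr_mx repr x -> repr r -> repr_mx repr A ->
    0 <= t <= 1 -> 0 < h <= cst -> prec k <= cst -> r0 <= r <= r1 ->
    cnorm x <= M -> (forall i j, cabs (A i j) <= M) ->
    testMF im out dout k1 (pt t) x r A 8^-1 ->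
    testMF im out dout k (hull t (t + h)) x r A (7 / 8).
Proof.
have n1 : 0 <= (1 / 4 : R) <= 1 /\ 0 <= (3 / 8 : R) <= 1 by split; lra.
move=> r00; have [B [B1 MB MrB]] : exists B : R, [/\ 1 <= B, M <= B & M + r1 <= B].
  exists (`|M| + `|r1| + 1).
  have := (normr_ge0 M, normr_ge0 r1, ler_norm M, ler_norm r1).
  by move=> [[[? ?] ?] ?]; split; lra.
have har := impl_arithP him.
have [C C1 hC] := newton_box_near out hrepr hc har B.
have [D D1 hD] := slope_box_near dout hrepr hdc har B.
have CD0 : 0 < C + D by lra.
have [C0 D0] : 0 <= C /\ 0 <= D by split; lra.
pose cst := Num.min (1 / 4) (Num.min (r0 / (16 * (C + D))) (16 * (C + D))^-1).
have [c4 cr cD] : [/\ cst <= 1 / 4, cst <= r0 / (16 * (C + D)) & cst <= (16 * (C + D))^-1].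
  by split; rewrite /cst !ge_min lexx ?orbT.
have c0 : 0 < cst.
  have p1 : 0 < r0 / (16 * (C + D)) by apply: divr_gt0; lra.
  have p2 : 0 < (16 * (C + D))^-1 by rewrite invr_gt0; lra.
  by rewrite !lt_min p1 p2 andbT; apply/andP; split => //; lra.
have cCr : (C + D) * cst <= r0 / 16.
  have : (16 * (C + D)) * cst <= r0 by rewrite -ler_pdivlMl ?[_^-1 * _]mulrC //; lra.
  by lra.
have cD1 : (C + D) * cst <= 1 / 16.
  have : (16 * (C + D)) * cst <= 1 by rewrite -ler_pdivlMl ?mulr1 //; lra.
  by lra.
clearbody cst; exists cst => // {CD0 cr cD C1 D1} k k1 t h x r A rt rh rx rr rA /andP[t0 t1] /andP[h0 hc'] pk.
move=> /andP[r0r rr1] xM AM tst; have r'0 : 0 < r by lra.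
have [h0' r0'] := (ltW h0, ltW r'0).
have [uk uk1] := (prec01 him k, prec01 him k1).
have e8 : 0 <= 8^-1 :> R by rewrite invr_ge0.
have [V1 J1] := test_bounds hout hdout hrepr hc hdc har uk1 (repr_pt rt) rx rr rA r'0 e8 tst.
have [lT hT] := hull_step t h0'.
have rT : repr_itv repr (hull t (t + h)) by apply: repr_hull => //; exact: reprD.
have h01 : 0 <= h <= 1 by apply/andP; split; lra.
have bT : bounded_itv B (pt t) by split=> /=; lra.
have Te : isub h (hull t (t + h)) (pt t) by split; rewrite ?lT ?hT /=; lra.
have T0 := isub_refl (pt t) (lexx 0).
have AB i j : cabs (A i j) <= B by have := AM i j; lra.
have self e (X : 'cV[cbox R]_n) : 0 <= e -> forall i, csubx e (X i 0) (X i 0).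
  by move=> e0 i; exact: csubx_refl.
have xB : vbounded B (mxpt x) by apply: vbounded_mxpt; lra.
have vB : vbounded B (vball x r).
  by apply: vboundedW _ (vbounded_vball x r0'); lra.
have wB : vbounded B (vball 0 1 : 'cV[cbox R]_n).
  by apply: vboundedW _ (vbounded_vball 0 ler01); rewrite cnorm0; lra.
have rX := repr_mxpt rx; have rV := repr_vball hrepr rx rr.
have rW := @repr_vball01 _ _ hrepr n.
have := hC _ h _ _ _ _ A uk h01 rT rX rA bT xB AB Te (self _ _ h0').
move=> /vbounded_csubx V2.
have := newton_box_incl out hrepr hc har (prec k) uk1 (repr_pt rt) rX rA T0 (self _ _ (lexx 0)).
move=> /vbounded_csubx V3.
have := hD _ h _ _ _ _ A _ uk h01 rT rV rA rW bT vB AB wB Te (self _ _ h0').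
move=> /vbounded_csubx J2.
have := slope_box_incl dout hrepr hdc har (prec k) uk1 (repr_pt rt) rV rA rW T0
  (self _ _ (lexx 0)) (self _ _ (lexx 0)).
move=> /vbounded_csubx J3.
have hp : h + prec k <= 2 * cst by lra.
have Ch : C * (h + prec k) <= C * (2 * cst) by rewrite ler_wpM2l.
have Dh : D * (h + prec k) <= D * (2 * cst) by rewrite ler_wpM2l.
have C0c : 0 <= C * cst by rewrite mulr_ge0 // ltW.
have D0c : 0 <= D * cst by rewrite mulr_ge0 // ltW.
have V4 : vbounded (1 / 4 * r) (newton_box out ar (prec k) (hull t (t + h)) (mxpt x) A).
  by apply: vboundedW _ (V2 _ (V3 _ V1)); clear -hout hdout him hZ hrepr hc hdc Ch C0c D0c cCr r0r rr1; lra.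
have J4 : vbounded (3 / 8) (slope_box dout ar (prec k) (hull t (t + h)) (vball x r) A (vball 0 1)).
  have J5 := J2 _ (J3 _ J1).
  have le : 2 * 8^-1 + 0 + D * (h + prec k) <= 3 / 8.
    clear -hout hdout him hZ hrepr hc hdc Dh C0c D0c cD1.
    lra.
  exact: (vboundedW le J5).
by apply: (test_complete har uk r'0 n1.1 n1.2 _ V4 J4); clear V4 J4 V1 J1 V2 V3 J2 J3; lra.
Qed.

(** Contraction at [D^-1 v] shows that [A v] has norm at most 15/8 of that of [D^-1 v]. Hence [A] is
    bounded independently of the box, as a uniform constant in [shrink_pass] requires. *)
Lemma moore_entries_bound d t x r A : 0 < d -> tame F repr inv Z (slope_tol R n) d t ->
  dFmap F t (Z t) \in unitmx ->
  moore_box (Fmap F t) (dFmap F t) (7 / 8) x r A -> cnorm (Z t - x) <= r ->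
  forall i j, cabs (A i j) <= 2 * (n%:R * 2 * d^-1).
Proof.
move=> d0 [_ Db _] uD /moore_contracting cA Zx.
have d'0 : 0 <= d^-1 by rewrite invr_ge0 ltW.
have B0 : 0 <= n%:R * 2 * d^-1 by rewrite !mulr_ge0.
apply: entry_le_cnorm => [|v v1]; first lra.
set D := dFmap F t (Z t) in uD Db cA; have := cA (Z t) (invmx D *m v) Zx.
rewrite -/D mulmxBl mul1mx -mulmxA mulKVmx // cdistC.
have triangle := ler_cnormD (A *m v) (invmx D *m v).
have h : cnorm (invmx D *m v) <= n%:R * 2 * d^-1 * cnorm v by exact: cnorm_mulmx.
have h' : n%:R * 2 * d^-1 * cnorm v <= n%:R * 2 * d^-1 by rewrite ler_piMr.
move: triangle h {Zx v1}; move: (cnorm (A *m v)) (cnorm (invmx D *m v)) (cnorm (_ - _)).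
by move=> a b e; lra.
Qed.

Section InnerLoop.
Variables (t r : R) (x : 'cV[R[i]]_n) (A : 'M[R[i]]_n).

Local Notation inner := (fun S : nat * R =>
  let: (k, h) := S in ~~ testMF im out dout k (hull t (t + h)) x r A (7 / 8)).

Lemma shrink_inv k h k' h' : while inner (@shrink_body R n im) (k, h) (k', h') ->
  0 < h -> repr h -> [/\ (k <= k')%N, 0 < h', repr h' &
    testMF im out dout k' (hull t (t + h')) x r A (7 / 8)].
Proof.
move=> w h0 rh.
pose Inv (S : nat * R) := [/\ (k <= S.1)%N, 0 < S.2 & repr S.2].
have stepI S S' : Inv S -> inner S -> @shrink_body R n im S S' -> Inv S'.
  move: S S' => [k1 h1] [k2 h2] [/= kk1 h10 rh1] _ [-> ->]; split=> /=.
  - by case: ifP => // _; exact: leqW.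
  - by lra.
  - exact: repr_half.
have [[/= kk' h'0 rh'] /negPn tst] := while_invariant stepI w (And3 (leqnn k) h0 rh).
by [].
Qed.

(* A failed test with [h / 2 < g < prec K] raises the precision as long as the index is
   below [K], hence the factor [2 ^- k]. *)
Lemma shrink_lower_bound g K k h k' h' :
  while inner (@shrink_body R n im) (k, h) (k', h') -> 0 < g < prec K ->
  ((k < K)%N -> g / 2 ^+ k <= h) -> (k' < K)%N -> g / 2 ^+ k' <= h'.
Proof.
move=> w /andP[g0 gK] start.
pose Inv (S : nat * R) := (S.1 < K)%N -> g / 2 ^+ S.1 <= S.2.
have stepI S S' : Inv S -> inner S -> @shrink_body R n im S S' -> Inv S'.
  move: S S' => [k1 h1] [k2 h2] I1 _ [-> ->]; rewrite /Inv /=.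
  have pow1 : 1 <= 2 ^+ k1 :> R by rewrite exprn_ege1 // ler1n.
  case: ifP => [_ lt|le lt].
    have := I1 (ltnW lt) => /= I1'.
    by rewrite exprS invfM mulrCA mulrC; have : g / 2 ^+ k1 <= h1 by []; lra.
  have pk : prec K <= prec k1 by apply: (prec_le him); exact: ltnW.
  apply: (@le_trans _ _ g); first by rewrite ler_pdivrMr ?ler_peMr //; lra.
  by move/negbT: le; rewrite -leNgt; lra.
by have [] := while_invariant stepI w start.
Qed.

(** From index [K] on, a test can only fail for [h > 2 g], so halving leaves [h] above [g]. Below
    [K], a halving under [g] also raises the index, and the exponent keeps pace; it therefore never
    has to exceed [K]. *)
Lemma shrink_lower_bound_pass g K k h k' h' :
  while inner (@shrink_body R n im) (k, h) (k', h') -> 0 < g < prec K ->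
  (forall k0 h0, (K <= k0)%N -> 0 < h0 <= 2 * g -> repr h0 ->
     testMF im out dout k0 (hull t (t + h0)) x r A (7 / 8)) ->
  0 < h -> repr h -> g / 2 ^+ minn k K <= h -> g / 2 ^+ minn k' K <= h'.
Proof.
move=> w /andP[g0 gK] pass h0 rh start.
pose Inv (S : nat * R) := [/\ g / 2 ^+ minn S.1 K <= S.2, 0 < S.2 & repr S.2].
have stepI S S' : Inv S -> inner S -> @shrink_body R n im S S' -> Inv S'.
  move: S S' => [k1 h1] [k2 h2] [/= I1 h10 rh1] fail [-> ->]; rewrite /Inv /=.
  split; [|lra|exact: repr_half].
  have le_g m : g <= h1 / 2 -> g / 2 ^+ m <= h1 / 2.
    move=> gh; have pow1 : 1 <= 2 ^+ m :> R by rewrite exprn_ege1 // ler1n.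
    by apply: le_trans gh; rewrite ler_pdivrMr ?ler_peMr //; lra.
  have [Kk|kK] := leqP K k1.
    apply: le_g; have [le|lt] := leP h1 (2 * g); last lra.
    by rewrite pass // ?h10 in fail.
  have [ge|lt] := leP g (h1 / 2); first exact: le_g.
  have pk : prec K <= prec k1 by apply: (prec_le him); exact: ltnW.
  rewrite ifT; last by lra.
  rewrite (minn_idPl kK); move: I1; rewrite (minn_idPl (ltnW kK)) => I1.
  by rewrite exprS invfM mulrCA mulrC; lra.
by have [[]] := while_invariant stepI w (And3 start h0 rh).
Qed.

Lemma shrink_terminates cst : 0 < cst ->
  (forall k h, prec k <= cst -> 0 < h <= cst -> repr h ->
     testMF im out dout k (hull t (t + h)) x r A (7 / 8)) ->
  forall k h, 0 < h -> repr h -> exists k' h', while inner (@shrink_body R n im) (k, h) (k', h').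
Proof.
move=> c0 pass; have [K hK] := prec_small him c0.
have /andP[pK _] := prec01 him K.
(* Once [h <= 2 g], a failed test at an index below [K] has [h / 2 < prec K] and so raises the
   index, while from [K] on the test passes. *)
pose g := Num.min (cst / 2) (prec K / 2).
have g0 : 0 < g by rewrite lt_min; apply/andP; split; lra.
have [gc gK] : g <= cst / 2 /\ g <= prec K / 2 by rewrite !ge_min !lexx orbT.
pose body S S' := @shrink_body R n im S S'.
have small m : forall k h, (K - k <= m)%N -> 0 < h <= 2 * g -> repr h ->
    terminates inner body (k, h).
  elim: m => [|m IH] k h Km /andP[h0 hg] rh; apply: terminates_step => fail.
    move: Km; rewrite leqn0 subn_eq0 => Kk.
    have pk : prec k <= cst by apply: ltW; exact: hK.
    by rewrite pass // ?h0 in fail; lra.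
  exists (if prec k > h / 2 then k.+1 else k, h / 2) => //.
  have [Kk|kK] := leqP K k.
    have pk : prec k <= cst by apply: ltW; exact: hK.
    by rewrite pass // ?h0 in fail; lra.
  have pk : prec K <= prec k by apply: (prec_le him); exact: ltnW.
  rewrite ifT; last by lra.
  apply: IH; [by move: Km; rewrite subnS; case: (K - k)%N | by apply/andP; split; lra |].
  exact: repr_half.
have all_h : forall kh : nat * R, 0 <= kh.2 -> 0 < kh.2 -> repr kh.2 -> terminates inner body kh.
  apply: (@descent R _ (fun kh : nat * R => kh.2) _ g g0) => -[k h] /= _ IH h0 rh.
  have [le|lt] := leP h (2 * g); first by apply: (small (K - k)%N) => //; rewrite h0.
  apply: terminates_step => _; exists (if prec k > h / 2 then k.+1 else k, h / 2) => //.
  by apply: IH => /=; [lra | lra | lra | exact: repr_half].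
move=> k h h0 rh; have [[k' h'] w] := all_h (k, h) (ltW h0) h0 rh.
by exists k', h'.
Qed.

End InnerLoop.
End Tracking.

Section TrackLoop.
Variables (R : realType) (n : nat) (F : 'I_n -> mpoly n.+1 R[i]).
Variables (c dc : circuit R n.+1) (out : 'I_n -> node c) (dout : 'I_n -> 'I_n -> node dc).
Hypotheses (hout : forall i, node_poly (out i) = F i)
  (hdout : forall i j, node_poly (dout i j) = mderiv (lift ord0 j) (F i)).
Variables (repr : set R) (hrepr : representable_numbers repr).
Hypotheses (hc : repr_circuit repr c) (hdc : repr_circuit repr dc).
Variables (im : implementation R n) (him : valid_implementation repr (dFmap F) im).
Variables (zeta : 'cV[R[i]]_n) (I : set R) (Z : R -> 'cV[R[i]]_n).
Hypothesis hZ : continuation F zeta I Z.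

Local Notation prec := (impl_prec im).
Local Notation running := (fun S : tstate R n => let: (_, t, _) := S in t < 1).
Local Notation body := (track_body im out dout).
Local Notation inner t r x A := (fun S : nat * R =>
  let: (k, h) := S in ~~ testMF im out dout k (hull t (t + h)) x r A (7 / 8)).

Definition tracked_box t x r A : Prop :=
  [/\ I t, cnorm (Z t - x) <= r & moore_box (Fmap F t) (dFmap F t) (7 / 8) x r A].

(* The last step of [t] may exceed 1. *)
Definition track_inv (S : tstate R n) : Prop :=
  let: (_, x, r, A, t, h) := S in
  [/\ [/\ repr_mx repr x, repr r & repr_mx repr A], repr t /\ repr h, 0 <= t, 0 < h &
      tracked_box (Num.min t 1) x r A].

Lemma refine_result k x r A t k1 x1 r1 A1 :
  repr_mx repr x -> repr r -> repr_mx repr A -> repr t -> tracked_box t x r A ->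
  refine im out dout t r A 8^-1 k x (k1, x1, r1, A1) ->
  [/\ (k <= k1)%N, [/\ repr_mx repr x1, repr r1 & repr_mx repr A1],
      0 < r1 <= Num.max r 1, tracked_box t x1 r1 A1 &
      testMF im out dout k1 (pt t) x1 r1 A1 8^-1].
Proof.
move=> rx rr rA rt [It Zx hbox] ref; have [_ _ _ zeroZ _] := hZ; have [Ft0 _] := zeroZ t It.
have := refine_spec hout hrepr hc him rt rx rr rA hbox Ft0 Zx ref.
move=> /= [[kk1 [rx1 rr1 rA1] r1b xZ tst] _].
have /andP[r10 _] := r1b; have e8 : 0 <= 8^-1 :> R by rewrite invr_ge0.
have le : 8^-1 <= 7 / 8 :> R by lra.
have box1 := test_moore hout hdout hrepr hc hdc (impl_arithP him) (prec01 him k1) (repr_pt rt)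
  rx1 rr1 rA1 r10 e8 tst (lo_in (pt t)).
split; [exact: kk1 | by split | exact: r1b | split | exact: tst].
- exact: It.
- by rewrite cdistC.
- exact: mooreW le box1.
Qed.

Lemma track_bodyP k x r A t h S' :
  track_inv (k, x, r, A, t, h) -> t < 1 -> body (k, x, r, A, t, h) S' ->
  exists k1 x1 r1 A1 k2 h2,
  [/\ refine im out dout t r A 8^-1 k x (k1, x1, r1, A1),
      while (inner t r1 x1 A1) (@shrink_body R n im) (k1, 2 * h) (k2, h2),
      S' = (k2, x1, r1, A1, t + h2, h2), track_inv S' &
      [/\ (k <= k1)%N, (k1 <= k2)%N & r1 <= Num.max r 1]].
Proof.
move=> [[rx rr rA] [rt rh] t0 h0] box t1; rewrite (min_l (ltW t1)) in box.
move=> [k1 [x1 [r1 [A1 [k2 [h2 [ref w ->]]]]]]].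
exists k1, x1, r1, A1, k2, h2.
have [kk1 [rx1 rr1 rA1] /andP[r10 r1m] [It Zx1 _] tst] := refine_result rx rr rA rt box ref.
have h20 : 0 < 2 * h by lra.
have [k12 h2p rh2 tst2] := shrink_inv hrepr w h20 (repr_double hrepr rh).
have [_ ->] := hull_step t (ltW h2p).
have e8 : 0 <= 7 / 8 :> R by lra.
have rt2 : repr (t + h2) by exact: reprD.
have t20 : 0 <= t + h2 by lra.
have rT : repr_itv repr (hull t (t + h2)) by exact: repr_hull.
have box2 s : t <= s <= t + h2 -> moore_box (Fmap F s) (dFmap F s) (7 / 8) x1 r1 A1.
  move=> ts; apply: (test_moore hout hdout hrepr hc hdc (impl_arithP him) (prec01 him k2) rT
    rx1 rr1 rA1 r10 e8 tst2).
  exact: in_hull_step (ltW h2p) ts.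
(* If the step passes 1, the parameter 1 itself still lies in the tested interval. *)
have end_in : t <= Num.min (t + h2) 1 <= t + h2.
  by rewrite le_min ge_min lexx (ltW t1) andbT lerDl ltW.
have [I2 Z2] := extension hZ It Zx1 box2 end_in.
have box' := box2 _ end_in.
have inv' : track_inv (k2, x1, r1, A1, t + h2, h2).
  by split; [split | split | | | split].
by split; [exact: ref | exact: w | | exact: inv' | split].
Qed.

Lemma track_inv_step S S' : track_inv S -> running S -> body S S' -> track_inv S'.
Proof.
move: S => [[[[[k x] r] A] t] h] inv t1 b.
by have [k1 [x1 [r1 [A1 [k2 [h2 [_ _ _ inv' _]]]]]]] := track_bodyP inv t1 b.
Qed.

Lemma track_inv_start x r A : repr_mx repr x -> repr r -> repr_mx repr A ->
  tracked_box 0 x r A -> track_inv (0%N, x, r, A, 0, 1).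
Proof.
move=> rx rr rA box; split; [by split | | exact: lexx | exact: ltr01 |].
  by split; [exact: repr0 | exact: repr1].
by rewrite (min_l ler01).
Qed.

Lemma track_spec x r A x' r' A' : repr_mx repr x -> repr r -> repr_mx repr A ->
  tracked_box 0 x r A -> track im out dout x r A x' r' A' -> tracked_box 1 x' r' A'.
Proof.
move=> rx rr rA box [k' [t' [h' w]]].
have start := track_inv_start rx rr rA box.
have [[_ _ _ _ box']] := while_invariant track_inv_step w start.
by rewrite -leNgt => t1; rewrite (min_r t1) in box'.
Qed.

Section Termination.
Hypothesis I01 : forall t, 0 <= t <= 1 -> I t.
Variable d : R.
Hypothesis d_gt0 : 0 < d.
Hypothesis hd : forall t, 0 <= t <= 1 -> tame F repr (impl_inv im) Z (slope_tol R n) d t.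

Lemma tracked_bounds t x r A : 0 <= t <= 1 -> tracked_box t x r A ->
  cnorm x <= d^-1 + r /\ forall i j, cabs (A i j) <= 2 * (n%:R * 2 * d^-1).
Proof.
move=> t01 [It Zx hbox]; have [_ _ _ zeroZ _] := hZ; have [_ uD] := zeroZ t It.
split; last exact: moore_entries_bound d_gt0 (hd t01) uD hbox Zx.
by have [Zd _ _] := hd t01; have := ler_cnormD x (Z t); rewrite cdistC; lra.
Qed.

Lemma track_body_exists S : track_inv S -> running S -> exists S', body S S'.
Proof.
move: S => [[[[[k x] r] A] t] h] [[rx rr rA] [rt rh] t0 h0 box] t1.
rewrite (min_l (ltW t1)) in box; have [It Zx hbox] := box.
have t01 : 0 <= t <= 1 by rewrite t0 ltW.
have [_ _ _ zeroZ _] := hZ; have [Ft0 _] := zeroZ t It.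
have [[[[k1 x1] r1] A1] ref] := refine_terminates hout hdout hrepr hc hdc him rt rx rr rA
  hbox Ft0 Zx t01 k d_gt0 (hd t01).
have [_ [rx1 rr1 rA1] /andP[r10 _] box1 tst] := refine_result rx rr rA rt box ref.
have [xM AM] := tracked_bounds t01 box1.
pose M := Num.max (d^-1 + r1) (2 * (n%:R * 2 * d^-1)).
(* For the termination of a single iteration the constant may depend on the box just refined, so
   both radius bounds are [r1]. *)
have [cst cst0 pass] := shrink_pass hout hdout hrepr hc hdc him M r1 r10.
have h20 : 0 < 2 * h by lra.
have [k2 [h2 w]] : exists k2 h2, while (inner t r1 x1 A1) (@shrink_body R n im)
    (k1, 2 * h) (k2, h2).
  apply: (shrink_terminates hrepr him cst0) => // [k0 h' pk h'b rh'|]; last exact: repr_double.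
  apply: (pass k0 k1) => //.
  - by rewrite !lexx.
  - by rewrite le_max xM.
  - by move=> i j; rewrite le_max AM orbT.
by exists (k2, x1, r1, A1, hi (hull t (t + h2)), h2), k1, x1, r1, A1, k2, h2.
Qed.

(** From index [K] on, [radius] keeps all radii above [min r0 cst], and they never exceed
    [max r0 1]. A single constant of [shrink_pass] is then valid in all later iterations, which
    bounds the step from below and makes [1 - t] a measure. *)
Lemma track_ends_late cst K : (forall k, (K <= k)%N -> prec k <= cst) -> 0 < cst ->
  (forall t r x A k S, repr t -> repr_mx repr x -> repr r -> repr_mx repr A ->
    moore_box (Fmap F t) (dFmap F t) (7 / 8) x r A ->
    Fmap F t (Z t) = 0 -> cnorm (Z t - x) <= r ->
    0 <= t <= 1 -> tame F repr (impl_inv im) Z (slope_tol R n) d t -> prec k <= cst ->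
    refine im out dout t r A 8^-1 k x S -> Num.min r cst <= S.1.2) ->
  forall S, track_inv S -> (K <= S.1.1.1.1.1)%N -> terminates running body S.
Proof.
move=> hK cst0 radius [[[[[k0 x0] r0] A0] t0] h0] inv0 /= Kk0.
have [_ _ _ h00 [_ _ [r00 _]]] := inv0.
pose rmin := Num.min r0 cst; pose rmax := Num.max r0 1.
have rmin0 : 0 < rmin by rewrite lt_min r00.
pose M := Num.max (d^-1 + rmax) (2 * (n%:R * 2 * d^-1)).
have [e e0 pass] := shrink_pass hout hdout hrepr hc hdc him M rmax rmin0.
have [K1 hK1] := prec_small him e0; have /andP[pK1 _] := prec01 him K1.
(* [2 g <= e] makes the tests pass from [K1] on, [g < prec K1] ties small steps to an increase of
   the precision before [K1], and [g <= h0] starts the invariant. *)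
pose g := Num.min (Num.min (e / 2) (prec K1 / 2)) h0.
have g0 : 0 < g by rewrite !lt_min h00 andbT; apply/andP; split; lra.
have [ge gK gh] : [/\ g <= e / 2, g <= prec K1 / 2 & g <= h0].
  by split; rewrite !ge_min lexx ?orbT.
have g2e : 2 * g <= e by lra.
have gK1 : 0 < g < prec K1 by rewrite g0; lra.
have pow2 m : 1 <= 2 ^+ m :> R by rewrite exprn_ege1 // ler1n.
have gpow m : g / 2 ^+ m <= g by rewrite ler_pdivrMr ?ler_peMr // ?ltW // (lt_le_trans ltr01).
have gmono m m' : (m <= m')%N -> g / 2 ^+ m' <= g / 2 ^+ m.
  move=> mm'; rewrite ler_pM2l // lef_pV2 ?posrE ?exprn_gt0 //.
  by rewrite ler_weXn2l // ler1n.
have step0 : 0 < g / 2 ^+ K1 by rewrite divr_gt0 // exprn_gt0.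
pose mu (S : tstate R n) := 1 - S.1.2.
pose late (S : tstate R n) := [/\ track_inv S, (K <= S.1.1.1.1.1)%N,
  rmin <= S.1.1.1.2 <= rmax & g / 2 ^+ minn S.1.1.1.1.1 K1 <= S.2].
suff H S : late S -> terminates running body S.
  apply: H; split=> //=; first by rewrite ge_min le_max !lexx.
  exact: le_trans (gpow _) gh.
have trivial_end (S' : tstate R n) : mu S' < 0 -> terminates running body S'.
  move: S' => [[[[[k x] r] A] t] h]; rewrite /mu /= => lt0.
  by apply: terminates_step; lra.
have [lt0 _|] := ltP (mu S) 0; first exact: trivial_end.
move: S; apply: (descent step0) => S _ IH lateS; apply: terminates_step => run.
have [invS KS rS hS] := lateS.
have [S' b] := track_body_exists invS run; exists S' => //.
move: S invS KS rS hS run b IH {lateS} => [[[[[k x] r] A] t] h] invS /= KS /andP[rm rM] hS t1 b IH.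
have [k1 [x1 [r1 [A1 [k2 [h2 [ref w ES' invS' [kk1 k12 r1m]]]]]]]] := track_bodyP invS t1 b.
have [[rx rr rA] [rt rh] t_ge0 h_gt0 box] := invS.
rewrite (min_l (ltW t1)) in box; have [It Zx hbox] := box.
have t01 : 0 <= t <= 1 by rewrite t_ge0 ltW.
have [_ _ _ zeroZ _] := hZ; have [Ft0 _] := zeroZ t It.
have [_ [rx1 rr1 rA1] /andP[r10 _] box1 tst] := refine_result rx rr rA rt box ref.
have r1min : rmin <= r1.
  apply: le_trans (radius t r x A k _ rt rx rr rA hbox Ft0 Zx t01 (hd t01) (hK k KS) ref).
  by rewrite le_min rm ge_min lexx orbT.
have r1max : r1 <= rmax.
  by apply: le_trans r1m _; rewrite ge_max rM le_max lexx orbT.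
have [xM AM] := tracked_bounds t01 box1.
have h2_ge : g / 2 ^+ minn k2 K1 <= h2.
  apply: (shrink_lower_bound_pass hrepr him w gK1).
  - move=> k' h' Kk' /andP[h'0 h'g] rh'; apply: (pass k' k1) => //.
    + by rewrite h'0 (le_trans h'g).
    + by apply: ltW; exact: hK1.
    + by rewrite r1min.
    + by rewrite le_max (le_trans xM) // lerD2l.
    + by move=> i j; rewrite le_max AM orbT.
  - by rewrite mulr_gt0.
  - exact: repr_double.
  (* [refine] may have raised the index, which only weakens the bound; doubling [h] preserves it. *)
  apply: (@le_trans _ _ h); last by rewrite ler_peMl ?ler1n // ltW.
  apply: le_trans hS; apply: gmono.
  by rewrite leq_min geq_minr andbT (leq_trans (geq_minl _ _) kk1).
have h2_step : g / 2 ^+ K1 <= h2.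
  by apply: le_trans h2_ge; apply: gmono; exact: geq_minr.
subst S'; have [lt0|ge0] := ltP (mu (k2, x1, r1, A1, t + h2, h2)) 0; first exact: trivial_end.
apply: IH => //; first by rewrite /mu /= opprD addrA lerD2l lerN2.
split=> //=; last by rewrite r1min.
exact: leq_trans KS (leq_trans kk1 k12).
Qed.

(** While the index is below [K], nothing is known about the radii, but [h] is at least
    [g / 2 ^+ K]. So either [t] gets past 1 or the index reaches [K], from where [late_ends] takes
    over. *)
Lemma track_ends_early K :
  (forall S, track_inv S -> (K <= S.1.1.1.1.1)%N -> terminates running body S) ->
  forall S, track_inv S -> terminates running body S.
Proof.
move=> late_ends [[[[[k0 x0] r0] A0] t0] h0] inv0.
have [_ _ _ h00 _] := inv0; have /andP[pK _] := prec01 him K.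
pose g := Num.min (prec K / 2) h0.
have g0 : 0 < g by rewrite lt_min h00 andbT; lra.
have [gK gh] : g <= prec K / 2 /\ g <= h0 by rewrite !ge_min !lexx orbT.
have pow2 m : 1 <= 2 ^+ m :> R by rewrite exprn_ege1 // ler1n.
have gpow m : g / 2 ^+ m <= g by rewrite ler_pdivrMr ?ler_peMr // ?ltW // (lt_le_trans ltr01).
have gmono m m' : (m <= m')%N -> g / 2 ^+ m' <= g / 2 ^+ m.
  move=> mm'; rewrite ler_pM2l // lef_pV2 ?posrE ?exprn_gt0 //.
  by rewrite ler_weXn2l // ler1n.
have step0 : 0 < g / 2 ^+ K by rewrite divr_gt0 // exprn_gt0.
pose mu (S : tstate R n) := 1 - S.1.2.
pose early (S : tstate R n) := track_inv S /\
  ((S.1.1.1.1.1 < K)%N -> g / 2 ^+ S.1.1.1.1.1 <= S.2).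
suff H S : early S -> terminates running body S.
  by apply: H; split=> //= _; exact: le_trans (gpow _) gh.
have trivial_end (S' : tstate R n) : mu S' < 0 -> terminates running body S'.
  move: S' => [[[[[k x] r] A] t] h]; rewrite /mu /= => lt0.
  by apply: terminates_step; lra.
have [lt0 _|] := ltP (mu S) 0; first exact: trivial_end.
move: S; apply: (descent step0) => S _ IH [invS hS]; apply: terminates_step => run.
have [S' b] := track_body_exists invS run; exists S' => //.
move: S invS hS run b IH => [[[[[k x] r] A] t] h] invS /= hS t1 b IH.
have [k1 [x1 [r1 [A1 [k2 [h2 [_ w ES' invS' [kk1 k12 _]]]]]]]] := track_bodyP invS t1 b.
have [_ _ _ h_gt0 _] := invS.
subst S'; have [Kk2|k2K] := leqP K k2; first exact: late_ends.
have gK1 : 0 < g < prec K by rewrite g0; lra.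
have h2_ge : g / 2 ^+ k2 <= h2.
  apply: (shrink_lower_bound him w gK1) => // k1K.
  apply: (@le_trans _ _ h); last lra.
  by apply: le_trans (hS (leq_ltn_trans kk1 k1K)); exact: gmono.
have h2_step : g / 2 ^+ K <= h2 by apply: le_trans h2_ge; apply: gmono; exact: ltnW.
have [lt0|ge0] := ltP (mu (k2, x1, r1, A1, t + h2, h2)) 0; first exact: trivial_end.
by apply: IH => //; rewrite /mu /= opprD addrA lerD2l lerN2.
Qed.

End Termination.

Lemma track_terminates x r A : (forall t, 0 <= t <= 1 -> I t) ->
  repr_mx repr x -> repr r -> repr_mx repr A -> tracked_box 0 x r A ->
  exists x' r' A', track im out dout x r A x' r' A'.
Proof.
move=> I01 rx rr rA box.
have [d d0 hd] := tame_uniform hdout (impl_invP him) hZ (slope_tol_gt0 R n) I01.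
have [cst cst0 radius] := refine_radius hout hdout hrepr hc hdc him Z d0.
have [K hK] := prec_small him cst0.
have start := track_inv_start rx rr rA box.
have late := track_ends_late d0 hd (fun k Kk => ltW (hK k Kk)) cst0 radius.
have [[[[[[k' x'] r'] A'] t'] h'] w] := track_ends_early d0 hd late start.
by exists x', r', A', k', t', h'.
Qed.

End TrackLoop.

Theorem theorem5p1 (R : realType) (repr : set R)
  (hrepr : representable_numbers repr)
  (n : nat) (F : 'I_n -> mpoly n.+1 R[i])
  (* circuits for F and for its differential with respect to x *)
  (c dc : circuit R n.+1)
  (out : 'I_n -> node c) (dout : 'I_n -> 'I_n -> node dc)
  (hc : repr_circuit repr c) (hdc : repr_circuit repr dc)
  (hout : forall i, node_poly (out i) = F i)
  (hdout : forall i j, node_poly (dout i j) = mderiv (lift ord0 j) (F i))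
  (im : implementation R n)
  (him : valid_implementation repr (dFmap F) im)
  (x : 'cV[R[i]]_n) (r : R) (A : 'M[R[i]]_n)
  (hx : repr_mx repr x) (hr : repr r) (hA : repr_mx repr A)
  (hbox : moore_box (Fmap F 0) (dFmap F 0) (7 / 8) x r A)
  (zeta : 'cV[R[i]]_n) (hzeta : associated_zero (Fmap F 0) x r zeta)
  (I : set R) (Z : R -> 'cV[R[i]]_n) (hZ : continuation F zeta I Z) :
  ((exists x' r' A', track im out dout x r A x' r' A') <-> I 1) /\
  (forall x' r' A', track im out dout x r A x' r' A' ->
     moore_box (Fmap F 1) (dFmap F 1) (7 / 8) x' r' A' /\
     associated_zero (Fmap F 1) x' r' (Z 1)).
Proof.
have [[_ itvI I0] _ Z0 zeroZ _] := hZ.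
have start : tracked_box F I Z 0 x r A by split=> //; rewrite Z0; case: hzeta => -[].
have spec x' r' A' : track im out dout x r A x' r' A' -> tracked_box F I Z 1 x' r' A'.
  exact: (track_spec hout hdout hrepr hc hdc him hZ hx hr hA start).
split; last first.
  move=> x' r' A' /spec[I1 Z1x box1]; split=> //; have [F1 _] := zeroZ 1 I1.
  split=> // z [Fz zx]; symmetry.
  have lt1 : 7 / 8 < 1 :> R by lra.
  exact: (zero_unique F1 Z1x (moore_contracting box1) lt1 Fz zx).
split=> [[x' [r' [A' /spec[]]]] //|I1].
apply: (track_terminates hout hdout hrepr hc hdc him hZ _ hx hr hA start) => t /andP[t0 t1].
by apply: (itvI 0 1) => //; rewrite t0.
Qed.
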